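(* Let $\mathcal{B}=\{B_t\}_{t\in G}$ be a Banach *-algebraic bundle over an LCH group $G$, let $H\leqslant G$ and let $T\colon \mathcal{B}_H\to \mathbb{B}(Y)$ be a *-representation of the reduction $\mathcal{B}_H=\{B_t\}_{t\in H}$ on a Hilbert space $Y$. Then the following are equivalent: (1) $T$ is $\mathcal{B}$-positive. (2) For every coset $\alpha\in G/H$, every positive integer $n$, all $b_1,\ldots,b_n\in \mathcal{B}_\alpha$ and all $\xi_1,\ldots,\xi_n\in Y$, $\sum_{i,j=1}^n\langle \xi_i,T_{b_i^*b_j}\xi_j\rangle\geq 0$. (3) The restriction $T|_{B_e}$ is $\mathcal{B}$-positive, that is to say, $\langle \xi,T_{b^*b}\xi\rangle\geq 0$ for all $b\in\mathcal{B}$ and $\xi\in Y$. Besides, the three conditions above hold if $\mathcal{B}$ is a Fell bundle.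
   Context: All groups are locally compact Hausdorff (LCH); $H\leqslant G$ means $H$ is a closed subgroup of $G$; $\Delta_G,\Delta_H$ are the modular functions and $dt$ denotes integration with respect to a fixed left Haar measure. Inner products are linear in the second variable. A Banach *-algebraic bundle $\mathcal{B}=\{B_t\}_{t\in G}$ (Fell) is a continuous Banach bundle over $G$ with continuous associative multiplication, bilinear on fibres, $B_sB_t\subset B_{st}$, $\|ab\|\le\|a\|\|b\|$, and continuous conjugate-linear isometric involution with $B_s^*\subset B_{s^{-1}}$, $(ab)^*=b^*a^*$, $a^{**}=a$. It is a Fell bundle if moreover $\|b^*b\|=\|b\|^2$ and $b^*b$ is positive in the C*-algebra $B_e$ for all $b\in\mathcal{B}$ ($e$ is the unit of $G$). For $S\subset G$ closed, $\mathcal{B}_S:=\{B_t\}_{t\in S}$. $C_c(\mathcal{B})$ is the *-algebra of compactly supported continuous sections with $f*g(t)=\int_G f(s)g(s^{-1}t)\,ds$ and $f^*(t)=\Delta_G(t)^{-1}f(t^{-1})^*$. A *-representation of a Banach *-algebraic bundle on a Hilbert space $Y$ is a map $T$ from the bundle to $\mathbb{B}(Y)$, linear on fibres, with $T_{ab}=T_aT_b$, $T_{a^*}=T_a^*$, and such that $b\mapsto\langle T_b\xi,\eta\rangle$ is continuous for all $\xi,\eta$. Its integrated form is $T_f\xi=\int T_{f(t)}\xi\,dt$. Define $p\colon C_c(\mathcal{B})\to C_c(\mathcal{B}_H)$ by $p(f)(t)=\Delta_G(t)^{1/2}\Delta_H(t)^{-1/2}f(t)$. A *-representation $T\colon\mathcal{B}_H\to\mathbb{B}(Y)$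 is $\mathcal{B}$-positive if its integrated form satisfies $\langle \xi,T_{p(f^**f)}\xi\rangle\geq 0$ for all $\xi\in Y$ and $f\in C_c(\mathcal{B})$. *)

(* Defs.v *)
From HB Require Import structures.
From mathcomp Require Import all_boot all_order all_algebra.
From mathcomp Require Import all_classical all_reals all_analysis.
From mathcomp Require Import complex.

Set Implicit Arguments.
Unset Strict Implicit.
Unset Printing Implicit Defensive.

Import Order.TTheory GRing.Theory Num.Theory numFieldNormedType.Exports.

Local Open Scope classical_set_scope.
Local Open Scope ring_scope.

HB.mixin Record isTopologicalGroup G of Group G & Topological G := {
  mulg_continuous : continuous (fun p : G * G => (p.1 * p.2)%g) ;
  invg_continuous : continuous (fun x : G => (x^-1)%g) }.

#[short(type="topGroupType")]
HB.structure Definition TopGroup :=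
  {G of isTopologicalGroup G & Group G & Topological G}.

(* Measurable types of the library are pointed. *)
HB.instance Definition _ (G : topGroupType) :=
  isPointed.Build (TopGroup.sort G) 1%g.

Definition lch (X : topologicalType) : Prop :=
  hausdorff_space X /\ locally_compact [set: X].

Record closedSubgroup (G : topGroupType) := ClosedSubgroup {
  subgroup_set :> set G ;
  subgroup_closed : closed subgroup_set ;
  subgroup1 : subgroup_set 1%g ;
  subgroupM : forall x y,
    subgroup_set x -> subgroup_set y -> subgroup_set (x * y)%g ;
  subgroupV : forall x, subgroup_set x -> subgroup_set (x^-1)%g }.

Definition subgroup_type (G : topGroupType) (H : closedSubgroup G) : Type :=
  set_type H.

Section SubgroupType.
Variables (G : topGroupType) (H : closedSubgroup G).

HB.instance Definition _ := Topological.copy (subgroup_type H) (set_type H).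
HB.instance Definition _ := [isSub of subgroup_type H for
  (@sval G (fun x => x \in subgroup_set H))].

Lemma subgroup_group_closed :
  group_closed (fun x : G => x \in subgroup_set H).
Proof.
split; first exact/mem_set/subgroup1.
move=> x y /set_mem Hx /set_mem Hy; apply/mem_set.
by apply: subgroupM => //; exact: subgroupV.
Qed.

HB.instance Definition _ :=
  SubChoice_isSubGroup.Build G (fun x : G => x \in subgroup_set H)
    (subgroup_type H) subgroup_group_closed.

Lemma subgroup_val_continuous : continuous (val : subgroup_type H -> G).
Proof. exact: initial_continuous. Qed.

Lemma subgroup_mulg_continuous :
  continuous (fun p : subgroup_type H * subgroup_type H => (p.1 * p.2)%g).
Proof.
apply: continuous_comp_initial => -[x y].
apply: (@cvg_comp _ _ _ (fun p => (val p.1, val p.2))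
  (fun p : G * G => (p.1 * p.2)%g) _ (nbhs (val x, val y))).
- apply: cvg_pair.
  + apply: (@cvg_comp _ _ _ fst val _ (nbhs x)); first exact: cvg_fst.
    exact: subgroup_val_continuous.
  + apply: (@cvg_comp _ _ _ snd val _ (nbhs y)); first exact: cvg_snd.
    exact: subgroup_val_continuous.
- exact: (@mulg_continuous G (val x, val y)).
Qed.

Lemma subgroup_invg_continuous :
  continuous (fun x : subgroup_type H => (x^-1)%g).
Proof.
apply: continuous_comp_initial => x.
apply: (@cvg_comp _ _ _ val (fun y : G => (y^-1)%g) _ (nbhs (val x))).
  exact: subgroup_val_continuous.
exact: invg_continuous.
Qed.

HB.instance Definition _ := isTopologicalGroup.Build (subgroup_type H)
  subgroup_mulg_continuous subgroup_invg_continuous.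

End SubgroupType.

(* The left cosets rH, i.e. the points of G/H. *)
Definition left_cosets (G : topGroupType) (H : closedSubgroup G) :
  set (set G) := range (fun r => [set (r * h)%g | h in H]).

Lemma left_coset_invM (G : topGroupType) (H : closedSubgroup G)
    (alpha : set G) (s t : G) :
  left_cosets H alpha -> alpha s -> alpha t -> subgroup_set H (s^-1 * t)%g.
Proof.
move=> [r _ <-] [h Hh <-] [k Hk <-].
rewrite invgM -mulgA mulKg.
by apply: subgroupM => //; exact: subgroupV.
Qed.

Section Haar.
Variable R : realType.

Definition borel (G : topGroupType) := g_sigma_algebraType (@open G).

Record left_haar (G : topGroupType)
    (mu : {measure set (borel G) -> \bar R}) : Prop := LeftHaar {
  haar_neq0 : mu setT != 0%E ;
  haar_compact : forall K : set G, compact K -> (mu K < +oo)%E ;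
  haar_outer : forall E : set (borel G), measurable E ->
    mu E = ereal_inf [set mu U | U in [set U : set G | open U /\ E `<=` U]] ;
  haar_inner : forall U : set G, open U ->
    mu U = ereal_sup [set mu K | K in [set K : set G | compact K /\ K `<=` U]] ;
  haar_invariant : forall (x : G) (E : set (borel G)), measurable E ->
    mu [set (x * y)%g | y in (E : set G)] = mu E }.

(* Delta_G (t) is the factor by which right translation by t scales a left
   Haar measure. *)
Definition modular_function (G : topGroupType)
    (mu : {measure set (borel G) -> \bar R}) (Delta : G -> R) : Prop :=
  (forall t, 0 < Delta t) /\
  forall (t : G) (E : set (borel G)), measurable E ->
    mu [set (y * t)%g | y in (E : set G)] = ((Delta t)%:E * mu E)%E.

End Haar.

(* Norms of modules over R[i] are R[i]-valued. *)
Definition rnorm (R : realType) (V : normedModType R[i]) (v : V) : R :=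
  complex.Re `|v|.

Section Bochner.
Context d (T : measurableType d) (R : realType).
Variables (mu : {measure set T -> \bar R}) (V : completeNormedModType R[i]).

(* v is approximated by the integrals of integrable simple functions that
   approximate F in the L^1 seminorm. *)
Definition is_bochner (F : T -> V) (v : V) : Prop :=
  forall eps : R, 0 < eps ->
  exists (n : nat) (E : 'I_n -> set T) (c : 'I_n -> V),
    let dist t := rnorm (F t - \sum_(i < n) \1_(E i) t *: c i) in
    [/\ forall i, measurable (E i) /\ (mu (E i) < +oo)%E,
        measurable_fun setT dist,
        (\int[mu]_t (dist t)%:E < eps%:E)%E
      & rnorm (v - \sum_(i < n) (fine (mu (E i)))%:C%C *: c i) < eps].

(* 0 when F is not Bochner integrable. *)
Definition bochner (F : T -> V) : V := xget 0 [set v | is_bochner F v].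

End Bochner.

(* Only the data: the axioms on the topology of the total space are in
   banach_bundle. *)
Structure bundle (R : realType) (X : topologicalType) := Bundle {
  fibre :> X -> completeNormedModType R[i] ;
  bundle_open : set_system {x : X & fibre x} ;
  bundle_openT : bundle_open setT ;
  bundle_openI : setI_closed bundle_open ;
  bundle_open_bigU : forall (I : Type) (f : I -> set {x : X & fibre x}),
    (forall i, bundle_open (f i)) -> bundle_open (\bigcup_i f i) }.

Definition totalSpace (R : realType) (X : topologicalType) (B : bundle R X) :=
  {x : X & B x}.

HB.instance Definition _ (R : realType) (X : topologicalType)
    (B : bundle R X) := Choice.on (totalSpace B).
HB.instance Definition _ (R : realType) (X : topologicalType)
    (B : bundle R X) := isOpenTopological.Build (totalSpace B)
  (@bundle_openT R X B) (@bundle_openI R X B) (@bundle_open_bigU R X B).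

Section BundleTheory.
Variables (R : realType) (X : topologicalType) (B : bundle R X).

Definition in_total (x : X) (a : B x) : totalSpace B := Tagged (fun x => B x) a.
Definition proj (u : totalSpace B) : X := tag u.
Definition value (u : totalSpace B) : B (proj u) := tagged u.

(* u as an element of the fibre over x; 0 if u lies over another point. *)
Definition fib (x : X) (u : totalSpace B) : B x :=
  tagged_as (Tagged (fun x => B x) (0 : B x)) u.

Lemma fibK (x : X) (a : B x) : fib x (in_total a) = a.
Proof.
have := @tagged_asE _ (fun x => B x) (Tagged (fun x => B x) (0 : B x)) a.
exact.
Qed.

Definition addT (u v : totalSpace B) : totalSpace B :=
  in_total (value u + fib (proj u) v).
Definition scaleT (k : R[i]) (u : totalSpace B) : totalSpace B :=
  in_total (k *: value u).

Record banach_bundle : Prop := BanachBundle {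
  bb_hausdorff : hausdorff_space (totalSpace B) ;
  bb_proj_continuous : continuous proj ;
  bb_proj_open : forall U : set (totalSpace B), open U -> open (proj @` U) ;
  bb_norm_continuous : continuous (fun u : totalSpace B => rnorm (value u)) ;
  bb_add_continuous :
    {within [set p : totalSpace B * totalSpace B | proj p.1 = proj p.2],
      continuous (fun p => addT p.1 p.2)} ;
  bb_scale_continuous : forall k, continuous (scaleT k) ;
  bb_cvg0 : forall (F : set_system (totalSpace B)) (x : X), ProperFilter F ->
    proj @ F --> x -> (rnorm (value u) @[u --> F] --> (0 : R)) ->
    F --> in_total (0 : B x) }.

Definition Cc (f : forall x, B x) : Prop :=
  continuous (fun x => in_total (f x)) /\
  compact (closure [set x | f x != 0]).

End BundleTheory.

Structure starBundle (R : realType) (G : topGroupType) := StarBundle {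
  star_bundle :> bundle R G ;
  bmul : forall s t : G,
    star_bundle s -> star_bundle t -> star_bundle (s * t)%g ;
  bstar : forall t : G, star_bundle t -> star_bundle (t^-1)%g }.

Section StarBundleTheory.
Variables (R : realType) (G : topGroupType) (B : starBundle R G).

Definition mulT (u v : totalSpace B) : totalSpace B :=
  in_total (bmul (value u) (value v)).
Definition starT (u : totalSpace B) : totalSpace B :=
  in_total (bstar (value u)).

Record banach_star_bundle : Prop := BanachStarBundle {
  bsb_bundle : banach_bundle B ;
  bmul_linearl : forall s t (b : B t), linear (fun a : B s => bmul a b) ;
  bmul_linearr : forall s t (a : B s), linear (fun b : B t => bmul a b) ;
  bmulA : associative mulT ;
  bmul_norm : forall s t (a : B s) (b : B t),
    rnorm (bmul a b) <= rnorm a * rnorm b ;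
  bmul_continuous :
    continuous (fun p : totalSpace B * totalSpace B => mulT p.1 p.2) ;
  bstar_conj_linear : forall t k (a b : B t),
    bstar (k *: a + b) = k^*%C *: bstar a + bstar b ;
  bstar_norm : forall t (a : B t), rnorm (bstar a) = rnorm a ;
  bstarM : forall u v, starT (mulT u v) = mulT (starT v) (starT u) ;
  bstarK : involutive starT ;
  bstar_continuous : continuous starT }.

(* The Banach *-algebra B_e; 1^-1 and 1 * 1 are only propositionally 1. *)
Definition emul (a b : B 1%g) : B 1%g := fib 1%g (in_total (bmul a b)).
Definition estar (a : B 1%g) : B 1%g := fib 1%g (in_total (bstar a)).

(* (k, a) stands for k1 + a in the unitization of B_e. *)
Definition unitization_mul (x y : R[i] * B 1%g) : R[i] * B 1%g :=
  (x.1 * y.1, x.1 *: y.2 + y.1 *: x.2 + emul x.2 y.2).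

(* When B_e is unital this differs from the spectrum computed in B_e at most
   by the point 0. *)
Definition spectrum (a : B 1%g) : set R[i] :=
  [set z | ~ exists x, unitization_mul (z, - a) x = (1, 0) /\
                       unitization_mul x (z, - a) = (1, 0)].

Definition positive_elt (a : B 1%g) : Prop :=
  estar a = a /\ forall z, spectrum a z -> 0 <= z.

Record fell_bundle : Prop := FellBundle {
  fell_norm : forall t (b : B t),
    rnorm (bmul (bstar b) b) = rnorm b ^+ 2 ;
  fell_positive : forall u : totalSpace B,
    positive_elt (fib 1%g (mulT (starT u) u)) }.

Variables (mu : {measure set (borel G) -> \bar R}) (Delta : G -> R).

Definition convolution (f g : forall t, B t) (t : G) : B t :=
  bochner mu (fun s : borel G =>
    fib t (in_total (bmul (f s) (g ((s : G)^-1 * t)%g)))).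

Definition inv_section (f : forall t, B t) (t : G) : B t :=
  ((Delta t)^-1)%:C%C *: fib t (in_total (bstar (f (t^-1)%g))).

End StarBundleTheory.

Section Reduction.
Variables (R : realType) (G : topGroupType) (B : starBundle R G).
Variable H : closedSubgroup G.

Definition red_incl (u : {h : subgroup_type H & B (val h)}) : totalSpace B :=
  in_total (tagged u).

Definition red_bundle : bundle R (subgroup_type H) :=
  @Bundle R (subgroup_type H) (fun h => B (val h))
    (@open (initial_topology red_incl)) (@openT (initial_topology red_incl))
    (@openI (initial_topology red_incl))
    (fun I f fo =>
      @bigcup_open (initial_topology red_incl) I setT f (fun i _ => fo i)).

Definition reduction : starBundle R (subgroup_type H) :=
  @StarBundle R (subgroup_type H) red_bundle
    (fun s t a b => @bmul R G B (val s) (val t) a b)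
    (fun t a => @bstar R G B (val t) a).

End Reduction.

Structure hilbertType (R : realType) := Hilbert {
  hilbert_sort :> completeNormedModType R[i] ;
  ip : hilbert_sort -> hilbert_sort -> R[i] ;
  ip_linear : forall x, linear (ip x : hilbert_sort -> R[i]^o) ;
  ip_conj : forall x y, ip y x = (ip x y)^*%C ;
  ip_norm : forall x, ip x x = `|x| ^+ 2 }.

Structure starRep (R : realType) (G : topGroupType) (B : starBundle R G)
    (Y : hilbertType R) := StarRep {
  rep :> forall t, B t -> Y -> Y ;
  rep_op_linear : forall t (b : B t), linear (rep b) ;
  rep_op_bounded : forall t (b : B t), continuous (rep b) ;
  rep_linear : forall t (xi : Y), linear (fun b : B t => rep b xi) ;
  repM : forall s t (a : B s) (b : B t) xi,
    rep (bmul a b) xi = rep a (rep b xi) ;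
  rep_adj : forall t (b : B t) xi eta,
    ip (rep (bstar b) xi) eta = ip xi (rep b eta) ;
  rep_continuous : forall xi eta, continuous
    (fun u : totalSpace B => ip (rep (value u) xi) eta : R[i]^o) }.

Definition integrated_form (R : realType) (G : topGroupType)
    (B : starBundle R G) (Y : hilbertType R) (mu : {measure set (borel G) -> \bar R})
    (T : starRep B Y) (f : forall t, B t) (xi : Y) : Y :=
  bochner mu (fun t : borel G => T t (f t) xi).

Section Positivity.
Variables (R : realType) (G : topGroupType) (H : closedSubgroup G).
Variables (muG : {measure set (borel G) -> \bar R}) (DeltaG : G -> R).
Variable muH : {measure set (borel (subgroup_type H)) -> \bar R}.
Variable DeltaH : subgroup_type H -> R.
Variables (B : starBundle R G) (Y : hilbertType R).
Variable T : starRep (reduction B H) Y.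

Definition p_map (f : forall t, B t) (h : subgroup_type H) :
    reduction B H h :=
  (Num.sqrt (DeltaG (val h)) / Num.sqrt (DeltaH h))%:C%C *: f (val h).

Definition B_positive : Prop :=
  forall (xi : Y) (f : forall t, B t), Cc f ->
    0 <= ip xi (integrated_form muH T
                 (p_map (convolution muG (inv_section DeltaG f) f)) xi).

(* T at a point of the total space of B that lies over H. *)
Definition rep_at (u : totalSpace B) (Hu : subgroup_set H (proj u)) : Y -> Y :=
  T (exist _ (proj u) (mem_set Hu) : subgroup_type H) (value u).

Definition coset_positive : Prop :=
  forall (alpha : set G) (Halpha : left_cosets H alpha) (n : nat),
  (0 < n)%N ->
  forall (b : 'I_n -> totalSpace B) (Hb : forall i, alpha (proj (b i)))
         (xi : 'I_n -> Y),
    0 <= \sum_(i < n) \sum_(j < n)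
      ip (xi i) (rep_at (u := mulT (starT (b i)) (b j))
                        (left_coset_invM Halpha (Hb i) (Hb j)) (xi j)).

Definition unit_fibre_positive : Prop :=
  forall (u : totalSpace B) (xi : Y),
    0 <= ip xi (T 1%g (fib 1%g (mulT (starT u) u)) xi).

End Positivity.

(* Main.v *)
(* (2) => (3) is the case of one element.

   (3) => (2).  For b_1, ..., b_n over a coset, S = (T_{b_i^* b_j}) is a bounded
   self-adjoint operator of Y^n.  For fixed i and xi the vectors
   (l delta_ji xi + T_{c_j} xi)_j, with b_j c_j over the same point as b_i, form
   an S-invariant subspace, on which the form of S at such a vector is
   <xi, T_{d^* d} xi> with d = l b_i + sum_j b_j c_j, hence nonnegative by (3).
   On it the powers of A = 1 - S/M are contractive; as these subspaces span
   Y^n, the vectors A^k w are bounded for every w, and logarithmic convexity of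
   |A^k w| yields |A w| <= |w|, so S >= 0.

   (1) <-> the rest.  With d = Delta_G/Delta_H and k(s,t) = T_{f(s)^* f(t)},
   <xi, T_{p(f^* * f)} xi> is the integral over H x G of
   d(h)^{1/2} Delta_G(s)^{-1} <xi, k(s^{-1}, s^{-1} h) xi>.
   For (1) => (3), f is localized around a point by a bump function; this needs
   continuous sections through approximately any element of the bundle, built
   by successive approximation from thin open sets and partitions of unity.
   For (2) => (1), dividing by the right H-invariant weight
   W(s) = int_H Delta_H(k)^{-1} phi(s k^{-1}) dk and using Fubini turns the
   integral into one of nonnegative multiples of
   int_H int_H d(k)^{1/2} d(h)^{1/2} <xi, k(s k, s h) xi> dh dk, whose Riemann
   sums are instances of (2).  No inversion formula for Haar measures is needed,
   because F |-> int_G Delta_G(s)^{-1} F(s^{-1}) ds is already scaled correctly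
   by right translations.

   In a Fell bundle (3) holds since T maps b^* b to a self-adjoint operator A
   with A + c invertible for every c > 0. *)

Require Import Defs.
From HB Require Import structures.
From mathcomp Require Import all_boot all_order all_algebra.
From mathcomp Require Import all_classical all_reals all_analysis.
From mathcomp Require Import measurable_realfun finmap complex.
From mathcomp Require Import ring lra.
(* The topology library also has a [proj]; this restores that of [Defs]. *)
Import Defs.

Set Implicit Arguments.
Unset Strict Implicit.
Unset Printing Implicit Defensive.

Import Order.TTheory GRing.Theory Num.Theory numFieldNormedType.Exports.

Local Open Scope classical_set_scope.
Local Open Scope ring_scope.

(** [B_e] need not have a unit and [T] may be degenerate, so [xi] need not be of the form [T_c xi];
    the scalar [l] in the cyclic vectors acts as an adjoined unit. Positivity on several subspaces
    says nothing about their sum, whereas boundedness of orbits passes to sums: hence the detour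
    through the powers of [A].

    Haar measures are not assumed sigma-finite, and Borel sets of a product need not belong to the
    product sigma-algebra, so no product measure appears. All functions to be integrated on the
    groups are continuous with compact support; substitution, exchange of integrals, positivity of
    kernels and existence of Bochner integrals are read off from sums over a finite Borel partition
    of the support, on whose pieces the integrand is nearly constant.

    [bochner] is a chosen value, known only through [is_bochner]. Vectors are therefore compared
    after applying bounded real-linear functionals, which turns every identity into one of real
    integrals; [Re], [Im] and [- Im] suffice to recognize a nonnegative complex number. *)

Local Notation Re := complex.Re.
Local Notation Im := complex.Im.
Local Notation Int mu f := (Rintegral mu setT f).
Local Notation vol mu E := (fine (mu E)).

(** * Positive operators *)

Section PositiveForms.
Variables (R : realType).

Lemma discriminant_le (a b c : R) :
  (forall t, 0 <= a + 2 * t * b + t ^+ 2 * c) -> b ^+ 2 <= a * c.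
Proof.
move=> h.
have a0 : 0 <= a by have := h 0; rewrite mulr0 mul0r expr0n /= mul0r !addr0.
have c0 : 0 <= c.
  rewrite leNgt; apply/negP => c0.
  (* With [s] the quotient and [t = s + 1 >= 1], one has [t * c <= - (a + 1 + 2 |b|)], so the
     quadratic is at most [a - t * (a + 1) < 0]. *)
  have := h ((a + 1 + 2 * `|b|) / - c + 1).
  set s := _ / _; have s0 : 0 <= s.
    by rewrite divr_ge0 ?oppr_ge0 ?(ltW c0)// addr_ge0// ?mulr_ge0// addr_ge0.
  have hs : s * c = - (a + 1 + 2 * `|b|).
    by rewrite /s invrN mulrN mulNr -mulrA mulVf ?mulr1// lt_eqF.
  have hb := ler_norm b.
  nra.
have [c1|c1] := eqVneq c 0.
  rewrite c1 mulr0; rewrite {}c1 in h.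
  have [->|b0] := eqVneq b 0; first by rewrite expr0n.
  have := h (- (a + 1) / (2 * b)).
  have -> : 2 * (- (a + 1) / (2 * b)) * b = - (a + 1) by field.
  by rewrite mulr0 addr0 => ?; lra.
have cp : 0 < c by rewrite lt_def c1.
have := h (- b / c).
have -> : a + 2 * (- b / c) * b + (- b / c) ^+ 2 * c = (a * c - b ^+ 2) / c.
  by field.
by rewrite pmulr_lge0 ?invr_gt0// subr_ge0.
Qed.

Variables (V : lmodType R[i]) (r : V -> V -> R).
Hypothesis rC : forall x y, r x y = r y x.
Hypothesis rD : forall x y z, r x (y + z) = r x y + r x z.
Hypothesis rZ : forall x (t : R) y, r x (t%:C%C *: y) = t * r x y.
Hypothesis r_ge0 : forall x, 0 <= r x x.

Variables (S : V -> V) (M : R).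
Hypothesis SD : forall x y, S (x + y) = S x + S y.
Hypothesis SZ : forall (t : R) x, S (t%:C%C *: x) = t%:C%C *: S x.
Hypothesis S_sym : forall x y, r (S x) y = r x (S y).
Hypothesis M_gt0 : 0 < M.
Hypothesis S_le : forall x, r (S x) (S x) <= M ^+ 2 * r x x.

Let rDl x y z : r (y + z) x = r y x + r z x.
Proof. by rewrite rC rD !(rC x). Qed.
Let rZl x (t : R) y : r (t%:C%C *: y) x = t * r y x.
Proof. by rewrite rC rZ rC. Qed.

Lemma form_CS x y : r x y ^+ 2 <= r x x * r y y.
Proof.
apply: discriminant_le => t.
have := r_ge0 (x + t%:C%C *: y); rewrite !(rD, rDl, rZ, rZl) (rC y x).
by move=> h; apply: le_trans h _; rewrite le_eqVlt; apply/orP; left; apply/eqP; ring.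
Qed.

Lemma form_operator_le x : r x (S x) <= M * r x x.
Proof.
have h := form_CS x (S x); have h1 := S_le x; have h2 := r_ge0 x.
have h3 : r x (S x) ^+ 2 <= (M * r x x) ^+ 2.
  apply: le_trans h _; rewrite exprMn.
  rewrite [leRHS](_ : _ = r x x * (M ^+ 2 * r x x)); last by ring.
  exact: ler_wpM2l.
rewrite leNgt; apply/negP => h4.
have : 0 <= M * r x x by rewrite mulr_ge0// ltW.
by move=> h5; nra.
Qed.

Section Invariant.
Variable D : set V.
Hypothesis DD : forall x y, D x -> D y -> D (x + y).
Hypothesis DZ : forall (t : R) x, D x -> D (t%:C%C *: x).
Hypothesis DS : forall x, D x -> D (S x).
Hypothesis D_pos : forall x, D x -> 0 <= r x (S x).

(** Cauchy-Schwarz for the form [r x (S y)], semidefinite on [D] only, applied to [x] and [S x];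
    this is where the invariance of [D] enters. Bounding [r (S x) (S (S x))] by [M * r (S x) (S x)]
    lets one factor cancel. *)
Lemma positive_operator_sqr_le x : D x -> r (S x) (S x) <= M * r x (S x).
Proof.
move=> Dx; have Dx1 := DS Dx.
have h : r (S x) (S x) ^+ 2 <= r x (S x) * r (S x) (S (S x)).
  apply: discriminant_le => t.
  have := D_pos (DD Dx (DZ t Dx1)); rewrite !(SD, SZ, rD, rDl, rZ, rZl).
  rewrite -(S_sym x (S x)).
  by move=> h; apply: le_trans h _; rewrite le_eqVlt; apply/orP; left; apply/eqP; ring.
have h1 := form_operator_le (S x); have h2 := D_pos Dx; have h3 := r_ge0 (S x).
have h4 : r (S x) (S x) ^+ 2 <= r x (S x) * (M * r (S x) (S x)).
  by apply: le_trans h _; exact: ler_wpM2l.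
have [->|n0] := eqVneq (r (S x) (S x)) 0; first by rewrite mulr_ge0// ltW.
have p : 0 < r (S x) (S x) by rewrite lt_def n0.
by rewrite -(ler_pM2r p) -expr2; apply: le_trans h4 _; rewrite mulrCA mulrA.
Qed.

Definition defect x := x + (- M^-1)%:C%C *: S x.

(** In [|x|^2 - (2 / M) <x, S x> + |S x|^2 / M^2] the last term is at most [(1 / M) <x, S x>] by the
    preceding lemma. *)
Lemma defect_contraction x : D x -> r (defect x) (defect x) <= r x x.
Proof.
move=> Dx; have h := positive_operator_sqr_le Dx; have h2 := D_pos Dx.
rewrite /defect !(rD, rDl, rZ, rZl) (S_sym x x).
have Mi : 0 < M^-1 by rewrite invr_gt0.
have h3 : M^-1 * r (S x) (S x) <= r x (S x) by rewrite ler_pdivrMl.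
have h4 : M^-1 * (M^-1 * r (S x) (S x)) <= M^-1 * r x (S x) by rewrite ler_pM2l.
have h5 : 0 <= M^-1 * r x (S x) by rewrite mulr_ge0// ltW.
by lra.
Qed.

Lemma iter_defect_contraction x k :
  D x -> r (iter k defect x) (iter k defect x) <= r x x.
Proof.
move=> Dx; suff [] : D (iter k defect x) /\
    r (iter k defect x) (iter k defect x) <= r x x by [].
elim: k => [|k [Dk IH]] //=; split.
  by rewrite /defect; apply/DD/DZ/DS.
by apply: le_trans IH; exact: defect_contraction.
Qed.

End Invariant.

Lemma defectD x y : defect (x + y) = defect x + defect y.
Proof. by rewrite /defect SD scalerDr addrACA. Qed.

Lemma iter_defectD k x y :
  iter k defect (x + y) = iter k defect x + iter k defect y.
Proof. by elim: k => [|k IH] //=; rewrite IH defectD. Qed.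

Lemma defect_sym x y : r (defect x) y = r x (defect y).
Proof. by rewrite /defect !(rD, rDl, rZ, rZl) S_sym. Qed.

Definition defect_bounded x :=
  exists C, forall k, r (iter k defect x) (iter k defect x) <= C.

(** The parallelogram inequality [|a + b|^2 <= 2 |a|^2 + 2 |b|^2], applied to each power. *)
Lemma defect_boundedD x y :
  defect_bounded x -> defect_bounded y -> defect_bounded (x + y).
Proof.
move=> [C hC] [C' hC']; exists (2 * C + 2 * C') => k.
rewrite iter_defectD; move: (hC k) (hC' k).
move: (iter k _ x) (iter k _ y) => a b ha hb.
have := r_ge0 (a + (-1)%:C%C *: b); rewrite !(rD, rDl, rZ, rZl) (rC b a).
by lra.
Qed.

(* The numbers [r (A^k x) (A^k x)] are logarithmically convex in [k]; being
   bounded, they cannot increase. *)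
Lemma defect_bounded_positive x : defect_bounded x -> 0 <= r x (S x).
Proof.
move=> [C hC]; pose a k := r (iter k defect x) (iter k defect x).
have a_cvx k : a k.+1 ^+ 2 <= a k * a k.+2.
  have -> : a k.+1 = r (iter k defect x) (iter k.+2 defect x).
    by rewrite /a /= -defect_sym.
  exact: form_CS.
(* [|x - S x / M| <= |x|] expands to [(2 / M) <x, S x> >= |S x|^2 / M^2 >= 0]. *)
suff : a 1%N <= a 0%N.
  rewrite /a /= /defect !(rD, rDl, rZ, rZl) (S_sym x x).
  have Mi : 0 < M^-1 by rewrite invr_gt0.
  have h3 := mulr_ge0 (ltW Mi) (mulr_ge0 (ltW Mi) (r_ge0 (S x))).
  move=> h; rewrite -(pmulr_rge0 _ Mi); lra.
rewrite leNgt; apply/negP => a01.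
have a_ge0 k : 0 <= a k by exact: r_ge0.
have a1 : 0 < a 1%N by apply: le_lt_trans a01.
have a0 : 0 < a 0%N.
  rewrite lt_def a_ge0 andbT; apply/eqP => a0.
  by have := a_cvx 0%N; rewrite a0 mul0r leNgt exprn_gt0.
(* Convexity propagates the first ratio, so the numbers grow at least like [q ^+ k] with [q > 1];
   Bernoulli's inequality then carries them past [C]. *)
pose q := a 1%N / a 0%N.
have q1 : 1 < q by rewrite ltr_pdivlMr// mul1r.
have q0 : 0 < q by apply: lt_trans q1.
have step k : 0 < a k /\ q * a k <= a k.+1.
  elim: k => [|k [ak hk]]; first by split=> //; rewrite /q -mulrA mulVf ?mulr1// gt_eqF.
  have ak1 : 0 < a k.+1 by apply: lt_le_trans hk; rewrite mulr_gt0.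
  split=> //; rewrite -(ler_pM2l ak); apply: le_trans (a_cvx k).
  by rewrite mulrA expr2 ler_pM2r// mulrC.
have grow k : q ^+ k * a 0%N <= a k.
  elim: k => [|k IH]; first by rewrite expr0 mul1r.
  apply: le_trans (step k).2; rewrite exprS -mulrA.
  by rewrite ler_pM2l.
have bern k : 1 + (q - 1) * k%:R <= q ^+ k.
  elim: k => [|k IH]; first by rewrite mulr0 addr0 expr0.
  have k0 : 0 <= k%:R :> R by [].
  rewrite exprS -natr1.
  apply: (@le_trans _ _ (q * (1 + (q - 1) * k%:R))).
    by have := mulr_ge0 (sqr_ge0 (q - 1)) k0; nra.
  by rewrite ler_pM2l.
pose N := Num.truncn (C / a 0%N / (q - 1)).
have hN : C / a 0%N / (q - 1) < N.+1%:R by exact: truncnS_gt.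
have := le_trans (ler_wpM2r (ltW a0) (bern N.+1)) (le_trans (grow N.+1) (hC N.+1)).
rewrite -ler_pdivlMr//.
move: hN; rewrite ltr_pdivrMr ?subr_gt0// => hN; lra.
Qed.

(** Nothing relates the subspaces [D i] to each other. Since [defect] contracts each [D i], every
    [u i] has a bounded orbit; bounded orbits add up, and boundedness alone yields positivity at the
    sum. *)
Lemma positive_on_sum (I : finType) (D : I -> set V) (u : I -> V) :
  (forall i x y, D i x -> D i y -> D i (x + y)) ->
  (forall i (t : R) x, D i x -> D i (t%:C%C *: x)) ->
  (forall i x, D i x -> D i (S x)) ->
  (forall i x, D i x -> 0 <= r x (S x)) ->
  (forall i, D i (u i)) ->
  0 <= r (\sum_i u i) (S (\sum_i u i)).
Proof.
move=> DD DZ DS Dp Du; apply: defect_bounded_positive.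
apply: (big_ind defect_bounded).
- have r00 : r 0 0 = 0 by have := rZ 0 0 0; rewrite mul0r scale0r.
  have S0 : S 0 = 0 by have := SZ 0 0; rewrite !scale0r.
  exists 0; elim=> [|k IH] /=; first by rewrite r00.
  suff -> : iter k defect 0 = 0 by rewrite /defect S0 scaler0 addr0 r00.
  by elim: k {IH} => //= k ->; rewrite /defect S0 scaler0 addr0.
- exact: defect_boundedD.
- move=> i _; exists (r (u i) (u i)) => k.
  exact: (iter_defect_contraction (DD i) (DZ i) (DS i) (Dp i)).
Qed.

End PositiveForms.

(** * Positivity of an operator from its spectrum *)

Section PositiveSpectrum.
Variables (R : realType) (V : lmodType R[i]) (r : V -> V -> R).
Hypothesis rC : forall x y, r x y = r y x.
Hypothesis rD : forall x y z, r x (y + z) = r x y + r x z.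
Hypothesis rZ : forall x (t : R) y, r x (t%:C%C *: y) = t * r x y.
Hypothesis r_ge0 : forall x, 0 <= r x x.
Variables (S : V -> V) (M : R).
Hypothesis SD : forall x y, S (x + y) = S x + S y.
Hypothesis SZ : forall (t : R) x, S (t%:C%C *: x) = t%:C%C *: S x.
Hypothesis S_sym : forall x y, r (S x) y = r x (S y).
Hypothesis M_gt0 : 0 < M.
Hypothesis S_le : forall x, r (S x) (S x) <= M ^+ 2 * r x x.

(* The largest [m] with [m <= S] is in the approximate point spectrum of [S]. *)
Lemma positive_of_bounded_below :
  (forall m : R, m < 0 -> exists2 C : R, 0 < C & forall x,
    r x x <= C * r (S x + (- m)%:C%C *: x) (S x + (- m)%:C%C *: x)) ->
  forall x, 0 <= r x (S x).
Proof.
move=> hS x0; rewrite leNgt; apply/negP => x0_lt0.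
have rDl x y z : r (y + z) x = r y x + r z x by rewrite rC rD !(rC x).
have rZl x (t : R) y : r (t%:C%C *: y) x = t * r y x by rewrite rC rZ rC.
pose E : set R := [set m | forall x, m * r x x <= r x (S x)].
have EM : E (- M).
  move=> x; have h := form_CS rC rD rZ r_ge0 x (S x).
  have h1 := S_le x; have h2 := r_ge0 x.
  have h3 : r x (S x) ^+ 2 <= (M * r x x) ^+ 2.
    apply: le_trans h _; rewrite exprMn.
    rewrite [leRHS](_ : _ = r x x * (M ^+ 2 * r x x)); last by ring.
    exact: ler_wpM2l.
  have h4 : 0 <= M * r x x by rewrite mulr_ge0// ltW.
  by rewrite leNgt; apply/negP => h5; nra.
have E_neg m : E m -> m < 0.
  move=> Em; rewrite ltNge; apply/negP => m0.
  by have := le_lt_trans (Em x0) x0_lt0; rewrite ltNge mulr_ge0.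
have supE : has_sup E.
  by split; [exists (- M)|exists 0 => m /E_neg/ltW].
pose m := sup E.
have Em : E m.
  move=> x; have [rx|rx] := eqVneq (r x x) 0.
    by have := EM x; rewrite rx !mulr0.
  have rx0 : 0 < r x x by rewrite lt_def rx r_ge0.
  rewrite -ler_pdivlMr//; apply: sup_le_ub; first by exists (- M).
  by move=> m' /(_ x); rewrite ler_pdivlMr.
have m0 := E_neg _ Em; have [C C0 hC] := hS _ m0.
pose S' x := S x + (- m)%:C%C *: x.
have S'_pos x : 0 <= r x (S' x).
  by rewrite /S' rD rZ; have := Em x; lra.
have M'0 : 0 < M - m by rewrite subr_gt0 (lt_trans m0).
have S'_le x : r (S' x) (S' x) <= (M - m) * r x (S' x).
  apply: (@positive_operator_sqr_le _ _ _ rC rD rZ r_ge0 S' (M - m) _ _ _ _ _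
    setT) => //.
  - by move=> y z; rewrite /S' SD scalerDr addrACA.
  - by move=> t y; rewrite /S' SZ scalerDr !scalerA mulrC.
  - by move=> y z; rewrite /S' !(rD, rDl, rZ, rZl) S_sym.
  - move=> y; rewrite /S' !(rD, rDl, rZ, rZl) (S_sym y y).
    have := form_operator_le rC rD rZ r_ge0 M_gt0 S_le y.
    have := S_le y => h1 h2; have := mulr_ge0 (ltW M'0) (r_ge0 y).
    have h3 : - m * r y (S y) <= - m * (M * r y y) by rewrite ler_pM2l; lra.
    by nra.
(* Since [S'] is bounded below, [|x|^2 <= C |S' x|^2 <= C (M - m) <x, S' x>]; so [S'] dominates a
   positive constant and [m] was not the supremum of [E]. *)
suff : E (m + (C * (M - m))^-1).
  move=> /(ub_le_sup supE.2); rewrite -/m gerDl invr_le0.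
  by rewrite leNgt mulr_gt0.
move=> x; have h := le_trans (hC x) (ler_wpM2l (ltW C0) (S'_le x)).
have k0 : 0 < C * (M - m) by rewrite mulr_gt0.
rewrite mulrDl -lerBrDl mulrC ler_pdivrMr//.
apply: le_trans h _; rewrite /S' rD rZ.
by rewrite le_eqVlt; apply/orP; left; apply/eqP; ring.
Qed.

End PositiveSpectrum.

(** * Real-valued norms and inner products *)

Section Rnorm.
Variables (R : realType) (V : normedModType R[i]).
Implicit Types (v w : V).

Lemma rnormE v : `|v| = (rnorm v)%:C%C.
Proof.
rewrite /rnorm; have := normr_ge0 v; case: `|v| => a b.
by rewrite lecE /= => /andP[/eqP -> _].
Qed.

Lemma rnorm_ge0 v : 0 <= rnorm v.
Proof. by have := normr_ge0 v; rewrite rnormE ler0c. Qed.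

Lemma rnorm0 : rnorm (0 : V) = 0.
Proof. by rewrite /rnorm normr0. Qed.

Lemma rnorm_eq0 v : rnorm v = 0 -> v = 0.
Proof. by move=> h; apply/eqP; rewrite -normr_eq0 rnormE h. Qed.

Lemma ler_rnormD v w : rnorm (v + w) <= rnorm v + rnorm w.
Proof. by rewrite -lecR rmorphD /= -!rnormE ler_normD. Qed.

Lemma rnormN v : rnorm (- v) = rnorm v.
Proof. by rewrite /rnorm normrN. Qed.

Lemma rdistC v w : rnorm (v - w) = rnorm (w - v).
Proof. by rewrite /rnorm distrC. Qed.

Lemma ler_rdistD u v w : rnorm (v - w) <= rnorm (v - u) + rnorm (u - w).
Proof. by rewrite (le_trans _ (ler_rnormD _ _))// addrA subrK. Qed.

Lemma rnormZ (k : R[i]) v : rnorm (k *: v) = Re `|k| * rnorm v.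
Proof.
rewrite /rnorm normrZ rnormE normc_def /=; ring.
Qed.

Lemma rnormZr (t : R) v : rnorm (t%:C%C *: v) = `|t| * rnorm v.
Proof. by rewrite rnormZ normc_def /= expr0n addr0 sqrtr_sqr. Qed.

Lemma ler_rnorm_sum (I : Type) (s : seq I) (P : pred I) (F : I -> V) :
  rnorm (\sum_(i <- s | P i) F i) <= \sum_(i <- s | P i) rnorm (F i).
Proof.
elim/big_ind2 : _ => [|x1 x2 y1 y2 h1 h2|//]; first by rewrite rnorm0.
by apply: le_trans (ler_rnormD _ _) _; exact: lerD.
Qed.

Lemma nbhs_rnormP v (A : set V) :
  nbhs v A <-> exists2 e : R, 0 < e & forall w, rnorm (v - w) < e -> A w.
Proof.
split.
- move=> /nbhs_normP[[a b] /=]; rewrite ltcE /= => /andP[/eqP -> a0] h.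
  exists a => // w hw; apply: h => /=.
  by rewrite rnormE ltcE /= eqxx.
- move=> [e e0 h]; apply/nbhs_normP; exists (e%:C)%C; first by rewrite /= ltcR.
  by move=> w /=; rewrite rnormE ltcR; exact: h.
Qed.

Lemma cvg_rnormP (T : Type) (F : set_system T) (FF : Filter F) (f : T -> V) v :
  f @ F --> v <->
  forall e : R, 0 < e -> \forall x \near F, rnorm (v - f x) < e.
Proof.
split.
- by move=> h e e0; apply: (h [set w | rnorm (v - w) < e]); apply/nbhs_rnormP; exists e.
- move=> h A /nbhs_rnormP[e e0 hA].
  by apply: filterS (h _ e0) => x; exact: hA.
Qed.

End Rnorm.

Lemma rnorm_cplx_le (R : realType) (z : R[i]) : `|Re z| <= Re `|z|.
Proof. by have := normc_ge_Re z; rewrite normc_def lecR. Qed.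

Lemma cplx_ge0P (R : realType) (z : R[i]) :
  0 <= z <-> 0 <= Re z /\ Im z = 0.
Proof.
rewrite lecE /=; split; first by move=> /andP[/eqP -> ->].
by move=> [-> ->]; rewrite eqxx.
Qed.

Lemma linear_bound (R : realType) (V W : normedModType R[i]) (f : V -> W) :
  linear f -> continuous f ->
  exists2 M : R, 0 < M & forall v, rnorm (f v) <= M * rnorm v.
Proof.
move=> lf cf.
have f0 : f 0 = 0 by have := lf (-1) 0 0; rewrite scaler0 add0r scaleN1r addNr.
have fZ k v : f (k *: v) = k *: f v by have := lf k v 0; rewrite f0 !addr0.
have := cf 0; move/cvg_rnormP => /(_ 1 ltr01) /nbhs_rnormP[e e0 h].
have e20 : 0 < e / 2 by rewrite divr_gt0.
exists (e / 2)^-1; first by rewrite invr_gt0.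
move=> v; have [v0|v0] := eqVneq (rnorm v) 0.
  by rewrite (rnorm_eq0 v0) f0 !rnorm0 mulr0.
have vp : 0 < rnorm v by rewrite lt_def v0 rnorm_ge0.
have := h (((e / 2) / rnorm v)%:C%C *: v).
have s0 : 0 <= e / 2 / rnorm v by apply: divr_ge0; apply: ltW.
rewrite f0 fZ !sub0r !rnormN !rnormZr ger0_norm//.
have he : e / 2 < e by lra.
rewrite divfK// => /(_ he)/ltW; rewrite mulrAC ler_pdivrMr// mul1r => ?.
by rewrite ler_pdivlMl.
Qed.

Section Hilbert.
Variables (R : realType) (Y : hilbertType R).
Implicit Types x y z : Y.

Lemma ipDr x y z : ip x (y + z) = ip x y + ip x z.
Proof. by have := ip_linear x 1 y z; rewrite !scale1r. Qed.

Lemma ip0r x : ip x 0 = 0.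
Proof.
have := ip_linear x 0 0 0; rewrite scaler0 add0r => h.
by apply: (addrI (ip x 0)); rewrite addr0 -[RHS]add0r -ipDr addr0 add0r.
Qed.

Lemma ipZr x k y : ip x (k *: y) = k * ip x y.
Proof. by have := ip_linear x k y 0; rewrite ip0r !addr0. Qed.

Lemma ipNr x y : ip x (- y) = - ip x y.
Proof. by rewrite -scaleN1r ipZr mulN1r. Qed.

Lemma ipBr x y z : ip x (y - z) = ip x y - ip x z.
Proof. by rewrite ipDr ipNr. Qed.

Lemma ipDl x y z : ip (y + z) x = ip y x + ip z x.
Proof. by rewrite ip_conj ipDr rmorphD /= -!ip_conj. Qed.

Lemma ipNl x y : ip (- y) x = - ip y x.
Proof. by rewrite ip_conj ipNr rmorphN /= -!ip_conj. Qed.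

Lemma ipBl x y z : ip (y - z) x = ip y x - ip z x.
Proof. by rewrite ipDl ipNl. Qed.

Lemma ip0l x : ip 0 x = 0.
Proof. by rewrite ip_conj ip0r conjc0. Qed.

Lemma ip_sumr (I : Type) (s : seq I) (P : pred I) (F : I -> Y) x :
  ip x (\sum_(i <- s | P i) F i) = \sum_(i <- s | P i) ip x (F i).
Proof. by apply: (big_morph _ (ipDr x) (ip0r x)). Qed.

Lemma ip_self x : ip x x = (rnorm x ^+ 2)%:C%C.
Proof. by rewrite ip_norm rnormE rmorphXn. Qed.

(** The real form to which the lemmas on positive operators apply; they involve real scalars
    only. *)
Definition rip x y : R := Re (ip x y).

Lemma ripC x y : rip x y = rip y x.
Proof. by rewrite /rip ip_conj; case: (ip y x). Qed.

Lemma ripDr x y z : rip x (y + z) = rip x y + rip x z.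
Proof. by rewrite /rip ipDr raddfD. Qed.

Lemma ripZr x (t : R) y : rip x (t%:C%C *: y) = t * rip x y.
Proof. by rewrite /rip ipZr; case: (ip x y) => a b /=; rewrite mul0r subr0. Qed.

Lemma rip_self x : rip x x = rnorm x ^+ 2.
Proof. by rewrite /rip ip_self. Qed.

Lemma rip_CS x y : `|rip x y| <= rnorm x * rnorm y.
Proof.
have rD := ripDr; have rZ := ripZr; have rC := ripC.
have h0 z : 0 <= rip z z by rewrite rip_self sqr_ge0.
have := form_CS rC rD rZ h0 x y; rewrite !rip_self -exprMn -real_normK ?num_real//.
by rewrite ler_sqr ?nnegrE ?mulr_ge0 ?rnorm_ge0.
Qed.

Lemma ipZlr (t : R) x y : ip (t%:C%C *: x) y = t%:C%C * ip x y.
Proof.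
by rewrite ip_conj ipZr [in RHS]ip_conj; case: (ip y x) => a b; simpc.
Qed.

Lemma Im_ip x y : Im (ip x y) = rip ('i%C *: x) y.
Proof.
by rewrite /rip [ip ('i%C *: x) y]ip_conj ipZr [ip y x]ip_conj; case: (ip x y) => a b /=; ring.
Qed.

End Hilbert.

(** * Positivity on the unit fibre and on cosets *)

Section TotalSpace.
Variables (R : realType) (X : topologicalType) (B : bundle R X).

Lemma in_totalK (x : X) (u : totalSpace B) :
  proj u = x -> in_total (fib x u) = u.
Proof. by move=> <-; case: u => y a; congr (Tagged _ _); exact: fibK. Qed.

Lemma in_total_value (u : totalSpace B) : in_total (value u) = u.
Proof. by case: u. Qed.

End TotalSpace.

Section TotalRep.
Variables (R : realType) (G : topGroupType) (H : closedSubgroup G).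
Variables (B : starBundle R G) (bsbB : banach_star_bundle B).
Variables (Y : hilbertType R) (T : starRep (reduction B H) Y).

(* A total version of [rep_at], with no membership proof to transport. *)
Definition opT (u : totalSpace B) (xi : Y) : Y :=
  match pselect (subgroup_set H (proj u)) with
  | left Hu => rep_at T Hu xi
  | right _ => 0
  end.

Lemma rep_atE (u : totalSpace B) (Hu : subgroup_set H (proj u)) xi :
  rep_at T Hu xi = opT u xi.
Proof.
rewrite /opT; case: pselect => [Hu'|//].
by rewrite /rep_at (eq_irrelevance (mem_set Hu) (mem_set Hu')).
Qed.

Lemma opT_off (u : totalSpace B) xi :
  ~ subgroup_set H (proj u) -> opT u xi = 0.
Proof. by rewrite /opT; case: pselect. Qed.

Lemma opT_in_total (h : subgroup_type H) (a : B (val h)) xi :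
  opT (in_total a) xi = T h a xi.
Proof.
case: h a => t Ht a; have Ht' : subgroup_set H (proj (in_total a)).
  exact: set_mem Ht.
by rewrite -(rep_atE Ht') /rep_at (eq_irrelevance (mem_set Ht') Ht).
Qed.

Lemma opTE (h : subgroup_type H) (u : totalSpace B) xi :
  proj u = val h -> T h (fib (val h) u) xi = opT u xi.
Proof. by move=> hu; rewrite -opT_in_total in_totalK. Qed.

Lemma opT_mul (u v : totalSpace B) xi :
  subgroup_set H (proj u) -> subgroup_set H (proj v) ->
  opT (mulT u v) xi = opT u (opT v xi).
Proof.
move=> Hu Hv; rewrite -(rep_atE Hu) -(rep_atE Hv) /rep_at -repM.
by rewrite -(@opT_in_total (_ * _)%g).
Qed.

Lemma opT_star (u : totalSpace B) xi eta :
  ip (opT (starT u) xi) eta = ip xi (opT u eta).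
Proof.
have [Hu|Hu] := pselect (subgroup_set H (proj u)).
  rewrite -(rep_atE Hu) /rep_at -rep_adj.
  by rewrite -(@opT_in_total (_^-1)%g).
rewrite !opT_off ?ip0l ?ip0r// => Hu'; apply: Hu.
by rewrite -[proj u]invgK; exact: subgroupV.
Qed.

Lemma opT_linear (t : G) k (a b : B t) xi :
  opT (in_total (k *: a + b)) xi =
  k *: opT (in_total a) xi + opT (in_total b) xi.
Proof.
have [Ht|Ht] := pselect (subgroup_set H t).
  pose h : subgroup_type H := exist _ t (mem_set Ht).
  by rewrite !(@opT_in_total h) rep_linear.
by rewrite !opT_off// scaler0 addr0.
Qed.

Lemma opT_op_linear (u : totalSpace B) : linear (opT u).
Proof.
move=> k x y; rewrite /opT; case: pselect => [Hu|_].
  exact: rep_op_linear.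
by rewrite scaler0 addr0.
Qed.

Lemma opT_bound (u : totalSpace B) :
  exists2 M : R, 0 < M & forall xi, rnorm (opT u xi) <= M * rnorm xi.
Proof.
have [Hu|Hu] := pselect (subgroup_set H (proj u)).
  pose b : reduction B H (exist _ (proj u) (mem_set Hu)) := value u.
  have [M M0 h] := linear_bound (@rep_op_linear _ _ _ _ T _ b)
    (@rep_op_bounded _ _ _ _ T _ b).
  by exists M => // xi; rewrite -(rep_atE Hu); exact: h.
by exists 1 => // xi; rewrite opT_off// rnorm0 mul1r rnorm_ge0.
Qed.

Lemma opT0 (u : totalSpace B) : opT u 0 = 0.
Proof.
have := opT_op_linear u (-1) 0 0.
by rewrite scaler0 addr0 scaleN1r addNr.
Qed.

Lemma opTD (u : totalSpace B) x y : opT u (x + y) = opT u x + opT u y.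
Proof. by have := opT_op_linear u 1 x y; rewrite !scale1r. Qed.

Lemma opTZ (u : totalSpace B) k x : opT u (k *: x) = k *: opT u x.
Proof. by have := opT_op_linear u k x 0; rewrite opT0 !addr0. Qed.

Lemma opT_zero (t : G) xi : opT (in_total (0 : B t)) xi = 0.
Proof.
by have := opT_linear (-1) (0 : B t) 0 xi; rewrite scaler0 addr0 scaleN1r addNr.
Qed.

Lemma opT_mull_linear (u : totalSpace B) (t : G) k (a b : B t) xi :
  opT (mulT u (in_total (k *: a + b))) xi =
  k *: opT (mulT u (in_total a)) xi + opT (mulT u (in_total b)) xi.
Proof. by rewrite /mulT/= (bmul_linearr bsbB) opT_linear. Qed.

Lemma opT_starmul_linear (v : totalSpace B) (t : G) k (a b : B t) xi :
  opT (mulT (starT (in_total (k *: a + b))) v) xi =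
  k^*%C *: opT (mulT (starT (in_total a)) v) xi +
  opT (mulT (starT (in_total b)) v) xi.
Proof.
by rewrite /mulT/starT/= (bstar_conj_linear bsbB) (bmul_linearl bsbB) opT_linear.
Qed.

Lemma unit_fibre_positiveE :
  unit_fibre_positive T <->
  forall (u : totalSpace B) (xi : Y), 0 <= ip xi (opT (mulT (starT u) u) xi).
Proof.
have h (u : totalSpace B) xi : T 1%g (fib 1%g (mulT (starT u) u)) xi = opT (mulT (starT u) u) xi.
  by rewrite -(@opTE 1%g)//= /proj/= mulVg.
by split=> hp u xi; have := hp u xi; rewrite h.
Qed.

Lemma coset_positiveW : coset_positive T -> unit_fibre_positive T.
Proof.
move=> hT; apply/unit_fibre_positiveE => u xi.
pose alpha := [set (proj u * h)%g | h in H].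
have Ha : left_cosets H alpha by exists (proj u).
have Hu : alpha (proj u) by exists 1%g; [exact: subgroup1|rewrite mulg1].
have := hT alpha Ha 1%N isT (fun=> u) (fun=> Hu) (fun=> xi).
by rewrite !big_ord1 rep_atE.
Qed.

(** * The Gram operator of elements over one coset *)

Section GramPositive.
Hypothesis T_pos : unit_fibre_positive T.
Variables (n : nat) (b : 'I_n -> totalSpace B).
Hypothesis b_coset : forall i j, subgroup_set H ((proj (b i))^-1 * proj (b j))%g.

Local Notation V := {ffun 'I_n -> Y}.

Definition gram_form (x y : V) : R := \sum_i rip (x i) (y i).

Definition gram_op (x : V) : V :=
  [ffun j => \sum_k opT (mulT (starT (b j)) (b k)) (x k)].

Lemma gram_form_ge0 x : 0 <= gram_form x x.
Proof. by apply: sumr_ge0 => i _; rewrite rip_self sqr_ge0. Qed.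

Lemma gram_opD x y : gram_op (x + y) = gram_op x + gram_op y.
Proof.
apply/ffunP => j; rewrite !ffunE -big_split/=; apply: eq_bigr => k _.
by rewrite ffunE opTD.
Qed.

Lemma gram_opZ (t : R) x : gram_op (t%:C%C *: x) = t%:C%C *: gram_op x.
Proof.
apply/ffunP => j; rewrite !ffunE scaler_sumr; apply: eq_bigr => k _.
by rewrite ffunE opTZ.
Qed.

Lemma gram_adj i j x y :
  ip (opT (mulT (starT (b i)) (b j)) x) y =
  ip x (opT (mulT (starT (b j)) (b i)) y).
Proof. by rewrite -opT_star (bstarM bsbB) (bstarK bsbB). Qed.

Lemma gram_op_sym x y : gram_form (gram_op x) y = gram_form x (gram_op y).
Proof.
rewrite /gram_form.
transitivity (\sum_i \sum_k Re (ip (opT (mulT (starT (b i)) (b k)) (x k)) (y i))).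
  apply: eq_bigr => i _; rewrite ripC /rip ffunE ip_sumr raddf_sum /=.
  by apply: eq_bigr => k _; rewrite -/(rip _ _) ripC.
rewrite exchange_big/=; apply: eq_bigr => i _.
rewrite /rip ffunE ip_sumr raddf_sum /=.
by apply: eq_bigr => k _; rewrite gram_adj.
Qed.

Lemma gram_op_bound : exists2 M : R, 0 < M &
  forall x, gram_form (gram_op x) (gram_op x) <= M ^+ 2 * gram_form x x.
Proof.
have [m hm] : {m : 'I_n -> 'I_n -> R | forall i j, 0 < m i j /\
    forall xi, rnorm (opT (mulT (starT (b i)) (b j)) xi) <= m i j * rnorm xi}.
  have h i j : {mij : R | 0 < mij /\
      forall xi, rnorm (opT (mulT (starT (b i)) (b j)) xi) <= mij * rnorm xi}.
    by apply: cid; have [M M0 hM] := opT_bound (mulT (starT (b i)) (b j)); exists M.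
  by exists (fun i j => sval (h i j)) => i j; exact: svalP (h i j).
pose M0 : R := 1 + \sum_i \sum_j m i j.
have m0 i j : 0 <= m i j by rewrite ltW// (hm i j).1.
have sm i : 0 <= \sum_j m i j by apply: sumr_ge0.
have M0_gt0 : 0 < M0 by rewrite ltr_wpDr// sumr_ge0.
(* A factor [n] in front of [M0 ^+ 2] is what the sum over coordinates costs; the square of [n.+1]
   dominates it and is positive even for [n = 0]. *)
exists (n.+1%:R * M0); first by rewrite mulr_gt0// ltr0Sn.
move=> x; have r0 := gram_form_ge0 x.
have hx k : rnorm (x k) <= Num.sqrt (gram_form x x).
  rewrite -(ger0_norm (rnorm_ge0 (x k))) -sqrtr_sqr ler_sqrt//.
  rewrite /gram_form (bigD1 k)//= rip_self lerDl.
  by apply: sumr_ge0 => i _; rewrite rip_self sqr_ge0.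
have s0 : 0 <= Num.sqrt (gram_form x x) by rewrite sqrtr_ge0.
have hj j : rip (gram_op x j) (gram_op x j) <= M0 ^+ 2 * gram_form x x.
  rewrite rip_self -[in leRHS](sqr_sqrtr r0) -exprMn.
  rewrite ler_sqr ?nnegrE ?rnorm_ge0 ?mulr_ge0 ?(ltW M0_gt0)//.
  rewrite ffunE; apply: le_trans (ler_rnorm_sum _ _ _) _.
  apply: (@le_trans _ _ (\sum_k m j k * Num.sqrt (gram_form x x))).
    apply: ler_sum => k _; apply: le_trans ((hm j k).2 _) _.
    exact: ler_wpM2l.
  rewrite -mulr_suml ler_wpM2r// /M0 [X in 1 + X](bigD1 j)//=.
  rewrite addrCA lerDl addr_ge0// sumr_ge0//.
apply: (@le_trans _ _ (\sum_(i < n) M0 ^+ 2 * gram_form x x)).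
  by apply: ler_sum => j _; exact: hj.
rewrite sumr_const card_ord -[_ *+ n]mulr_natl exprMn -[leRHS]mulrA.
apply: ler_wpM2r; first by rewrite mulr_ge0// sqr_ge0.
by rewrite -natrX ler_nat (leq_trans (leqnSn n))// expnS expn1 leq_pmulr.
Qed.

(* The vectors [l xi e_i + (T_{c_j} xi)_j] with [c_j] over [s_j^-1 s_i], where
   [s_j] is the base point of [b j]: on them the Gram form is that of the
   single element [l b_i + \sum_j b_j c_j] over [s_i]. *)
Definition gram_cyclic (xi : Y) (i : 'I_n) : set V := [set x |
  exists (l : R[i]) (c : forall j, B ((proj (b j))^-1 * proj (b i))%g),
  forall j, x j = (if j == i then l else 0) *: xi + opT (in_total (c j)) xi].

Lemma gram_cyclicD xi i x y :
  gram_cyclic xi i x -> gram_cyclic xi i y -> gram_cyclic xi i (x + y).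
Proof.
move=> [l [c hc]] [l' [c' hc']]; exists (l + l'), (fun j => c j + c' j) => j.
rewrite ffunE hc hc'; have := opT_linear 1 (c j) (c' j) xi.
rewrite !scale1r => ->; rewrite addrACA -scalerDl; case: ifP => // _.
by rewrite addr0.
Qed.

Lemma gram_cyclicZ xi i (t : R) x :
  gram_cyclic xi i x -> gram_cyclic xi i (t%:C%C *: x).
Proof.
move=> [l [c hc]]; exists (t%:C%C * l), (fun j => t%:C%C *: c j) => j.
rewrite ffunE hc; have := opT_linear t%:C%C (c j) 0 xi.
rewrite addr0 opT_zero addr0 => ->; rewrite scalerDr scalerA.
by case: ifP => // _; rewrite mulr0.
Qed.

Definition gram_vec (i : 'I_n) (l : R[i])
    (c : forall j, B ((proj (b j))^-1 * proj (b i))%g) : B (proj (b i)) :=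
  l *: value (b i) +
  \sum_j fib (proj (b i)) (mulT (b j) (in_total (c j))).

Lemma proj_gram i (j : 'I_n) (c : B ((proj (b j))^-1 * proj (b i))%g) :
  proj (mulT (b j) (in_total c)) = proj (b i).
Proof. by rewrite /proj/= mulgA mulgV mul1g. Qed.

(** Both [b_j^* b_k] and [c_k] lie over [H], so [T] is multiplicative on their product, and summing
    over [k] collects the terms into [b_j^*] times [gram_vec]. *)
Lemma gram_op_cyclic xi i l c (x : V) :
  (forall j, x j = (if j == i then l else 0) *: xi + opT (in_total (c j)) xi) ->
  forall j, gram_op x j =
    opT (mulT (starT (b j)) (in_total (gram_vec (i := i) l c))) xi.
Proof.
move=> hx j; rewrite ffunE /gram_vec opT_mull_linear in_total_value.
transitivity (\sum_k ((if k == i then l else 0) *: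
      opT (mulT (starT (b j)) (b k)) xi +
    opT (mulT (starT (b j)) (b k)) (opT (in_total (c k)) xi))).
  by apply: eq_bigr => k _; rewrite hx opTD opTZ.
rewrite big_split/=; congr (_ + _).
  rewrite (bigD1 i)//= eqxx big1 ?addr0// => k /negPf ->.
  by rewrite scale0r.
rewrite (_ : opT _ _ = \sum_k opT (mulT (starT (b j)) (in_total
    (fib (proj (b i)) (mulT (b k) (in_total (c k)))))) xi); last first.
  apply: (big_morph (fun a => opT (mulT (starT (b j)) (in_total a)) xi)).
    move=> a a'; have := opT_mull_linear (starT (b j)) 1 a a' xi.
    by rewrite !scale1r.
  have := opT_mull_linear (starT (b j)) (-1) (0 : B (proj (b i))) 0 xi.
  by rewrite scaler0 addr0 scaleN1r addNr.
apply: eq_bigr => k _; rewrite in_totalK ?proj_gram//.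
by rewrite (bmulA bsbB) [RHS]opT_mul//; exact: b_coset.
Qed.

Lemma gram_cyclic_inv xi i x :
  gram_cyclic xi i x -> gram_cyclic xi i (gram_op x).
Proof.
(* Every coordinate of the image is already of the form [T_c xi], so its scalar part is 0. *)
move=> [l [c hc]]; exists 0, (fun j =>
  bmul (bstar (value (b j))) (gram_vec l c)) => j.
by rewrite (gram_op_cyclic hc) if_same scale0r add0r.
Qed.

Lemma gram_cyclic_pos xi i x :
  gram_cyclic xi i x -> 0 <= gram_form x (gram_op x).
Proof.
move=> [l [c hc]]; pose d := in_total (gram_vec l c).
suff -> : gram_form x (gram_op x) = rip xi (opT (mulT (starT d) d) xi).
  move/unit_fibre_positiveE : T_pos => /(_ d xi).
  by move=> /cplx_ge0P[].
rewrite /gram_form /rip.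
rewrite [in RHS]/d {1}/gram_vec opT_starmul_linear in_total_value.
rewrite ipDr raddfD/=.
transitivity (\sum_j (Re (ip ((if j == i then l else 0) *: xi) (gram_op x j)) +
   Re (ip (opT (in_total (c j)) xi) (gram_op x j)))).
  by apply: eq_bigr => j _; rewrite hc ipDl raddfD.
rewrite big_split/=; congr (_ + _).
  rewrite (bigD1 i)//= eqxx big1 ?addr0; last first.
    by move=> k /negPf ->; rewrite scale0r ip0l.
  rewrite (gram_op_cyclic hc) -/d ipZr ip_conj ipZr rmorphM/= -ip_conj.
  by [].
rewrite (_ : opT _ _ = \sum_k opT (mulT (starT (in_total
    (fib (proj (b i)) (mulT (b k) (in_total (c k)))))) d) xi); last first.
  apply: (big_morph (fun a => opT (mulT (starT (in_total a)) d) xi)).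
    move=> a a'; have := opT_starmul_linear d 1 a a' xi.
    by rewrite rmorph1 !scale1r.
  have := opT_starmul_linear d (-1) (0 : B (proj (b i))) 0 xi.
  by rewrite scaler0 addr0 rmorphN rmorph1 scaleN1r addNr.
rewrite ip_sumr raddf_sum /=; apply: eq_bigr => j _.
(* [(b_j c_j)^* d = c_j^* (b_j^* d)] with both factors over [H]; the operator of [c_j^*] then moves
   to the left slot as that of [c_j]. *)
rewrite in_totalK ?proj_gram// (bstarM bsbB) -(bmulA bsbB) opT_mul.
- by rewrite [ip xi _]ip_conj opT_star -ip_conj (gram_op_cyclic hc).
- by apply: subgroupV; exact: b_coset.
- exact: b_coset.
Qed.

End GramPositive.

Lemma unit_fibre_coset_positive : unit_fibre_positive T -> coset_positive T.
Proof.
move=> T_pos alpha Ha n n0 b Hb xi.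
have b_coset i j : subgroup_set H ((proj (b i))^-1 * proj (b j))%g.
  exact: (left_coset_invM Ha (Hb i) (Hb j)).
under eq_bigr do under eq_bigr do rewrite rep_atE.
apply/cplx_ge0P; split; last first.
  (* The double sum equals its conjugate, because the Gram matrix is self-adjoint. *)
  set z := \sum_i _; suff : z^*%C = z by case: z => x y /= [] ?; lra.
  rewrite /z rmorph_sum/=; under eq_bigr do rewrite rmorph_sum/=.
  rewrite exchange_big/=; apply: eq_bigr => i _; apply: eq_bigr => j _.
  by rewrite -ip_conj gram_adj.
(* The coordinate vectors are cyclic, with [l = 1] and [c = 0], each for its own vector [xi i];
   their sum is the whole family. *)
pose e i : {ffun 'I_n -> Y} := [ffun j => if j == i then xi i else 0].
pose x : {ffun 'I_n -> Y} := \sum_i e i.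
have xE i : x i = xi i.
  rewrite /x sum_ffunE (bigD1 i)//= ffunE eqxx big1 ?addr0// => k ki.
  by rewrite ffunE eq_sym (negPf ki).
have [M M0 hM] := gram_op_bound b.
have := @positive_on_sum R {ffun 'I_n -> Y} (@gram_form n) _ _ _
  (@gram_form_ge0 n) (gram_op b) M (gram_opD b) (gram_opZ b) (gram_op_sym b) M0 hM
  _ (fun i => gram_cyclic b (xi i) i) e.
rewrite -/x => h.
suff -> : Re (\sum_i \sum_j ip (xi i) (opT (mulT (starT (b i)) (b j)) (xi j))) =
   gram_form x (gram_op b x).
  apply: h.
  - by move=> y z; apply: eq_bigr => i _; rewrite ripC.
  - move=> y z w; rewrite /gram_form -big_split/=; apply: eq_bigr => i _.
    by rewrite ffunE ripDr.
  - move=> y t z; rewrite /gram_form mulr_sumr; apply: eq_bigr => i _.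
    by rewrite ffunE ripZr.
  - by move=> i y z; exact: gram_cyclicD.
  - by move=> i t y; exact: gram_cyclicZ.
  - by move=> i y; exact: gram_cyclic_inv.
  - by move=> i y; exact: gram_cyclic_pos.
  - move=> i; exists 1, (fun=> 0) => j.
    by rewrite ffunE opT_zero addr0; case: eqP => _; rewrite ?scale1r ?scale0r.
rewrite raddf_sum/=; apply: eq_bigr => i _; rewrite /rip xE ffunE ip_sumr.
by congr Re; apply: eq_bigr => j _; rewrite xE.
Qed.

End TotalRep.

(** * Fell bundles *)

Section Fell.
Variables (R : realType) (G : topGroupType) (H : closedSubgroup G).
Variables (B : starBundle R G) (bsbB : banach_star_bundle B).
Variables (Y : hilbertType R) (T : starRep (reduction B H) Y).

Lemma opT_emul (a b : B 1%g) xi :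
  opT T (in_total (emul a b)) xi = opT T (in_total a) (opT T (in_total b) xi).
Proof.
rewrite /emul in_totalK ?/proj/= ?mulg1//.
by rewrite -opT_mul//; exact: subgroup1.
Qed.

(** A real [m < 0] lies outside the spectrum of [a], so [(m, - a)] has an inverse [(w, c)] in the
    unitization. The bounded operator [w + T_c] then undoes [m - T_a], which makes [T_a - m] bounded
    below; the spectral criterion concludes. *)
Lemma opT_positive_elt (a : B 1%g) xi :
  positive_elt a -> 0 <= ip xi (opT T (in_total a) xi).
Proof.
move=> [a_sa a_sp].
have S_adj x y : ip (opT T (in_total a) x) y = ip x (opT T (in_total a) y).
  rewrite -opT_star; congr (ip (opT T _ x) y).
  by rewrite -{1}a_sa /estar in_totalK// /proj/= invg1.
apply/cplx_ge0P; split; last first.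
  have : (ip xi (opT T (in_total a) xi))^*%C = ip xi (opT T (in_total a) xi).
    by rewrite -ip_conj S_adj.
  by case: (ip _ _) => x y /= [] ?; lra.
have rC := @ripC R Y; have rD := @ripDr R Y; have rZ := @ripZr R Y.
have r0 (x : Y) : 0 <= rip x x by rewrite rip_self sqr_ge0.
have [M M0 hM] := opT_bound T (in_total a).
apply: (@positive_of_bounded_below _ _ _ rC rD rZ r0 (opT T (in_total a)) M).
- exact: opTD.
- by move=> t x; exact: opTZ.
- by move=> x y; rewrite /rip S_adj.
- exact: M0.
- move=> x; rewrite !rip_self -exprMn.
  by rewrite ler_sqr ?nnegrE ?rnorm_ge0// mulr_ge0 ?rnorm_ge0 ?ltW.
move=> m m0.
have : ~ spectrum a m%:C%C.
  by move=> /a_sp; rewrite ler0c leNgt m0.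
move=> /contrapT[[w c] [_ []]]/= hw hc.
have [K K0 hK] := opT_bound T (in_total c).
pose C := Re `|w| + K.
have nw : 0 <= Re `|w| by rewrite (le_trans _ (rnorm_cplx_le w)).
have C0 : 0 < C by rewrite ltr_wpDl.
exists (C ^+ 2); first by rewrite exprn_gt0.
move=> x; rewrite !rip_self -exprMn.
rewrite ler_sqr ?nnegrE ?rnorm_ge0// ?mulr_ge0 ?rnorm_ge0 ?(ltW C0)//.
set y := _ + _.
(* The second component of [(w, c) (m, - a) = (1, 0)], represented and evaluated at [x]. The sign
   appears because [y] is [(T_a - m) x]. *)
have -> : x = - (w *: y + opT T (in_total c) y).
  have oN (b : B 1%g) z : opT T (in_total (- b)) z = - opT T (in_total b) z.
    by rewrite -scaleN1r -[_ *: b]addr0 opT_linear opT_zero addr0 scaleN1r.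
  have := congr1 (fun b => opT T (in_total b) x) hc.
  rewrite opT_zero -[emul _ _]scale1r -addrA !opT_linear scale1r opT_emul !oN.
  rewrite -[- opT T (in_total a) x]scaleN1r !opTZ => h.
  rewrite /y !opTD !opTZ scalerDr scalerA rmorphN mulrN hw !scaleNr scale1r.
  apply/eqP; rewrite -addr_eq0; apply/eqP; rewrite -[RHS]oppr0 -h.
  rewrite !scaleN1r scalerN !opprD !opprK.
  by rewrite addrA (addrC x) subrK addrA [RHS]addrA addrAC.
rewrite rnormN; apply: le_trans (ler_rnormD _ _) _.
rewrite rnormZ /C mulrDl lerD2l; exact: hK.
Qed.

Lemma fell_unit_fibre_positive : fell_bundle B -> unit_fibre_positive T.
Proof.
move=> fB; apply/unit_fibre_positiveE => u xi.
have := opT_positive_elt xi (fell_positive fB u).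
by rewrite in_totalK// /proj/= mulVg.
Qed.

End Fell.

(** * Integration on locally compact groups *)

Section LocallyCompact.
Variables (R : realType) (X : topologicalType).

Lemma compact_finite_cover (K : set X) (U : X -> set X) :
  compact K -> (forall x, K x -> nbhs x (U x)) ->
  exists (n : nat) (x : 'I_n -> X),
    (forall i, K (x i)) /\ forall y, K y -> exists i, U (x i) y.
Proof.
(* The covering form of compactness is used on a pointed space: the empty set is treated apart, and
   otherwise a point of [K] serves as base point. *)
move=> cK hU; have [->|/set0P[x0 _]] := eqVneq K set0.
  have x : 'I_0 -> X by case.
  by exists 0%N, x; split => [[]//|y []].
pose pX : ptopologicalType := HB.pack (Topological.sort X) (isPointed.Build X x0).
have coverK : @cover_compact pX K by rewrite -compact_cover.
have [||D DK cov] := coverK X K (fun x => (U x)^°).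
- by move=> x _; exact: open_interior.
- by move=> y Ky; exists y => //; exact: hU.
exists (size (enum_fset D)), (tnth (in_tuple (enum_fset D))); split.
  by move=> i; apply/set_mem/DK; exact: mem_tnth.
move=> y /cov[x /= xD Uy].
have : x \in in_tuple (enum_fset D) by exact: xD.
by move=> /tnthP[i ei]; exists i; rewrite -ei; exact: interior_subset Uy.
Qed.

Hypothesis lchX : lch X.

(** Complete regularity gives [g] with value 0 at [x] and 1 off the interior of the intersection of
    [U] with a compact [C]. Truncating at level 1/2 confines the nonzero set of the bump to
    [g <= 1/2], a closed part of [C], hence compact. *)
Lemma lch_bump (x : X) (U : set X) : nbhs x U ->
  exists f : X -> R, [/\ continuous f, forall y, 0 <= f y, f x = 1 &
    exists K, [/\ compact K, nbhs x K, K `<=` U & forall y, f y != 0 -> K y]].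
Proof.
move=> Ux; have [hX lX] := lchX.
have [C] := lX x I; rewrite withinET => Cx [cC clC].
have oV : open (U `&` C)^° by exact: open_interior.
have Vx : (U `&` C)^° x by exact: filterI.
have := @locally_compact_completely_regular X R lX hX x (~` (U `&` C)^°).
move=> /(_ (open_closedC oV) (fun h => h Vx)).
move=> /(@uniform_separatorP X R)[g [cg g01 g0 g1]].
have gx : g x = 0 by apply: g0; exists x.
have cg' : continuous (fun y => Num.max 0 (1 - 2 * g y)).
  move=> y; apply: (@continuous_max _ _ (fun=> 0) (fun y => 1 - 2 * g y)).
    exact: cvg_cst.
  by apply: cvgB; [exact: cvg_cst|apply: cvgM; [exact: cvg_cst|exact: cg]].
exists (fun y => Num.max 0 (1 - 2 * g y)); split => //.
- by move=> y; rewrite le_max lexx.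
- by rewrite gx mulr0 subr0; apply/max_idPr.
pose K := [set y | g y <= 1 / 2].
have KV : K `<=` (U `&` C)^°.
  rewrite /K => y /= gy; apply: contrapT => nV.
  have gy1 : g y = 1 by apply: g1; exists y.
  by move: gy; rewrite gy1; lra.
have clK : closed K.
  apply: (@closed_comp _ _ g [set t | t <= 1 / 2]); last exact: closed_le.
  by move=> y _; exact: cg.
exists K; split.
- apply: subclosed_compact cC _ => // y /KV /interior_subset[] //.
- have : nbhs (g x) [set t | t <= 1 / 2].
    by rewrite gx; apply: lt_le_nbhsl; lra.
  exact: cg.
- by move=> y /KV /interior_subset[].
move=> y; apply: contraNP => /negP; rewrite -ltNge => h.
by apply/eqP/max_idPl; lra.
Qed.

Lemma lch_compact_nbhs (x : X) (U : set X) : nbhs x U ->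
  exists K, [/\ compact K, nbhs x K & K `<=` U].
Proof. by move=> /lch_bump[f [_ _ _ [K [? ? ? _]]]]; exists K. Qed.

Lemma lch_bump_compact (C : set X) : compact C ->
  exists f : X -> R, [/\ continuous f, forall y, 0 <= f y,
    forall y, C y -> 0 < f y &
    exists2 K, compact K & forall y, f y != 0 -> K y].
Proof.
move=> cC.
have [f hf] := choice (fun x : X => lch_bump (@filterT _ (nbhs x) _)).
have [|n [x [_ cov]]] := @compact_finite_cover C
  (fun x => [set y | 0 < f x y]) cC.
  move=> x _; have [cf f0 fx _] := hf x.
  have : nbhs (f x x) [set t : R | 0 < t] by apply: lt_nbhsr; rewrite fx.
  exact: cf.
exists (fun y => \sum_(i < n) f (x i) y); split.
- move=> y; apply: cvg_big => [|i _].
  + exact: (@add_continuous R).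
  + by have [cf _ _ _] := hf (x i); exact: cf.
- by move=> y; apply: sumr_ge0 => i _; have [] := hf (x i).
- move=> y /cov[i fi]; rewrite (bigD1 i)//= ltr_wpDr//.
  by apply: sumr_ge0 => j _; have [] := hf (x j).
have hK (i : 'I_n) : {K | compact K /\ forall y, f (x i) y != 0 -> K y}.
  by apply: cid; have [_ _ _ [K [? ? ? ?]]] := hf (x i); exists K.
exists (\big[setU/set0]_(i < n) sval (hK i)).
  by apply: bigsetU_compact => i _; have [] := svalP (hK i).
move=> y; apply: contraNP => nK; apply/eqP; rewrite big1// => i _.
apply/eqP; apply: contrapT => /negP h; apply: nK.
rewrite (bigD1 i)//=; left.
by have [_] := svalP (hK i); apply.
Qed.

End LocallyCompact.

Section ClosedSubgroup.
Variables (G : topGroupType) (H : closedSubgroup G).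
Hypothesis lchG : lch G.
Local Notation HT := (subgroup_type H).

Lemma subgroup_valP (h : HT) : subgroup_set H (val h).
Proof. by case: h => t; exact: set_mem. Qed.

Lemma nbhs_subgroup (h : HT) (A : set HT) :
  nbhs h A -> exists2 U : set G, nbhs (val h) U & val @^-1` U `<=` A.
Proof.
move=> [U [[W oW <-]] /= Wh WA]; exists W => //.
by apply: open_nbhs_nbhs.
Qed.

(** As [H] is closed, its intersection with [K] is compact, so the cluster point found in [G]
    belongs to [H]. *)
Lemma compact_subgroup (K : set G) :
  compact K -> compact ((val : HT -> G) @^-1` K).
Proof.
move=> cK F FF FK.
have cKH : compact (K `&` H) by apply: compact_closedI => //; exact: subgroup_closed.
have [|p [[Kp Hp] clp]] := cKH (val @ F) _.
  by apply: (@filterS HT F _ _ _ _ FK) => h Kh; split; [exact: Kh|exact: subgroup_valP].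

pose q : HT := exist _ p (mem_set Hp).
exists q; split => // A A' FA /nbhs_subgroup[U Uq UA'].
have [|_ [[h Ah <-] Uh]] := clp (val @` A) U _ Uq.
  by apply: (@filterS HT F _ _ _ _ FA) => h Ah; exists h.
by exists h; split => //; exact: UA'.
Qed.

Lemma lch_subgroup : lch HT.
Proof.
have [hG lG] := lchG; split.
  move=> p q clpq; apply: val_inj; apply: hG => A A' Ap A'q.
  have [||h [Ah A'h]] := clpq (val @^-1` A) (val @^-1` A').
  - exact: (@subgroup_val_continuous G H p A).
  - exact: (@subgroup_val_continuous G H q A').
  - by exists (val h).
move=> h _; have [K] := lG (val h) I; rewrite !withinET => Kh [cK clK].
exists (val @^-1` K); first exact: (@subgroup_val_continuous G H h K).
split; first exact: compact_subgroup.
apply: closed_comp clK => x _; exact: subgroup_val_continuous.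
Qed.

End ClosedSubgroup.

Lemma tube_lt (R : realType) (X Y : topologicalType) (g : X * Y -> R)
    (L : set Y) (x0 : X) (e : R) :
  continuous g -> compact L -> (forall y, L y -> g (x0, y) < e) ->
  \forall x \near x0, forall y, L y -> g (x, y) < e.
Proof.
move=> cg /compact_near_coveringP cL hg.
have := cL X (nbhs x0) (fun x y => g (x, y) < e) _ _.
apply => y Ly; have : nbhs (g (x0, y)) [set t | t < e].
  by apply: lt_nbhsl; exact: hg.
move=> /(cg (x0, y)) [[A A'] /= [Ax Ay] AA].
exists (A', A) => //= -[y' x'] [/= Ay' Ax']; exact: (AA (x', y')).
Qed.

(** * Finite Borel partitions of compact sets *)

Section Partition.
Variables (G : topGroupType) (hG : hausdorff_space G).
Implicit Types (K U : set G).

Lemma borel_open U : open U -> measurable (U : set (borel G)).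
Proof. by move=> oU; exact: sub_sigma_algebra. Qed.

Lemma borel_closed K : closed K -> measurable (K : set (borel G)).
Proof.
move=> cK; rewrite -(setCK K); apply: measurableC.
exact: borel_open (closed_openC cK).
Qed.

Lemma borel_compact K : compact K -> measurable (K : set (borel G)).
Proof. by move=> cK; apply: borel_closed; exact: compact_closed. Qed.

Lemma borel_continuous (R : realType) (f : G -> R) :
  continuous f -> measurable_fun setT (f : borel G -> R).
Proof.
move=> cf; apply: (measurability _ (measurable_realfun.RGenOInfty.measurableE R)).
move=> _ [_ [x ->] <-]; rewrite setTI; apply: borel_open.
apply: open_comp; first by move=> y _; exact: cf.
by rewrite set_itvoy; exact: open_gt.
Qed.

Lemma simple_sum_in (K : pzRingType) (V : lmodType K) n (E : 'I_n -> set G)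
    (c : 'I_n -> V) i y : trivIset setT E -> E i y ->
  \sum_(j < n) (\1_(E j) y : K) *: c j = c i.
Proof.
move=> tE Ey; rewrite (bigD1 i)//= indicE mem_set// scale1r big1 ?addr0//.
move=> j ji; rewrite indicE memNset ?scale0r// => Ejy.
have : j = i by apply: tE => //; exists y.
by move=> /eqP; rewrite (negPf ji).
Qed.

Lemma simple_sum_out (K : pzRingType) (V : lmodType K) n (E : 'I_n -> set G)
    (c : 'I_n -> V) y : (forall i, ~ E i y) ->
  \sum_(j < n) (\1_(E j) y : K) *: c j = 0.
Proof.
by move=> h; rewrite big1// => j _; rewrite indicE memNset ?scale0r.
Qed.

(** Tagged partitions. The tag [x i] lies in [K] but perhaps outside [E i], since earlier pieces may
    have taken it; closeness to the tag value is therefore always a separate condition on the points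
    of [E i]. *)
Record mpartition K n (E : 'I_n -> set (borel G)) (x : 'I_n -> G) : Prop := {
  mp_in : forall i, K (x i) ;
  mp_meas : forall i, measurable (E i) ;
  mp_triv : trivIset setT E ;
  mp_sub : forall i, E i `<=` K ;
  mp_cover : forall y, K y -> exists i, E i y }.

Lemma compact_partition K (P : G -> G -> Prop) :
  compact K -> (forall x, K x -> \forall y \near x, P x y) ->
  exists n (E : 'I_n -> set (borel G)) (x : 'I_n -> G),
    mpartition K E x /\ forall i y, E i y -> P (x i) y.
Proof.
move=> cK hP.
have [|n [x [xK cov]]] := compact_finite_cover (U := fun x => [set y | P x y]^°) cK.
  by move=> x Kx; apply: open_nbhs_nbhs; split;
    [exact: open_interior|exact: hP].
pose U i : set (borel G) := [set y | P (x i) y]^°.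
have mU i : measurable (U i) by apply: borel_open; exact: open_interior.
(* Each point is assigned to the covering set of least index. *)
pose E i : set (borel G) := (K `&` U i) `\` \bigcup_(j in [set j : 'I_n | (j < i)%N]) U j.
exists n, E, x; split; last by move=> i y [[_ /interior_subset]].
split => //.
- move=> i; apply: measurableD.
    by apply: measurableI => //; exact: borel_compact.
  apply: fin_bigcup_measurable => //; exact: finite_finset.
- move=> i j _ _ [y [[[_ Ui] Ni] [[_ Uj] Nj]]]; apply: ord_inj.
  case: (ltngtP i j) => // lt; exfalso.
    by apply: Nj; exists i; [exact: lt|exact: Ui].
  by apply: Ni; exists j; [exact: lt|exact: Uj].
- by move=> i y [[]].
move=> y Ky; have [i0 Ui0] := cov _ Ky.
have /asboolP ex0 : `[< U i0 y >] by apply/asboolP.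
case: (@arg_minnP _ i0 (fun i => `[< U i y >]) (fun i => i : nat)).
  exact/asboolP.
move=> i /asboolP Ui imin; exists i; split => // -[j /= ji /asboolP Uj].
by have := imin j Uj; rewrite leqNgt ji.
Qed.

End Partition.

(** * Integrals of compactly supported continuous functions *)

Section Integral.
Variables (R : realType) (G : topGroupType) (hG : hausdorff_space G).
Variable mu : {measure set (borel G) -> \bar R}.
Hypothesis mu_fin : forall K : set G, compact K -> (mu K < +oo)%E.

Definition cc_fun (X : topologicalType) (f : X -> R) : Prop :=
  continuous f /\ exists2 K, compact K & forall x, f x != 0 -> K x.

Notation Int f := (Rintegral mu setT (f : borel G -> R)).
Notation integrableR f := (mu.-integrable setT (EFin \o (f : borel G -> R))).
Notation vol E := (fine (mu (E : set (borel G)))).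

Lemma finite_measure_finE (E : set (borel G)) :
  (mu E < +oo)%E -> (vol E)%:E = mu E.
Proof. by move=> h; rewrite fineK// ge0_fin_numE. Qed.

Lemma vol_ge0 (E : set (borel G)) : 0 <= vol E.
Proof. by rewrite fine_ge0. Qed.

Lemma Int_indic (E : set (borel G)) : measurable E -> (mu E < +oo)%E ->
  integrableR (\1_E) /\ Int (\1_E) = vol E.
Proof.
move=> mE fE; split.
  apply/integrableP; split.
    by apply/measurable_EFinP; exact: measurable_indic.
  under eq_integral do rewrite /= ger0_norm ?indicE ?ler0n// -indicE.
  by rewrite integral_indic// setIT.
by rewrite /Rintegral integral_indic// setIT.
Qed.

Lemma Int_simple n (E : 'I_n -> set (borel G)) (c : 'I_n -> R) :
  (forall i, measurable (E i) /\ (mu (E i) < +oo)%E) ->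
  integrableR (fun x => \sum_(i < n) \1_(E i) x * c i) /\
  Int (fun x => \sum_(i < n) \1_(E i) x * c i) = \sum_(i < n) vol (E i) * c i.
Proof.
elim: n E c => [|n IH] E c hE.
  have -> : (fun x : borel G => \sum_(i < 0) \1_(E i) x * c i) = cst 0.
    by apply/funext => x; rewrite big_ord0.
  split; first exact: integrable0.
  by rewrite big_ord0 Rintegral_cst// mul0r.
have [i1 i2] := IH _ (fun i => c (widen_ord (leqnSn n) i))
  (fun i => hE (widen_ord (leqnSn n) i)).
have [j1 j2] := Int_indic (hE ord_max).1 (hE ord_max).2.
have -> : (fun x : borel G => \sum_(i < n.+1) \1_(E i) x * c i) =
   (fun x => \sum_(i < n) \1_(E (widen_ord (leqnSn n) i)) x * c (widen_ord (leqnSn n) i)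
      + \1_(E ord_max) x * c ord_max).
  by apply/funext => x; rewrite big_ord_recr.
have k1 : integrableR (fun x => \1_(E ord_max) x * c ord_max).
  have := @integrableZr _ _ R mu setT measurableT (c ord_max) _ j1.
  by [].
split; first by have := integrableD measurableT i1 k1.
by rewrite RintegralD// big_ord_recr/= RintegralZr// j2 i2.
Qed.

Lemma Int_close (f : G -> R) (A : set (borel G)) n (E : 'I_n -> set (borel G))
    (c : 'I_n -> R) (e : R) :
  integrableR f -> measurable A -> (mu A < +oo)%E ->
  (forall i, measurable (E i) /\ (mu (E i) < +oo)%E) ->
  (forall x, `|f x - \sum_(i < n) \1_(E i) x * c i| <= e * \1_A x) ->
  `|Int f - \sum_(i < n) vol (E i) * c i| <= e * vol A.
Proof.
move=> fi mA fA hE he; have [s1 s2] := Int_simple c hE.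
have [a1 a2] := Int_indic mA fA.
rewrite -s2 -RintegralB//; apply: le_trans (le_normr_Rintegral _ _) _ => //.
  by have := integrableB measurableT fi s1.
rewrite -a2 -RintegralZl//; apply: le_Rintegral => //.
- have := integrableB measurableT fi s1 => /integrable_abse.
  by [].
- have := @integrableZl _ _ R mu setT measurableT e _ a1.
  by [].
Qed.

Lemma cc_bounded (X : topologicalType) (f : X -> R) :
  cc_fun f -> exists2 M : R, 0 < M & forall x, `|f x| <= M.
Proof.
move=> [cf [K cK fK]].
have cfK : compact (f @` K).
  by apply: continuous_compact => //; exact: continuous_subspaceT.
have [M [Mr hM]] := compact_bounded cfK.
pose N := `|M| + 1; have MN : M < N.
  by rewrite /N (le_lt_trans (ler_norm M))// ltrDl.
have N0 : 0 < N by rewrite /N ltr_wpDl.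
exists N => // x; have [->|fx] := eqVneq (f x) 0; first by rewrite normr0 ltW.
by apply: (hM N MN); exists x => //; exact: fK.
Qed.

Lemma cc_integrable (f : G -> R) : cc_fun f -> integrableR f.
Proof.
move=> ccf; have [M M0 hM] := cc_bounded ccf; have [cf [K cK fK]] := ccf.
have mK := borel_compact hG cK.
have -> : EFin \o (f : borel G -> R) = (EFin \o f) \_ (K : set (borel G)).
  apply/funext => x; rewrite patchE; case: ifPn => // /negP xK /=.
  congr EFin; apply/eqP; apply: contrapT => /negP /fK Kx.
  by apply: xK; exact/mem_set.
apply: (iffLR (integrable_mkcond _ mK)).
apply: (@measurable_bounded_integrable _ (borel G) R mu f K) => //; first exact: mu_fin.
- by apply: measurable_funS (borel_continuous cf).
- exists M; split; first exact: num_real.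
  by move=> N MN x _; apply: le_trans (hM x) _; exact: ltW.
Qed.

Lemma mp_fin K n (E : 'I_n -> set (borel G)) x : compact K ->
  mpartition K E x -> forall i, measurable (E i) /\ (mu (E i) < +oo)%E.
Proof.
move=> cK hE i; split; first exact: mp_meas hE i.
apply: le_lt_trans (mu_fin cK); apply: le_measure.
- by apply/mem_set; exact: mp_meas hE i.
- by apply/mem_set; exact: borel_compact.
- exact: mp_sub hE i.
Qed.

(** [nu] is either the absolute value or the norm of a Banach space, so real and vector-valued sums
    share the estimate. *)
Lemma mp_sum_dist (V : zmodType) (nu : V -> R) K n (E : 'I_n -> set (borel G)) x
    (F : G -> V) (s : G -> V) (e : R) :
  0 <= e -> nu 0 = 0 ->
  mpartition K E x -> (forall y, ~ K y -> F y = 0) ->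
  (forall i y, E i y -> s y = F (x i)) ->
  (forall y, ~ K y -> s y = 0) ->
  (forall i y, E i y -> nu (F y - F (x i)) <= e) ->
  forall y, nu (F y - s y) <= e * \1_K y.
Proof.
move=> e0 nu0 hE F0 sE s0 he y; have [Ky|nKy] := pselect (K y).
  have [i Ey] := mp_cover hE Ky.
  by rewrite indicE mem_set// mulr1 (sE i)//; exact: he.
by rewrite F0// s0// subr0 nu0 indicE memNset// mulr0.
Qed.

Lemma Int_partition (f : G -> R) K n (E : 'I_n -> set (borel G)) x (e : R) :
  integrableR f -> compact K -> (forall y, f y != 0 -> K y) ->
  0 <= e -> mpartition K E x ->
  (forall i y, E i y -> `|f y - f (x i)| <= e) ->
  `|Int f - \sum_(i < n) vol (E i) * f (x i)| <= e * vol K.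
Proof.
move=> fi cK fK e0 hE he; have mK := borel_compact hG cK.
apply: Int_close => //; [exact: mu_fin|exact: mp_fin hE|].
apply: (mp_sum_dist (nu := Num.norm) e0 (normr0 _) hE) => //.
- move=> y nKy; apply/eqP; apply: contrapT => /negP /fK; exact: nKy.
- move=> i y Ey; exact: (@simple_sum_in G R R^o n E _ i y (mp_triv hE) Ey).
- move=> y nKy; apply: (@simple_sum_out G R R^o n E) => i Ey.
  by apply: nKy; exact: mp_sub hE _ _ Ey.
Qed.

Lemma mp_vol_sum K n (E : 'I_n -> set (borel G)) x (A : set (borel G)) :
  compact K -> mpartition K E x -> measurable A -> A `<=` K ->
  vol A = \sum_(i < n) vol (A `&` E i).
Proof.
move=> cK hE mA AK; have mK := borel_compact hG cK.
have AE (i : 'I_n) : measurable (A `&` E i) /\ (mu (A `&` E i) < +oo)%E.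
  have [mE fE] := mp_fin cK hE i; have mAE := measurableI _ _ mA mE.
  split => //; apply: le_lt_trans fE; apply: le_measure => //; exact/mem_set.
have fA : (mu A < +oo)%E.
  apply: le_lt_trans (mu_fin cK); apply: le_measure => //; exact/mem_set.
have [_ <-] := Int_indic mA fA.
have [_] := Int_simple (fun=> 1) AE.
under [X in _ = X -> _]eq_bigr do rewrite mulr1.
move=> <-; congr (Rintegral _ _ _); apply/funext => y.
have tAE : trivIset setT (fun i => A `&` E i).
  move=> i j _ _ [z [[_ Ei] [_ Ej]]].
  by apply: (mp_triv hE) => //; exists z.
rewrite indicE; have [Ay|Ay] := pselect (A y).
  have [i Ey] := mp_cover hE (AK _ Ay).
  have := @simple_sum_in G R R^o n (fun i => A `&` E i) (fun=> 1) i y tAE.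
  by rewrite mem_set// => -> //.
have := @simple_sum_out G R R^o n (fun i => A `&` E i) (fun=> 1) y.
by rewrite memNset// => -> // i [].
Qed.

Lemma cc_partition (f : G -> R) K (e : R) : continuous f -> compact K -> 0 < e ->
  exists n (E : 'I_n -> set (borel G)) (x : 'I_n -> G),
    mpartition K E x /\ forall i y, E i y -> `|f y - f (x i)| <= e.
Proof.
move=> cf cK e0.
apply: (@compact_partition G hG K (fun x y => `|f y - f x| <= e)) => // x _.
have := cf x => /cvgrPdist_le /(_ e e0).
by apply: filterS => y; rewrite distrC.
Qed.

(** A partition adapted to [f] pulls back along [phi] with the same tag values and with volumes
    multiplied by [c], so the two integrals are approximated by proportional sums. *)
Lemma Int_subst (f : G -> R) (phi : G -> G) (c : R) : 0 <= c ->
  cc_fun f -> cc_fun (f \o phi) -> continuous phi ->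
  (forall E : set (borel G), measurable E ->
     mu (phi @^-1` E) = (c%:E * mu E)%E) ->
  Int (f \o phi) = c * Int f.
Proof.
move=> c0 ccf ccfp cphi hmu; have [cf [K cK fK]] := ccf.
have mK := borel_compact hG cK.
have mphi (E : set (borel G)) : measurable E -> measurable (phi @^-1` E : set (borel G)).
  have : measurable_fun setT (phi : borel G -> borel G).
    apply: (@measurability _ _ (borel G) (borel G) setT phi (@open G) erefl).
    move=> _ [U oU <-]; rewrite setTI; apply: borel_open.
    by apply: open_comp => // y _; exact: cphi.
  by move=> h mE; rewrite -[X in measurable X]setTI; exact: h.
have fphi (E : set (borel G)) : measurable E -> (mu E < +oo)%E ->
    (mu (phi @^-1` E) < +oo)%E /\ vol (phi @^-1` E) = c * vol E.
  move=> mE fE; rewrite hmu// -finite_measure_finE// -EFinM.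
  by split; [exact: ltry|].
apply/eqP; rewrite -subr_eq0 -normr_le0; apply/ler_addgt0Pl => e e0.
rewrite addr0.
(* Each of the two approximations costs [e' * (c * vol K)]; the [+ 1] keeps the divisor positive
   when this vanishes. *)
have d0 : 0 < 2 * (c * vol K) + 1.
  by rewrite ltr_wpDl// mulr_ge0// mulr_ge0// vol_ge0.
have [n [E [x [hE he]]]] := cc_partition cf cK (divr_gt0 e0 d0).
have h1 := Int_partition (cc_integrable ccf) cK fK (ltW (divr_gt0 e0 d0)) hE he.
have Efin := mp_fin cK hE.
set e' := e / _ in he h1.
have e'0 : 0 <= e' by rewrite ltW// divr_gt0.
have h2 : `|Int (f \o phi) - \sum_(i < n) vol (phi @^-1` E i) * f (x i)| <=
    e' * vol (phi @^-1` K).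
  apply: Int_close; [exact: cc_integrable|exact: mphi|exact: (fphi K mK (mu_fin cK)).1| |].
    by move=> i; have [mE fE] := Efin i; split; [exact: mphi|exact: (fphi _ mE fE).1].
  move=> y; apply: (mp_sum_dist (nu := Num.norm) e'0 (normr0 _) hE (F := f)
     (s := fun z => \sum_(i < n) \1_(E i) z * f (x i))) => //.
  - move=> z nKz; apply/eqP; apply: contrapT => /negP /fK; exact: nKz.
  - move=> i z Ez; exact: (@simple_sum_in G R R^o n E _ i z (mp_triv hE) Ez).
  - move=> z nKz; apply: (@simple_sum_out G R R^o n E) => i Ez.
    by apply: nKz; exact: mp_sub hE _ _ Ez.
have h3 : \sum_(i < n) vol (phi @^-1` E i) * f (x i) =
    c * \sum_(i < n) vol (E i) * f (x i).
  rewrite mulr_sumr; apply: eq_bigr => i _; have [mE fE] := Efin i.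
  by rewrite (fphi _ mE fE).2 mulrA.
rewrite h3 (fphi K mK (mu_fin cK)).2 in h2.
have h4 : c * `|Int f - \sum_(i < n) vol (E i) * f (x i)| <= c * (e' * vol K).
  by rewrite ler_wpM2l.
rewrite -{1}(ger0_norm c0) -normrM mulrBr in h4.
apply: (@le_trans _ _ (2 * (e' * (c * vol K)))).
  have := ler_distD (c * \sum_(i < n) vol (E i) * f (x i)) (Int (f \o phi)) (c * Int f).
  rewrite (distrC (c * \sum_(i < n) _)); lra.
rewrite mulrCA /e' mulrAC ler_pdivrMr// ler_wpM2l ?(ltW e0)//.
lra.
Qed.

End Integral.

Lemma eq_of_dist_le (R : realType) (a b C : R) :
  0 <= C -> (forall e, 0 < e -> `|a - b| <= e * C) -> a = b.
Proof.
move=> C0 h; apply/eqP; rewrite -subr_eq0 -normr_le0; apply/ler_addgt0Pl => e e0.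
rewrite addr0; have C1 : 0 < C + 1 by rewrite ltr_wpDl.
apply: le_trans (h _ (divr_gt0 e0 C1)) _.
by rewrite mulrAC ler_pdivrMr// ler_wpM2l ?(ltW e0)// lerDl.
Qed.

(** * Integrals depending on a parameter *)

Section ParameterIntegral.
Variables (R : realType) (G : topGroupType) (hG : hausdorff_space G).
Variable mu : {measure set (borel G) -> \bar R}.
Hypothesis mu_fin : forall K : set G, compact K -> (mu K < +oo)%E.

Lemma Int_dist_le (f g : G -> R) (L : set G) (e : R) :
  cc_fun f -> cc_fun g -> compact L ->
  (forall y, `|f y - g y| <= e * \1_L y) ->
  `|Int mu f - Int mu g| <= e * vol mu L.
Proof.
move=> cf cg cL h; have fi := cc_integrable hG mu_fin cf.
have gi := cc_integrable hG mu_fin cg.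
have fgi : mu.-integrable setT (EFin \o (fun x : borel G => f x - g x)).
  by have := integrableB measurableT fi gi.
rewrite -RintegralB//.
have mL := borel_compact hG cL.
have E0 (i : 'I_0) : measurable (set0 : set (borel G)) /\ (mu set0 < +oo)%E.
  by case: i.
(* The difference is compared with the empty simple function, that is, with 0. *)
have := @Int_close R G mu _ L 0 (fun=> set0) (fun=> 0) e fgi mL (mu_fin cL) E0.
rewrite big_ord0 subr0; apply => y.
by rewrite big_ord0 subr0.
Qed.

Lemma cc_funD (X : topologicalType) (f g : X -> R) :
  cc_fun f -> cc_fun g -> cc_fun (fun x => f x + g x).
Proof.
move=> [cf [K cK fK]] [cg [L cL gL]]; split.
  by move=> x; apply: cvgD; [exact: cf|exact: cg].
exists (K `|` L); first exact: compactU.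
move=> x; have [fx|/fK] := eqVneq (f x) 0; last by left.
by rewrite fx add0r => /gL; right.
Qed.

Lemma cc_funM (X : topologicalType) (f g : X -> R) :
  cc_fun f -> continuous g -> cc_fun (fun x => g x * f x).
Proof.
move=> [cf [K cK fK]] cg; split.
  by move=> x; apply: cvgM; [exact: cg|exact: cf].
by exists K => // x h; apply: fK; apply: contraNneq h => ->; rewrite mulr0.
Qed.

Lemma cc_funZ (X : topologicalType) (f : X -> R) (c : R) :
  cc_fun f -> cc_fun (fun x => c * f x).
Proof. by move=> ccf; apply: cc_funM => // x; exact: cvg_cst. Qed.

Lemma cc_fun0 (X : topologicalType) : cc_fun (fun _ : X => 0 : R).
Proof.
split; first by move=> x; exact: cvg_cst.
by exists set0; [exact: compact0|move=> x; rewrite eqxx].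
Qed.

Lemma IntZ (f : G -> R) c : cc_fun f -> Int mu (fun x => c * f x) = c * Int mu f.
Proof. by move=> cf; rewrite RintegralZl//; exact: cc_integrable. Qed.

Lemma Int_lincomb n (a : 'I_n -> R) (f : 'I_n -> G -> R) :
  (forall i, cc_fun (f i)) ->
  cc_fun (fun x => \sum_(i < n) a i * f i x) /\
  Int mu (fun x => \sum_(i < n) a i * f i x) = \sum_(i < n) a i * Int mu (f i).
Proof.
elim: n a f => [|n IH] a f hf.
  have -> : (fun x => \sum_(i < 0) a i * f i x) = fun=> 0.
    by apply/funext => x; rewrite big_ord0.
  split; first exact: cc_fun0.
  by rewrite big_ord0 Rintegral_cst// mul0r.
pose w := widen_ord (leqnSn n).
have [i1 i2] := IH (fun i => a (w i)) (fun i => f (w i)) (fun i => hf (w i)).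
have e : (fun x => \sum_(i < n.+1) a i * f i x) =
  (fun x => \sum_(i < n) a (w i) * f (w i) x + a ord_max * f ord_max x).
  by apply/funext => x; rewrite big_ord_recr.
have j1 := cc_funZ (a ord_max) (hf ord_max).
rewrite e; split; first exact: cc_funD.
rewrite RintegralD//; [|exact: cc_integrable|exact: cc_integrable].
by rewrite big_ord_recr/= i2 IntZ.
Qed.

Lemma cc_fun_slice (X : topologicalType) (F : X * G -> R) (x : X) (L : set G) :
  continuous F -> compact L -> (forall y, F (x, y) != 0 -> L y) ->
  cc_fun (fun y => F (x, y)).
Proof.
move=> cF cL FL; split; last by exists L.
move=> y; apply: (@cvg_comp _ _ _ (fun y => (x, y)) F _ (nbhs (x, y))).
  by apply: cvg_pair; [exact: cvg_cst|exact: cvg_id].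
exact: cF.
Qed.

(** The tube lemma over the compact set [L]; off [L] both slices vanish. *)
Lemma Int_param_close (X : topologicalType) (F : X * G -> R) (x0 : X) (L : set G)
    (e : R) :
  continuous F -> compact L -> 0 < e ->
  (\forall x \near x0, forall y, F (x, y) != 0 -> L y) ->
  \forall x \near x0, forall y, `|F (x, y) - F (x0, y)| <= e * \1_L y.
Proof.
move=> cF cL e0 FL.
have cd : continuous (fun p => `|F p - F (x0, p.2)|).
  move=> p; apply: cvg_norm; apply: cvgB; first exact: cF.
  apply: (@cvg_comp _ _ _ (fun p : X * G => (x0, p.2)) F _ (nbhs (x0, p.2))).
    by apply: cvg_pair; [exact: cvg_cst|exact: cvg_snd].
  exact: cF.
have h : \forall x \near x0, forall y, L y -> `|F (x, y) - F (x0, y)| < e.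
  by apply: tube_lt cd cL _ => y _; rewrite subrr normr0.
have FL0 := nbhs_singleton FL.
apply: filterS2 FL h => x Fx hx y.
have [Ly|nLy] := pselect (L y).
  by rewrite indicE mem_set// mulr1 ltW// hx.
rewrite indicE memNset// mulr0 normr_le0 subr_eq0.
have [->|/Fx//] := eqVneq (F (x, y)) 0.
by rewrite eq_sym; apply: contrapT => /negP /FL0.
Qed.

Lemma Int_param_cvg (X : topologicalType) (F : X * G -> R) (x0 : X) (L : set G) :
  continuous F -> compact L ->
  (\forall x \near x0, forall y, F (x, y) != 0 -> L y) ->
  (Int mu (fun y => F (x, y))) @[x --> x0] --> Int mu (fun y => F (x0, y)).
Proof.
move=> cF cL FL; apply/cvgrPdist_le => e e0.
have d0 : 0 < vol mu L + 1 by rewrite ltr_wpDl// vol_ge0.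
have FL0 := nbhs_singleton FL.
apply: filterS2 FL (Int_param_close cF cL (divr_gt0 e0 d0) FL) => x Fx hx.
rewrite distrC; apply: le_trans (Int_dist_le _ _ cL hx) _.
- exact: cc_fun_slice cF cL Fx.
- exact: cc_fun_slice cF cL FL0.
by rewrite mulrAC ler_pdivrMr// ler_wpM2l ?(ltW e0)// lerDl.
Qed.

Lemma cc_fun_param (X : topologicalType) (F : X * G -> R) (K : set X) (L : set G) :
  continuous F -> compact K -> compact L ->
  (forall x y, F (x, y) != 0 -> K x /\ L y) ->
  cc_fun (fun x => Int mu (fun y => F (x, y))).
Proof.
move=> cF cK cL FKL; split.
  move=> x; apply: Int_param_cvg cF cL _.
  by apply: filterE => x' y /FKL[].
exists K => // x; apply: contraNP => nK; apply/eqP.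
rewrite (_ : (fun y => _) = cst 0) ?Rintegral_cst ?mul0r//.
by apply/funext => y; apply/eqP; apply: contrapT => /negP /FKL[].
Qed.

End ParameterIntegral.

Lemma continuous_swap (X Y Z : topologicalType) (F : X * Y -> Z) :
  continuous F -> continuous (fun p : Y * X => F (p.2, p.1)).
Proof.
move=> cF p; apply: (@cvg_comp _ _ _ (fun p : Y * X => (p.2, p.1)) F _ (nbhs (p.2, p.1))).
  by apply: cvg_pair; [exact: cvg_snd|exact: cvg_fst].
exact: cF.
Qed.

(** * Exchange of the order of integration *)

Section Fubini.
Variables (R : realType) (G1 G2 : topGroupType).
Hypotheses (hG1 : hausdorff_space G1) (hG2 : hausdorff_space G2).
Variable mu1 : {measure set (borel G1) -> \bar R}.
Variable mu2 : {measure set (borel G2) -> \bar R}.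
Hypothesis mu1_fin : forall K : set G1, compact K -> (mu1 K < +oo)%E.
Hypothesis mu2_fin : forall K : set G2, compact K -> (mu2 K < +oo)%E.

(** Partition [K] so that the slices [F (x, _)] move by at most [e] on each piece, uniformly in the
    second variable. Both iterated integrals are then within [e] times the two volumes of one and
    the same sum over the tags. *)
Lemma Int_fubini (F : G1 * G2 -> R) (K : set G1) (L : set G2) :
  continuous F -> compact K -> compact L ->
  (forall x y, F (x, y) != 0 -> K x /\ L y) ->
  Int mu1 (fun x => Int mu2 (fun y => F (x, y))) =
  Int mu2 (fun y => Int mu1 (fun x => F (x, y))).
Proof.
move=> cF cK cL FKL.
have cPhi := cc_fun_param hG2 mu2_fin cF cK cL FKL.
have cF' := continuous_swap cF.
have FKL' y x : F (x, y) != 0 -> L y /\ K x by move=> /FKL[].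
have cPsi := cc_fun_param hG1 mu1_fin cF' cL cK FKL'.
rewrite /= in cPsi.
have FL x : forall y, F (x, y) != 0 -> L y by move=> y /FKL[].
have sl x : cc_fun (fun y => F (x, y)) by exact: cc_fun_slice cF cL (FL x).
have sl' y : cc_fun (fun x => F (x, y)).
  apply: (cc_fun_slice (F := fun p => F (p.2, p.1)) cF' cK) => x /FKL[] //.
have C0 : 0 <= 2 * (vol mu1 K * vol mu2 L).
  by rewrite mulr_ge0// mulr_ge0// vol_ge0.
apply: (eq_of_dist_le C0) => e e0.
have [n [E [x [hE he]]]] := @compact_partition G1 hG1 K
    (fun x0 x => forall y, `|F (x, y) - F (x0, y)| <= e * \1_L y) cK
    (fun x0 _ => Int_param_close cF cL e0 (filterE _ FL)).
have e00 := ltW e0.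
have h1 : `|Int mu1 (fun x => Int mu2 (fun y => F (x, y))) -
    \sum_(i < n) vol mu1 (E i) * Int mu2 (fun y => F (x i, y))| <=
    e * vol mu2 L * vol mu1 K.
  apply: (Int_partition hG1 mu1_fin (cc_integrable hG1 mu1_fin cPhi) cK _ _ hE).
  - move=> z; apply: contraNP => nK; apply/eqP.
    rewrite (_ : (fun y => _) = cst 0) ?Rintegral_cst ?mul0r//.
    by apply/funext => y; apply/eqP; apply: contrapT => /negP /FKL[].
  - by rewrite mulr_ge0// vol_ge0.
  - by move=> i z Ez; apply: Int_dist_le => //; exact: he.
have [s1 s2] := Int_lincomb hG2 mu2_fin (fun i => vol mu1 (E i)) (fun i => sl (x i)).
have h2 : `|Int mu2 (fun y => Int mu1 (fun x => F (x, y))) -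
    \sum_(i < n) vol mu1 (E i) * Int mu2 (fun y => F (x i, y))| <=
    e * vol mu1 K * vol mu2 L.
  rewrite -s2; apply: Int_dist_le => // y.
  have [Ly|nLy] := pselect (L y); last first.
    rewrite indicE memNset// mulr0 normr_le0 subr_eq0; apply/eqP.
    have F0 z : F (z, y) = 0.
      by apply/eqP; apply: contrapT => /negP /FKL[].
    rewrite (_ : (fun z => F (z, y)) = cst 0); last by apply/funext.
    rewrite Rintegral_cst// mul0r big1// => i _; first by rewrite F0 mulr0.
  rewrite indicE mem_set// mulr1.
  apply: (Int_partition hG1 mu1_fin (cc_integrable hG1 mu1_fin (sl' y)) cK _ _ hE) => //.
  - by move=> z /FKL[].
  - by move=> i z Ez; have := he i z Ez y; rewrite indicE mem_set// mulr1.
have := ler_distD (\sum_(i < n) vol mu1 (E i) * Int mu2 (fun y => F (x i, y)))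
  (Int mu1 (fun x => Int mu2 (fun y => F (x, y))))
  (Int mu2 (fun y => Int mu1 (fun x => F (x, y)))).
rewrite (distrC (\sum_(i < n) _)).
set a := `|_ - _|; set b := `|_ - _| in h1 *; set c := `|_ - _| in h2 *.
by move=> ?; lra.
Qed.

End Fubini.

Section TopGroupMaps.
Variable G : topGroupType.

Lemma mulg_cvg (T : Type) (F : set_system T) (FF : Filter F) (f g : T -> G) x y :
  f @ F --> x -> g @ F --> y -> (fun t => (f t * g t)%g) @ F --> (x * y)%g.
Proof.
move=> fx gy; apply: (@cvg_comp _ _ _ (fun t => (f t, g t))
  (fun p : G * G => (p.1 * p.2)%g) _ (nbhs (x, y))).
  exact: cvg_pair.
exact: (@mulg_continuous G (x, y)).
Qed.

Lemma mulg_continuousl (x : G) : continuous (fun y : G => (x * y)%g).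
Proof. by move=> y; apply: mulg_cvg; [exact: cvg_cst|exact: cvg_id]. Qed.

Lemma mulg_continuousr (x : G) : continuous (fun y : G => (y * x)%g).
Proof. by move=> y; apply: mulg_cvg; [exact: cvg_id|exact: cvg_cst]. Qed.

Lemma continuous_mulg (X : topologicalType) (f g : X -> G) :
  continuous f -> continuous g -> continuous (fun x => (f x * g x)%g).
Proof. by move=> cf cg x; apply: mulg_cvg; [exact: cf|exact: cg]. Qed.

Lemma continuous_invg (X : topologicalType) (f : X -> G) :
  continuous f -> continuous (fun x => ((f x)^-1)%g).
Proof.
move=> cf x; apply: (@cvg_comp _ _ _ f (fun y : G => (y^-1)%g) _ (nbhs (f x))).
  exact: cf.
exact: invg_continuous.
Qed.

Lemma compactM (K L : set G) : compact K -> compact L ->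
  compact [set (x * y)%g | x in K & y in L].
Proof.
move=> cK cL.
have -> : [set (x * y)%g | x in K & y in L] =
    (fun p : G * G => (p.1 * p.2)%g) @` (K `*` L).
  apply/seteqP; split => z.
    by move=> [x Kx [y Ly <-]]; exists (x, y).
  by move=> [[x y] [/= Kx Ly] <-]; exists x => //; exists y.
apply: continuous_compact; last exact: compact_setX.
by apply: continuous_subspaceT; exact: mulg_continuous.
Qed.

Lemma compactV (K : set G) : compact K -> compact [set (x^-1)%g | x in K].
Proof.
move=> cK; apply: continuous_compact => //.
by apply: continuous_subspaceT; exact: invg_continuous.
Qed.

Lemma cc_fun_comp (R : realType) (X Y : topologicalType) (f : Y -> R)
    (phi : X -> Y) (psi : Y -> X) :
  continuous phi -> continuous psi -> cancel phi psi ->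
  cc_fun f -> cc_fun (f \o phi).
Proof.
move=> cphi cpsi pK [cf [K cK fK]]; split.
  move=> x; apply: (@cvg_comp _ _ _ phi f _ (nbhs (phi x))); first exact: cphi.
  exact: cf.
exists (psi @` K).
  by apply: continuous_compact => //; exact: continuous_subspaceT.
by move=> x /fK Kx; exists (phi x).
Qed.

End TopGroupMaps.

(** * Haar measures and modular functions *)

Section Haar.
Variables (R : realType) (G : topGroupType) (lchG : lch G).
Variable mu : {measure set (borel G) -> \bar R}.
Hypothesis haarG : left_haar mu.

Let hG := lchG.1.
Let mu_fin := haar_compact haarG.

(** If a nonempty open set were null, finitely many of its translates would cover any compact set,
    so all compact sets would be null, and inner regularity of the whole group would give
    [mu = 0]. *)
Lemma haar_open_gt0 (U : set G) x : open U -> U x -> (0 < mu (U : set (borel G)))%E.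
Proof.
move=> oU Ux; rewrite lt0e measure_ge0 andbT; apply/eqP => U0.
have mU := borel_open oU.
have UT (y : G) : exists V : set (borel G), [/\ measurable V, nbhs y V & mu V = 0%E].
  (* The left translate of [U] that moves [x] to [y]. *)
  exists [set (y * x^-1 * z)%g | z in U].
  have -> : [set (y * x^-1 * z)%g | z in U] = (fun z => (x * y^-1 * z)%g) @^-1` U.
    apply/seteqP; split => z /=.
      move=> [u Uu <-].
      by rewrite !mulgA -(mulgA x) mulVg mulg1 mulgV mul1g.
    move=> Uz; exists (x * y^-1 * z)%g => //.
    by rewrite !mulgA -(mulgA y) mulVg mulg1 mulgV mul1g.
  have oV : open ((fun z => (x * y^-1 * z)%g) @^-1` U).
    by apply: open_comp => // z _; exact: mulg_continuousl.
  split; first exact: borel_open.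
    apply: open_nbhs_nbhs; split => //=.
    by rewrite -mulgA mulVg mulg1.
  rewrite -U0 -(haar_invariant haarG (y * x^-1)%g mU); congr (mu _).
  apply/seteqP; split => z /=.
    move=> Uz; exists (x * y^-1 * z)%g => //.
    by rewrite !mulgA -(mulgA y) mulVg mulg1 mulgV mul1g.
  move=> [u Uu <-].
  by rewrite !mulgA -(mulgA x) mulVg mulg1 mulgV mul1g.
have [V hV] := choice UT.
have K0 K : compact K -> mu (K : set (borel G)) = 0%E.
  move=> cK.
  have [|n [y [_ cov]]] := compact_finite_cover (U := fun y => V y) cK.
    by move=> y _; have [] := hV y.
  apply/eqP; rewrite eq_le measure_ge0 andbT.
  apply: (@le_trans _ _ (mu (\big[setU/set0]_(i < n) V (y i)))).
    apply: le_measure.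
    - by apply/mem_set; exact: borel_compact.
    - by apply/mem_set; apply: bigsetU_measurable => i _; have [] := hV (y i).
    - move=> z /cov[i Vi]; rewrite (bigD1 i)//=; by left.
  suff [] : measurable (\big[setU/set0]_(i < n) V (y i)) /\
      (mu (\big[setU/set0]_(i < n) V (y i)) <= 0)%E by [].
  elim/big_ind : _ => [|A B [mA hA] [mB hB]|i _].
  - by rewrite measure0.
  - split; first exact: measurableU.
    have h : (mu (A `|` B) <= mu A + mu B)%E by exact: measureU2.
    apply: (le_trans h).
    by rewrite -(adde0 0%E) leeD.
  - by have [mV _ ->] := hV (y i).
have := haar_neq0 haarG; rewrite (haar_inner haarG openT) => /eqP; apply.
apply/eqP; rewrite eq_le; apply/andP; split.
  by apply: ge_ereal_sup => _ [K [cK _] <-]; rewrite K0.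
by apply: ereal_sup_ubound; exists set0; [split; [exact: compact0|]|rewrite measure0].
Qed.

Lemma vol_gt0 (E : set (borel G)) : measurable E -> (mu E < +oo)%E ->
  (0 < mu E)%E -> 0 < vol mu E.
Proof. by move=> mE fE E0; rewrite fine_gt0// E0 fE. Qed.

Lemma Int_gt0 (f : G -> R) x : cc_fun f -> (forall y, 0 <= f y) -> 0 < f x ->
  0 < Int mu f.
Proof.
move=> ccf f0 fx; have [cf [K cK fK]] := ccf.
pose U : set G := f @^-1` [set t | f x / 2 < t].
have oU : open U.
  by apply: open_comp; [move=> y _; exact: cf|exact: open_gt].
have UK : U `<=` K.
  move=> y Uy; apply: fK; rewrite gt_eqF//; apply: lt_trans Uy.
  by rewrite divr_gt0.
have mU := borel_open oU.
have fU : (mu U < +oo)%E.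
  apply: le_lt_trans (mu_fin cK); apply: le_measure => //; apply/mem_set => //.
  exact: borel_compact.
have Ux : U x by rewrite /U/=; lra.
have [i1 i2] := Int_indic mU fU.
apply: (@lt_le_trans _ _ (f x / 2 * vol mu U)).
  by rewrite mulr_gt0 ?divr_gt0// vol_gt0// (haar_open_gt0 oU Ux).
rewrite -i2 -RintegralZl//; apply: le_Rintegral => //.
- have := @integrableZl _ _ R mu setT measurableT (f x / 2) _ i1.
  by [].
- exact: cc_integrable.
move=> y _; have [Uy|nUy] := pselect (U y).
  by rewrite mem_set// mulr1 ltW.
by rewrite memNset// mulr0.
Qed.

Lemma Int_translate (f : G -> R) x : cc_fun f ->
  Int mu (fun y => f (x * y)%g) = Int mu f.
Proof.
move=> ccf; rewrite -[RHS]mul1r; apply: (@Int_subst _ _ hG _ mu_fin f (fun y => (x * y)%g)) => //.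
- apply: (@cc_fun_comp _ _ _ f _ (fun y => (x^-1 * y)%g)) => //.
  + exact: mulg_continuousl.
  + exact: mulg_continuousl.
  + by move=> y; rewrite mulKg.
- exact: mulg_continuousl.
move=> E mE; rewrite mul1e -[RHS](haar_invariant haarG x^-1%g mE); congr (mu _).
apply/seteqP; split => y /=; first by move=> Ey; exists (x * y)%g; rewrite ?mulKg.
by move=> [z Ez <-]; rewrite mulVKg.
Qed.

Variable Delta : G -> R.
Hypothesis modG : modular_function mu Delta.

Lemma modular_gt0 t : 0 < Delta t.
Proof. exact: modG.1. Qed.

(** Computes the measure of [K s t] in one step and in two, for a compact neighbourhood [K] of 1,
    whose positive finite measure cancels. *)
Lemma modularM s t : Delta (s * t)%g = Delta s * Delta t.
Proof.
have [K [cK K1 _]] := lch_compact_nbhs R lchG (@filterT _ (nbhs (1%g : G)) _).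
have mK := borel_compact hG cK; have fK := mu_fin cK.
have K0 : 0 < vol mu K.
  apply: vol_gt0 => //.
  apply: lt_le_trans (haar_open_gt0 (open_interior K) K1) _.
  apply: le_measure; [|by apply/mem_set|exact: interior_subset].
  by apply/mem_set; apply: borel_open; exact: open_interior.
have mKs : measurable ([set (y * s)%g | y in K] : set (borel G)).
  apply: borel_compact => //; apply: continuous_compact => //.
  by apply: continuous_subspaceT; exact: mulg_continuousr.
have e1 := modG.2 (s * t)%g K mK.
have e2 := modG.2 t _ mKs.
rewrite (modG.2 s K mK) in e2.
have e3 : [set (y * (s * t))%g | y in K] = [set (y * t)%g | y in [set (y * s)%g | y in K]].
  apply/seteqP; split => z.
    by move=> [y Ky <-]; exists (y * s)%g; [exists y|rewrite mulgA].
  by move=> [_ [y Ky <-] <-]; exists y => //; rewrite mulgA.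
rewrite /= e3 in e1.
have : ((Delta (s * t)%g)%:E * mu K = (Delta t)%:E * ((Delta s)%:E * mu K))%E.
  by rewrite -e1 -e2.
rewrite -(finite_measure_finE fK) -!EFinM => -[].
rewrite mulrA => /(mulIf (lt0r_neq0 K0)) ->.
by rewrite mulrC.
Qed.

Lemma modular1 : Delta 1%g = 1.
Proof.
have := modularM 1 1; rewrite mulg1 => h.
by apply: (mulfI (lt0r_neq0 (modular_gt0 1%g))); rewrite -h mulr1.
Qed.

Lemma modularV t : Delta (t^-1)%g = (Delta t)^-1.
Proof.
apply: (mulIf (lt0r_neq0 (modular_gt0 t))).
by rewrite -modularM mulVg modular1 mulVf// lt0r_neq0// modular_gt0.
Qed.

Lemma Int_rtranslate (f : G -> R) x : cc_fun f ->
  Int mu (fun y => f (y * x)%g) = (Delta x)^-1 * Int mu f.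
Proof.
move=> ccf; apply: (@Int_subst _ _ hG _ mu_fin f (fun y => (y * x)%g)) => //.
- by rewrite invr_ge0 ltW// modular_gt0.
- apply: (@cc_fun_comp _ _ _ f _ (fun y => (y * x^-1)%g)) => //.
  + exact: mulg_continuousr.
  + exact: mulg_continuousr.
  + by move=> y; rewrite mulgK.
- exact: mulg_continuousr.
(* The preimage of [E] is [E x^-1], whence the inverse of [Delta x]. *)
move=> E mE; rewrite -modularV -(modG.2 _ _ mE); congr (mu _).
apply/seteqP; split => y /=; first by move=> Ey; exists (y * x)%g; rewrite ?mulgK.
by move=> [z Ez <-]; rewrite mulgVK.
Qed.

(** [Delta t] is the quotient of the integral of a bump by that of its right translate by [t]. The
    latter is a parameter integral: for parameters in a compact neighbourhood [N], the supports stay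
    in the compact set [K N^-1]. *)
Lemma modular_continuous : continuous Delta.
Proof.
have [f [cf f0 f1 [K [cK _ _ fK]]]] := lch_bump R lchG (@filterT _ (nbhs (1%g : G)) _).
have ccf : cc_fun f by split => //; exists K.
have If0 : 0 < Int mu f by apply: (Int_gt0 ccf f0 (x := 1%g)); rewrite f1.
have cV : continuous (fun t => Int mu (fun y => f (y * t)%g)).
  move=> t.
  have [N [cN Nt _]] := lch_compact_nbhs R lchG (@filterT _ (nbhs t) _).
  apply: (@Int_param_cvg R G hG mu mu_fin G (fun p => f (p.2 * p.1)%g) t
    [set (x * y)%g | x in K & y in [set (z^-1)%g | z in N]]).
  - move=> p; apply: (@cvg_comp _ _ _ (fun p : G * G => (p.2 * p.1)%g) f _
      (nbhs (p.2 * p.1)%g)); last exact: cf.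
    by apply: mulg_cvg; [exact: cvg_snd|exact: cvg_fst].
  - by apply: compactM => //; exact: compactV.
  - apply: filterS Nt => x Nx y /fK Kyx /=.
    exists (y * x)%g => //; exists (x^-1)%g; first by exists x.
    by rewrite mulgK.
have -> : Delta = (fun t => Int mu f / Int mu (fun y => f (y * t)%g)).
  apply/funext => t; rewrite Int_rtranslate// invfM invrK mulrCA mulfV ?mulr1//.
  by rewrite gt_eqF.
move=> t; apply: cvgM; first exact: cvg_cst.
apply: cvgV; last exact: cV.
by rewrite Int_rtranslate// gt_eqF// mulr_gt0// invr_gt0 modular_gt0.
Qed.

Lemma modular_inv_continuous : continuous (fun t => (Delta t)^-1).
Proof.
move=> t; apply: cvgV; first by rewrite gt_eqF// modular_gt0.
exact: modular_continuous.
Qed.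

End Haar.

Lemma rnorm_continuous (R : realType) (V : normedModType R[i]) (X : topologicalType)
    (f : X -> V) : continuous f -> continuous (fun x => rnorm (f x)).
Proof.
move=> cf x; apply/cvgrPdist_lt => e e0.
have := cf x => /cvg_rnormP /(_ e e0); apply: filterS => y hy.
apply: le_lt_trans hy; rewrite ler_norml; apply/andP; split.
  by have := ler_rnormD (f x) (f y - f x); rewrite addrC subrK (rdistC (f x)); lra.
by have := ler_rnormD (f y) (f x - f y); rewrite addrC subrK; lra.
Qed.

Lemma rnorm_complete (R : realType) (V : completeNormedModType R[i]) (v : nat -> V) :
  (forall e : R, 0 < e -> exists N, forall m k, (N <= m)%N -> (N <= k)%N ->
     rnorm (v m - v k) < e) ->
  exists l, forall e : R, 0 < e -> exists N, forall m, (N <= m)%N ->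
     rnorm (l - v m) < e.
Proof.
move=> hv; have : cauchy (v @ \oo).
  apply: cauchy_exP => -[a b] /=; rewrite ltcE /= => /andP[/eqP -> a0].
  have [N hN] := hv a a0; exists (v N).
  exists N => // k /= Nk; rewrite -ball_normE /= rnormE ltcR.
  exact: hN.
move=> /cauchy_cvg /cvg_ex[l vl]; exists l => e e0.
have /cvg_rnormP/(_ e e0)[N _ hN] := vl.
by exists N => m Nm; exact: hN.
Qed.

(** * Bochner integrals of compactly supported continuous maps *)

Section Bochner.
Variables (R : realType) (G : topGroupType) (hG : hausdorff_space G).
Variable mu : {measure set (borel G) -> \bar R}.
Hypothesis mu_fin : forall K : set G, compact K -> (mu K < +oo)%E.
Variable V : completeNormedModType R[i].

(** On the common refinement, a point of a nonempty piece shows that the two tag values differ by at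
    most [e + e'], and empty pieces have no volume. *)
Lemma mp_sum_cauchy (F : G -> V) K n m (E : 'I_n -> set (borel G)) x
    (E' : 'I_m -> set (borel G)) x' (e e' : R) :
  compact K -> mpartition K E x -> mpartition K E' x' ->
  (forall i y, E i y -> rnorm (F y - F (x i)) <= e) ->
  (forall i y, E' i y -> rnorm (F y - F (x' i)) <= e') ->
  rnorm (\sum_i (vol mu (E i))%:C%C *: F (x i) -
         \sum_j (vol mu (E' j))%:C%C *: F (x' j)) <= (e + e') * vol mu K.
Proof.
move=> cK hE hE' he he'.
have volE i : vol mu (E i) = \sum_j vol mu (E i `&` E' j).
  by apply: (mp_vol_sum hG mu_fin cK hE'); [exact: mp_meas hE i|exact: mp_sub hE i].
have volE' j : vol mu (E' j) = \sum_i vol mu (E i `&` E' j).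
  rewrite (mp_vol_sum hG mu_fin cK hE (mp_meas hE' j) (@mp_sub _ _ _ _ _ hE' j)).
  by apply: eq_bigr => i _; rewrite setIC.
have -> : \sum_i (vol mu (E i))%:C%C *: F (x i) =
    \sum_i \sum_j (vol mu (E i `&` E' j))%:C%C *: F (x i).
  by apply: eq_bigr => i _; rewrite volE rmorph_sum scaler_suml.
have -> : \sum_j (vol mu (E' j))%:C%C *: F (x' j) =
    \sum_i \sum_j (vol mu (E i `&` E' j))%:C%C *: F (x' j).
  rewrite exchange_big/=; apply: eq_bigr => j _.
  by rewrite volE' rmorph_sum scaler_suml.
rewrite -sumrB.
have -> : vol mu K = \sum_i \sum_j vol mu (E i `&` E' j).
  rewrite (mp_vol_sum hG mu_fin cK hE (borel_compact hG cK) (@subset_refl _ _)).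
  by apply: eq_bigr => i _; rewrite setIidr ?volE//; exact: mp_sub hE i.
apply: le_trans (ler_rnorm_sum _ _ _) _; rewrite mulr_sumr.
apply: ler_sum => i _; rewrite -sumrB; apply: le_trans (ler_rnorm_sum _ _ _) _.
rewrite mulr_sumr; apply: ler_sum => j _; rewrite -scalerBr rnormZr.
rewrite (ger0_norm (vol_ge0 _ _)).
have [[y [Ey E'y]]|h] := pselect (E i `&` E' j !=set0).
  rewrite mulrC ler_wpM2r ?vol_ge0//.
  apply: le_trans (ler_rdistD (F y) _ _) _.
  by rewrite rdistC; apply: lerD; [exact: he|exact: he'].
have -> : E i `&` E' j = set0.
  by apply: contrapT => /eqP/set0P.
by rewrite measure0 mul0r mulr0.
Qed.

Lemma vector_partition (F : G -> V) K (e : R) : continuous F -> compact K -> 0 < e ->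
  exists n (E : 'I_n -> set (borel G)) (x : 'I_n -> G),
    mpartition K E x /\ forall i y, E i y -> rnorm (F y - F (x i)) <= e.
Proof.
move=> cF cK e0.
apply: (@compact_partition G hG K (fun x y => rnorm (F y - F x) <= e)) => // x _.
have := cF x => /cvg_rnormP /(_ e e0).
by apply: filterS => y; rewrite rdistC => /ltW.
Qed.

(** Tagged sums for partitions on which [F] oscillates by at most [1 / (m + 1)] are Cauchy. Their
    limit is an integral, approximated by the simple functions with these tag values. *)
Lemma bochner_exists (F : G -> V) K : continuous F -> compact K ->
  (forall y, ~ K y -> F y = 0) -> exists v, is_bochner mu F v.
Proof.
move=> cF cK FK; have mK := borel_compact hG cK.
have part (m : nat) : {p : {n : nat & ('I_n -> set (borel G)) * ('I_n -> G)}%type |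
    mpartition K (projT2 p).1 (projT2 p).2 /\
    forall i y, (projT2 p).1 i y -> rnorm (F y - F ((projT2 p).2 i)) <= m.+1%:R^-1}.
  apply: cid; have m0 : 0 < m.+1%:R^-1 :> R by rewrite invr_gt0.
  have [n [E [x hE]]] := vector_partition cF cK m0.
  by exists (existT _ n (E, x)).
pose n m := projT1 (sval (part m)).
pose E m : 'I_(n m) -> set (borel G) := (projT2 (sval (part m))).1.
pose x m : 'I_(n m) -> G := (projT2 (sval (part m))).2.
have hE m : mpartition K (E m) (x m) by have [] := svalP (part m).
have hx m i y : E m i y -> rnorm (F y - F (x m i)) <= m.+1%:R^-1.
  by have [_] := svalP (part m); apply.
pose v m := \sum_i (vol mu (E m i))%:C%C *: F (x m i).
have small (e : R) : 0 < e -> exists N, forall m, (N <= m)%N ->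
    m.+1%:R^-1 * vol mu K < e.
  move=> e0; have d0 : 0 < vol mu K + 1 by rewrite ltr_wpDl// vol_ge0.
  exists (Num.truncn ((vol mu K + 1) / e)) => m Nm.
  have h : (vol mu K + 1) / e < m.+1%:R.
    by apply: lt_le_trans (truncnS_gt _) _; rewrite ler_nat.
  rewrite mulrC ltr_pdivrMr// -ltr_pdivrMl// mulrC.
  by apply: le_lt_trans h; rewrite ler_pM2r ?invr_gt0// lerDl.
have [|l hl] := @rnorm_complete R V v.
  move=> e e0; have [N hN] := small (e / 2) (divr_gt0 e0 (ltr0n R 2)).
  exists N => m k Nm Nk.
  apply: le_lt_trans (mp_sum_cauchy cK (hE m) (hE k) (@hx m) (@hx k)) _.
  by rewrite mulrDl (splitr e) ltrD// hN.
exists l => e e0.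
have [N1 hN1] := small e e0; have [N2 hN2] := hl e e0.
pose m := maxn N1 N2.
exists (n m), (E m), (fun i => F (x m i)).
(* The pieces being disjoint, the distance to the simple function is a finite sum of indicators
   times continuous functions; this form makes it measurable. *)
have distE y : rnorm (F y - \sum_(i < n m) \1_(E m i) y *: F (x m i)) =
    \sum_(i < n m) \1_(E m i) y * rnorm (F y - F (x m i)).
  have [Ky|nKy] := pselect (K y).
    have [i Ey] := mp_cover (hE m) Ky.
    rewrite (simple_sum_in (fun i => F (x m i)) (mp_triv (hE m)) Ey).
    have := @simple_sum_in G R R^o _ _ (fun i => rnorm (F y - F (x m i))) _ _
      (mp_triv (hE m)) Ey.
    exact: esym.
  have nE i : ~ E m i y by move=> Ey; apply: nKy; exact: mp_sub (hE m) _ _ Ey.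
  rewrite simple_sum_out// FK// subr0 rnorm0.
  apply: esym.
  exact: (@simple_sum_out G R R^o _ _ (fun i => rnorm (0 - F (x m i))) _ nE).
have distK y : rnorm (F y - \sum_(i < n m) \1_(E m i) y *: F (x m i)) <=
    m.+1%:R^-1 * \1_K y.
  apply: (mp_sum_dist (nu := @rnorm R V) (F := F)
    (s := fun y => \sum_(i < n m) \1_(E m i) y *: F (x m i)) _ _ (hE m) FK).
  - by rewrite invr_ge0.
  - exact: rnorm0.
  - by move=> i z Ez; rewrite (simple_sum_in (fun i => F (x m i)) (mp_triv (hE m)) Ez).
  - move=> z nKz; rewrite simple_sum_out// => i Ez.
    by apply: nKz; exact: mp_sub (hE m) _ _ Ez.
  - exact: hx.
have mdist : measurable_fun setT (fun y : borel G =>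
    rnorm (F y - \sum_(i < n m) \1_(E m i) y *: F (x m i))).
  rewrite (funext distE); apply: measurable_sum => i.
  apply: measurable_funM; first exact: measurable_indic (mp_meas (hE m) i).
  apply: borel_continuous; apply: rnorm_continuous => y.
  by apply: cvgB; [exact: cF|exact: cvg_cst].
split => //.
- exact: (mp_fin hG mu_fin cK (hE m)).
- have [k1 _] := Int_indic mK (mu_fin cK).
  apply: (@le_lt_trans _ _ (\int[mu]_y ((m.+1%:R^-1)%:E * (\1_K y)%:E))%E).
    apply: ge0_le_integral => //.
    + by move=> y _; rewrite lee_fin rnorm_ge0.
    + exact/measurable_EFinP.
    + by apply: measurable_funeM; apply/measurable_EFinP; exact: measurable_indic.
    + by move=> y _; rewrite -EFinM lee_fin.
  rewrite integralZl//= integral_indic// setIT -finite_measure_finE; last exact: mu_fin.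
  by rewrite -EFinM lte_fin hN1// leq_maxl.
- by apply: hN2; exact: leq_maxr.
Qed.

(** [L] passes through the approximating simple functions, and both errors are controlled by its
    bound. Whichever value [bochner] selects, its images under such functionals are thus
    determined. *)
Lemma bochner_functional (F : G -> V) v (L : V -> R) (C : R) :
  (forall x y, L (x + y) = L x + L y) ->
  (forall (t : R) x, L (t%:C%C *: x) = t * L x) ->
  (forall x, `|L x| <= C * rnorm x) ->
  cc_fun (fun y => L (F y)) ->
  is_bochner mu F v -> L v = Int mu (fun y => L (F y)).
Proof.
move=> LD LZ LC ccL hv.
have L0 : L 0 = 0 by have := LZ 0 0; rewrite mul0r scaler0.
have LB x y : L (x - y) = L x - L y.
  rewrite LD; congr (_ + _); have := LZ (-1) y.
  by rewrite rmorphN rmorph1 scaleN1r mulN1r.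
have LS n (f : 'I_n -> V) : L (\sum_i f i) = \sum_i L (f i).
  exact: (big_morph L LD L0).
have C0 : 0 <= 2 * `|C| by rewrite mulr_ge0.
have LC' x : `|L x| <= `|C| * rnorm x.
  by apply: le_trans (LC x) _; rewrite ler_wpM2r ?rnorm_ge0// ler_norm.
apply: (eq_of_dist_le C0) => e e0.
have [n [E [c /= [hE md hd hc]]]] := hv e e0.
have h1 : `|L v - \sum_(i < n) vol mu (E i) * L (c i)| <= `|C| * e.
  have -> : \sum_(i < n) vol mu (E i) * L (c i) =
      L (\sum_(i < n) (vol mu (E i))%:C%C *: c i).
    by rewrite LS; apply: eq_bigr => i _; rewrite LZ.
  rewrite -LB; apply: le_trans (LC' _) _; rewrite ler_wpM2l// ltW//.
have [s1 s2] := Int_simple (fun i => L (c i)) hE.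
have Li := cc_integrable hG mu_fin ccL.
pose d (t : borel G) := rnorm (F t - \sum_(i < n) \1_(E i) t *: c i).
have di : mu.-integrable setT (EFin \o d).
  apply/integrableP; split; first exact/measurable_EFinP.
  under eq_integral do rewrite /= ger0_norm ?rnorm_ge0//.
  exact: lt_trans hd (ltry _).
have h2 : `|Int mu (fun y => L (F y)) - \sum_(i < n) vol mu (E i) * L (c i)| <= `|C| * e.
  rewrite -s2 -RintegralB//.
  have Bi := integrableB measurableT Li s1.
  apply: le_trans (le_normr_Rintegral _ _) _ => //.
  apply: (@le_trans _ _ (Int mu (fun t => `|C| * d t))).
    apply: le_Rintegral => //.
    - by have := integrable_abse Bi.
    - by have := @integrableZl _ _ R mu setT measurableT `|C| _ di.
    move=> y _; rewrite -/(d y); apply: le_trans (LC' _).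
    rewrite LB LS le_eqVlt; apply/orP; left; apply/eqP; congr (`|_ - _|).
    apply: eq_bigr => i _; rewrite -LZ; congr (L (_ *: _)).
    by rewrite !indicE; case: (_ \in _).
  rewrite RintegralZl// ler_wpM2l// -lee_fin /Rintegral fineK ?ltW//.
  by apply: integrable_fin_num.
have := ler_distD (\sum_(i < n) vol mu (E i) * L (c i)) (L v) (Int mu (fun y => L (F y))).
by rewrite (distrC (\sum_(i < n) _)); lra.
Qed.

Lemma bochner_of_exists (F : G -> V) v : is_bochner mu F v -> is_bochner mu F (bochner mu F).
Proof. by move=> hv; rewrite /bochner; case: xgetP => // /(_ v). Qed.

End Bochner.

Lemma nbhsI (T : topologicalType) (x : T) (A A' : set T) :
  nbhs x A -> nbhs x A' -> nbhs x (A `&` A').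
Proof. exact: filterI. Qed.

(** * Continuous sections of Banach bundles *)

Section BundleTopology.
Variables (R : realType) (X : topologicalType) (B : bundle R X).
Hypothesis bbB : banach_bundle B.
Local Notation projB := (@proj R X B).
Implicit Types (u v w : totalSpace B) (g : forall x, B x).

Lemma addT_near u v (Z : set (totalSpace B)) :
  proj u = proj v -> nbhs (addT u v) Z ->
  exists W W', [/\ nbhs u W, nbhs v W' & forall w w', W w -> W' w' ->
    proj w = proj w' -> Z (addT w w')].
Proof.
move=> uv hZ; have := (iffLR (subspace_continuousP _ _) (bb_add_continuous bbB)) (u, v) uv _ hZ.
move=> [[W W'] /= [uW vW'] h]; exists W, W'; split => // w w' Ww Ww' ww'.
exact: (h (w, w')).
Qed.

Lemma proj_near u (W : set (totalSpace B)) :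
  nbhs u W -> nbhs (proj u) (projB @` W).
Proof.
rewrite !nbhsE => -[U [oU Uu] UW]; exists (projB @` U).
  by split; [exact: bb_proj_open|exists u].
by move=> _ [w Uw <-]; exists w => //; exact: UW.
Qed.

Lemma proj_pull u (A : set X) : nbhs (proj u) A -> nbhs u (projB @^-1` A).
Proof. exact: (bb_proj_continuous bbB). Qed.

Definition distT u v : R := rnorm (value u - fib (proj u) v).

Lemma distT_in_total (x : X) (a b : B x) :
  distT (in_total a) (in_total b) = rnorm (a - b).
Proof. by rewrite /distT fibK. Qed.

Lemma addT_in_total (x : X) (a b : B x) :
  addT (in_total a) (in_total b) = in_total (a + b).
Proof. by rewrite /addT /= fibK. Qed.

Lemma distT_near u v (e : R) : proj u = proj v -> distT u v < e ->
  exists W W', [/\ nbhs u W, nbhs v W' & forall w w', W w -> W' w' ->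
    proj w = proj w' -> distT w w' < e].
Proof.
have dE w w' : proj w = proj w' ->
    distT w w' = rnorm (value (addT w (scaleT (-1) w'))).
  move: w w' => [x a] [y b] /= xy; subst y; rewrite -!/(in_total _) distT_in_total.
  have -> : scaleT (-1) (in_total b) = in_total (- b) by rewrite /scaleT scaleN1r.
  by rewrite fibK.
move=> uv; rewrite dE// => h.
have hZ : nbhs (addT u (scaleT (-1) v)) [set w | rnorm (value w) < e].
  exact: (bb_norm_continuous bbB (lt_nbhsl h)).
have [W [W' [uW vW' hW]]] := @addT_near u (scaleT (-1) v) _ uv hZ.
exists W, (scaleT (-1) @^-1` W'); split => //.
  exact: (bb_scale_continuous bbB vW').
by move=> w w' Ww Ww' ww'; rewrite dE//; exact: hW.
Qed.

(** Thin neighbourhoods replace a metric on the total space: they control distances inside each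
    fibre and never compare two fibres. *)
Lemma thin_near u (e : R) : 0 < e -> exists W, nbhs u W /\
  forall w w', W w -> W w' -> proj w = proj w' -> distT w w' < e.
Proof.
move=> e0; have [|W [W' [uW uW' h]]] := @distT_near u u e erefl.
  by rewrite -(in_total_value u) distT_in_total subrr rnorm0.
exists (W `&` W'); split; first exact: filterI.
by move=> w w' [Ww _] [_ W'w']; exact: h.
Qed.

(* [g] is not assumed continuous, and [u] need not be one of its values. *)
Definition near_section (e : R) g u : Prop :=
  \forall w \near u, rnorm (g (proj w) - value w) < e.

Lemma near_section_le e e' g u : e <= e' -> near_section e g u -> near_section e' g u.
Proof. by move=> ee'; apply: filterS => w h; exact: lt_le_trans ee'. Qed.

Lemma in_total_exists (x : X) w :
  proj w = x -> exists b : B x, w = in_total b.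
Proof. by case: w => y b /= <-; exists b. Qed.

(** A point [w] near [a + b] need not be given as a sum. Openness of the projection supplies [c1]
    near [a] and [c2] near [b] over the same base point as [w], and thinness around [a + b] puts
    [c1 + c2] within [eta] of [w]. *)
Lemma near_sectionD e e' (eta : R) g g' (x : X) (a b : B x) : 0 < eta ->
  near_section e g (in_total a) -> near_section e' g' (in_total b) ->
  near_section (e + e' + eta) (fun x => g x + g' x) (in_total (a + b)).
Proof.
move=> eta0 hg hg'.
have [Z [hZ thin]] := thin_near (in_total (a + b)) eta0.
have hZ' := hZ; rewrite -addT_in_total in hZ'.
have [W [W' [uW uW' hW]]] := addT_near (erefl : proj (in_total a) = proj (in_total b)) hZ'.
have h1 := proj_pull (u := in_total (a + b)) (proj_near (nbhsI hg uW)).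
have h2 := proj_pull (u := in_total (a + b)) (proj_near (nbhsI hg' uW')).
apply: filterS3 hZ h1 h2 => w Zw [w1 [gw1 Ww1] e1] [w2 [gw2 Ww2] e2].
have [y [c [c1 [c2 [ew ew1 ew2]]]]] : exists y (c c1 c2 : B y),
    [/\ w = in_total c, w1 = in_total c1 & w2 = in_total c2].
  have [c1 ew1] := in_total_exists e1.
  have [c2 ew2] := in_total_exists e2.
  by exists (proj w), (value w), c1, c2; split => //; rewrite in_total_value.
subst w w1 w2; rewrite /= in gw1 gw2 *.
have := thin _ _ Zw (hW _ _ Ww1 Ww2 erefl) erefl.
rewrite addT_in_total distT_in_total => h.
apply: le_lt_trans (ler_rdistD (c1 + c2) _ _) _.
rewrite opprD addrACA; apply: ltrD; last by rewrite rdistC.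
apply: le_lt_trans (ler_rnormD _ _) _; exact: ltrD.
Qed.

Lemma near_section0 (e : R) g (x : X) : 0 < e ->
  (\forall y \near x, g y = 0) -> near_section e g (in_total (0 : B x)).
Proof.
move=> e0 g0.
have h : \forall w \near in_total (0 : B x), rnorm (value w) < e.
  have : rnorm (value (in_total (0 : B x))) < e by rewrite rnorm0.
  by move=> /lt_nbhsl; exact: bb_norm_continuous.
have h' := proj_pull (u := in_total (0 : B x)) g0.
apply: filterS2 h h' => w hw /= ->.
by rewrite sub0r rnormN.
Qed.

Lemma near_section_bounded (e : R) g u : near_section e g u ->
  exists2 M : R, 0 < M & \forall x \near proj u, rnorm (g x) < M.
Proof.
move=> h; exists (`|e| + rnorm (value u) + 1).
  by rewrite ltr_wpDl// addr_ge0// rnorm_ge0.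
have h1 : \forall w \near u, rnorm (value w) < rnorm (value u) + 1.
  have : rnorm (value u) < rnorm (value u) + 1 by rewrite ltrDl.
  by move=> /lt_nbhsl; exact: bb_norm_continuous.
apply: filterS (proj_near (nbhsI h h1)) => _ [w [hw hw1] <-].
have := ler_rnormD (g (proj w) - value w) (value w); rewrite subrK => h2.
have := ler_norm e; lra.
Qed.

Lemma near_sectionZ (e eta : R) g (phi : X -> R) (x : X) (a : B x) : 0 < eta ->
  {for x, continuous phi} -> near_section e g (in_total a) ->
  near_section (`|phi x| * e + eta) (fun y => (phi y)%:C%C *: g y)
    (in_total ((phi x)%:C%C *: a)).
Proof.
move=> eta0 cphi hg.
have [M M0 hM] := near_section_bounded hg; rewrite /= in hM.
pose c := phi x; have eM : 0 < eta / 2 / M by rewrite !divr_gt0.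
have h1 : \forall y \near x, `|phi y - c| * rnorm (g y) < eta / 2.
  have h2 : \forall y \near x, `|phi y - c| < eta / 2 / M.
    have /cvgrPdist_lt/(_ _ eM) := cphi.
    by apply: filterS => y; rewrite distrC.
  apply: filterS2 h2 hM => y h2 h3.
  apply: (@le_lt_trans _ _ (`|phi y - c| * M)); first by rewrite ler_wpM2l// ltW.
  by rewrite -ltr_pdivlMr.
pose u := in_total ((phi x)%:C%C *: a).
have h1' := proj_pull (u := u) h1.
suff h2 : \forall w \near u, rnorm (c%:C%C *: g (proj w) - value w) < `|c| * e + eta / 2.
  apply: filterS2 h1' h2 => w /= hw1 hw2.
  have -> : (phi (proj w))%:C%C *: g (proj w) - value w =
      (phi (proj w) - c)%:C%C *: g (proj w) + (c%:C%C *: g (proj w) - value w).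
    by rewrite rmorphB scalerBl addrA subrK.
  apply: le_lt_trans (ler_rnormD _ _) _; rewrite rnormZr; lra.
(* For [c] nonzero, scaling by [c^-1] carries neighbourhoods of [c a] back to neighbourhoods of [a];
   for [c = 0] only the smallness of the norm near the zero element is available. *)
have [c0|c0] := eqVneq c 0.
  have h2 : near_section (eta / 2) (fun y => 0 : B y) u.
    rewrite /u -/c c0 rmorph0 scale0r; apply: near_section0; first by rewrite divr_gt0.
    exact: filterE.
  apply: filterS h2 => w.
  by rewrite c0 rmorph0 scale0r normr0 mul0r !add0r.
have h2 : nbhs u (scaleT (c^-1)%:C%C @^-1`
    [set w | rnorm (g (proj w) - value w) < e]).
  apply: (bb_scale_continuous bbB); rewrite /scaleT/u/=.
  by rewrite scalerA -rmorphM mulVf// rmorph1 scale1r.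
apply: filterS h2 => w /= hw.
have -> : c%:C%C *: g (proj w) - value w =
    c%:C%C *: (g (proj w) - (c^-1)%:C%C *: value w).
  by rewrite scalerBr scalerA -rmorphM mulfV// rmorph1 scale1r.
rewrite rnormZr; apply: (@lt_trans _ _ (`|c| * e)); last by rewrite ltrDl divr_gt0.
by rewrite ltr_pM2l// normr_gt0.
Qed.

Lemma near_section_sum n (e : 'I_n -> R) (eta : R) (g : 'I_n -> forall x, B x)
    (x : X) (a : 'I_n -> B x) : 0 < eta ->
  (forall i, near_section (e i) (g i) (in_total (a i))) ->
  near_section (eta + \sum_(i < n) (e i + eta)) (fun y => \sum_(i < n) g i y)
    (in_total (\sum_(i < n) a i)).
Proof.
move=> eta0; elim: n e g a => [|n IH] e g a hg.
  rewrite !big_ord0 addr0; apply: near_section0 => //.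
  by apply: filterE => y; rewrite big_ord0.
rewrite !big_ord_recr /=.
have -> : (fun y => \sum_(i < n.+1) g i y) =
  (fun y => \sum_(i < n) g (widen_ord (leqnSn n) i) y + g ord_max y).
  by apply: functional_extensionality_dep => y; rewrite big_ord_recr.
rewrite addrA addrA; apply: near_sectionD => //.
exact: IH.
Qed.

(** [g x] is itself within [e] of [a], so a point near [g x] is within [e] of some point near [a] in
    its fibre, which in turn is within [e] of [g]: hence the factor 2. *)
Lemma near_section_recenter (e : R) g (x : X) (a : B x) :
  near_section e g (in_total a) -> near_section (2 * e) g (in_total (g x)).
Proof.
move=> hg; have := nbhs_singleton hg; rewrite /= => ga.
have [|W [W' [uW uW' h]]] := @distT_near (in_total (g x)) (in_total a) e erefl.
  by rewrite distT_in_total.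
have h1 := proj_pull (u := in_total (g x)) (proj_near (nbhsI hg uW')).
apply: filterS2 uW h1 => w Ww [w' [gw' W'w'] ew].
have h2 := h _ _ Ww W'w' (esym ew).
have [c ew'] := in_total_exists ew; subst w'.
rewrite -[X in distT X _]in_total_value distT_in_total in h2.
apply: le_lt_trans (ler_rdistD c _ _) _; rewrite [2 * e]mulr_natl mulr2n.
by apply: ltrD => //; rewrite rdistC.
Qed.

(** The difference [g (proj w) - w] tends to the zero element as [w] tends to [g x], by [bb_cvg0].
    Adding it back to [w] gives [g (proj w)], and the points [proj w] fill a neighbourhood of [x],
    the projection being open. *)
Lemma near_section_continuous g (x : X) :
  (forall e : R, 0 < e -> near_section e g (in_total (g x))) ->
  (fun y => in_total (g y)) @ x --> in_total (g x).
Proof.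
move=> hg; pose u := in_total (g x).
pose D w := in_total (g (proj w) - value w).
have D0 : D @ nbhs u --> in_total (0 : B x).
  apply: (bb_cvg0 bbB).
  - by move=> A hA; exact: (proj_pull (u := u) hA).
  - apply/cvgrPdist_lt => e e0; apply: filterS (hg e e0) => w /= hw.
    by rewrite sub0r normrN ger0_norm// rnorm_ge0.
move=> Z uZ.
have uZ' : nbhs (addT u (in_total (0 : B x))) Z by rewrite addT_in_total addr0.
have [W [W' [uW uW' h]]] := addT_near (erefl : proj u = proj (in_total (0 : B x))) uZ'.
apply: filterS (proj_near (nbhsI uW (D0 _ uW'))) => _ [w [Ww W'w] <-] /=.
have := h w (D w) Ww W'w erefl.
by rewrite -{1}(in_total_value w) addT_in_total addrCA subrr addr0.
Qed.

Lemma in_total_continuous (x : X) : continuous (@in_total R X B x).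
Proof.
move=> a Z hZ.
have hZ' : nbhs (addT (in_total a) (in_total (0 : B x))) Z.
  by rewrite addT_in_total addr0.
have [W [W' [uW uW' h]]] := addT_near (erefl : proj (in_total a) = proj (in_total (0 : B x))) hZ'.
have D0 : (fun b : B x => in_total (b - a)) @ nbhs a --> in_total (0 : B x).
  apply: (bb_cvg0 bbB).
  - exact: cvg_cst.
  - apply/cvgrPdist_lt => e e0; apply/nbhs_rnormP; exists e => // b /=.
    by rewrite sub0r normrN ger0_norm ?rnorm_ge0// rdistC.
have hD : \forall b \near a, W' (in_total (b - a)) by exact: D0.
suff : \forall b \near a, Z (in_total b) by [].
apply: filterS hD => b hb.
have := h _ _ (nbhs_singleton uW) hb erefl.
by rewrite addT_in_total addrCA subrr addr0.
Qed.

(** With [in_total_continuous], this identifies the norm topology of a fibre with the topology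
    induced from the total space. *)
Lemma fib_continuous (Y : topologicalType) (f : Y -> totalSpace B) (x : X) :
  continuous f -> (forall y, proj (f y) = x) -> continuous (fun y => fib x (f y)).
Proof.
move=> cf pf y; apply/cvg_rnormP => e e0.
have [|W [W' [uW uW' h]]] := @distT_near (f y) (f y) e erefl.
  by rewrite -(in_total_value (f y)) distT_in_total subrr rnorm0.
have hf : \forall z \near y, W' (f z) by exact: cf.
apply: filterS hf => z hz.
have := h _ _ (nbhs_singleton uW) hz; rewrite !pf => /(_ erefl).
by rewrite -[f y](in_totalK (pf y)) -[f z](in_totalK (pf z)) distT_in_total !fibK.
Qed.

(** The axioms give continuity of scaling by one fixed scalar at a time. Writing [phi y g y] as
    [c g y] plus [(phi y - c) g y] reduces joint continuity to that and to [bb_cvg0]. *)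
Lemma section_scale_continuous g (phi : X -> R) (x : X) :
  (fun y => in_total (g y)) @ x --> in_total (g x) -> {for x, continuous phi} ->
  (fun y => in_total ((phi y)%:C%C *: g y)) @ x --> in_total ((phi x)%:C%C *: g x).
Proof.
move=> cg cphi; pose c := phi x.
have D0 : (fun y => in_total ((phi y - c)%:C%C *: g y)) @ nbhs x --> in_total (0 : B x).
  apply: (bb_cvg0 bbB); first exact: cvg_id.
  suff h : (fun y => rnorm ((phi y - c)%:C%C *: g y)) @ x --> (0 : R) by exact: h.
  have -> : (fun y => rnorm ((phi y - c)%:C%C *: g y)) =
      (fun y => `|phi y - c| * rnorm (g y)).
    by apply/funext => y; rewrite rnormZr.
  have -> : 0 = `|phi x - c| * rnorm (g x) by rewrite subrr normr0 mul0r.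
  apply: cvgM.
    by apply: cvg_norm; apply: cvgB; [exact: cphi|exact: cvg_cst].
  apply: (@cvg_comp _ _ _ (fun y => in_total (g y)) (fun u => rnorm (value u)) _ _ _ cg).
  exact: (fun A hA => bb_norm_continuous bbB (hA : nbhs (rnorm (value (in_total (g x)))) A)).
move=> Z hZ.
have hZ' : nbhs (addT (scaleT c%:C%C (in_total (g x))) (in_total (0 : B x))) Z.
  by rewrite addT_in_total addr0.
have [W [W' [uW uW' h]]] := addT_near
  (erefl : proj (scaleT c%:C%C (in_total (g x))) = proj (in_total (0 : B x))) hZ'.
have h1 : \forall y \near x, W (scaleT c%:C%C (in_total (g y))).
  exact: (cg _ (bb_scale_continuous bbB uW)).
have h2 : \forall y \near x, W' (in_total ((phi y - c)%:C%C *: g y)) by exact: D0.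
suff : \forall y \near x, Z (in_total ((phi y)%:C%C *: g y)) by [].
apply: filterS2 h1 h2 => y Wy W'y.
have := h _ _ Wy W'y erefl.
by rewrite addT_in_total /= rmorphB scalerBl addrCA subrr addr0.
Qed.

End BundleTopology.

(** * Existence of continuous sections *)

Section Sections.
Variables (R : realType) (X : topologicalType) (B : bundle R X).
Hypothesis bbB : banach_bundle B.
Hypothesis lchX : lch X.
Local Notation projB := (@proj R X B).

Lemma select_section (W : set (totalSpace B)) : exists g : forall x, B x,
  forall x, (projB @` W) x -> W (in_total (g x)).
Proof.
have h x : exists a : B x, (projB @` W) x -> W (in_total a).
  have [[w Ww wx]|n] := pselect ((projB @` W) x); last by exists 0.
  by exists (fib x w) => _; rewrite in_totalK.
exists (fun x => sval (cid (h x))) => x; exact: svalP (cid (h x)).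
Qed.

(** Bumps divided by their sum, which is known to be nonzero on [K] only; this is why continuity and
    total 1 are claimed at points of [K]. The closed sets [C] allow a function to be replaced by 0
    near any point off its support. *)
Lemma partition_of_unity (K : set X) (V : X -> set X) :
  compact K -> (forall x, K x -> nbhs x (V x)) ->
  exists (n : nat) (x : 'I_n -> X) (phi : 'I_n -> X -> R),
    [/\ forall i, K (x i), forall i y, 0 <= phi i y,
        forall y, K y -> \sum_(i < n) phi i y = 1,
        forall i y, K y -> {for y, continuous (phi i)} &
        forall i, exists2 C, closed C & C `<=` V (x i) /\
          forall y, phi i y != 0 -> C y].
Proof.
move=> cK hV.
have hpsi x : exists psi : X -> R, K x ->
    [/\ continuous psi, forall y, 0 <= psi y, psi x = 1 &
      exists K, [/\ compact K, nbhs x K, K `<=` V x & forall y, psi y != 0 -> K y]].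
  have [Kx|nKx] := pselect (K x); last by exists (fun=> 0).
  by have [psi h] := lch_bump R lchX (hV x Kx); exists psi.
have [psi hp] := choice hpsi.
have [|n [x [xK cov]]] := @compact_finite_cover X K (fun x => [set y | 0 < psi x y]) cK.
  move=> x Kx; have [cpsi _ px _] := hp x Kx.
  have : 0 < psi x x by rewrite px.
  by move=> /lt_nbhsr; exact: cpsi.
have p0 i y : 0 <= psi (x i) y by have [_ h _ _] := hp _ (xK i).
pose s y := \sum_(i < n) psi (x i) y.
have s0 y : 0 <= s y by apply: sumr_ge0.
have spos y : K y -> 0 < s y.
  move=> /cov[i pi]; rewrite /s (bigD1 i)//= ltr_wpDr//.
  by apply: sumr_ge0.
exists n, x, (fun i y => psi (x i) y / s y); split => //.
- by move=> i y; rewrite divr_ge0.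
- by move=> y Ky; rewrite -mulr_suml mulfV// gt_eqF// spos.
- move=> i y Ky; apply: cvgM.
    by have [cpsi _ _ _] := hp _ (xK i); exact: cpsi.
  apply: cvgV; first by rewrite gt_eqF// spos.
  apply: cvg_big => [|j _]; first exact: (@add_continuous R).
  by have [cpsi _ _ _] := hp _ (xK j); exact: cpsi.
move=> i; have [_ _ _ [C [cC _ CV hC]]] := hp _ (xK i).
exists C; first exact: compact_closed lchX.1 cC.
by split => // y h; apply: hC; apply: contraNneq h => ->; rewrite mul0r.
Qed.

Definition approx_section (K : set X) (e : R) (g : forall x, B x) : Prop :=
  forall x, K x -> exists a : B x, near_section e g (in_total a).

Lemma thin_approx_section (W : set (totalSpace B)) (e : R) g (K : set X) :
  open W -> (forall w w', W w -> W w' -> proj w = proj w' -> distT w w' < e) ->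
  (forall x, (projB @` W) x -> W (in_total (g x))) -> K `<=` projB @` W ->
  forall x, K x -> near_section e g (in_total (g x)).
Proof.
move=> oW thin gW KW x Kx; have Wg := gW x (KW x Kx).
apply: filterS (open_nbhs_nbhs (conj oW Wg)) => w Ww.
have Wgw : W (in_total (g (proj w))) by apply: gW; exists w.
by have := thin _ _ Wgw Ww erefl; rewrite -[X in distT _ X]in_total_value distT_in_total.
Qed.

(** Around each point choose a thin open set whose elements are within [e] of [f], select
    arbitrarily from it, and glue with a partition of unity. A convex combination of elements within
    [e] of [f y] is again within [e]. *)
Lemma approx_section_refine (K : set X) (e e' : R) f :
  compact K -> 0 < e' -> approx_section K e f ->
  exists f', approx_section K e' f' /\
    forall x, K x -> rnorm (f x - f' x) <= e.
Proof.
move=> cK e'0 hf.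
have e2 : 0 < e' / 2 by rewrite divr_gt0.
have hW x : exists W : set (totalSpace B), open W /\ (K x ->
    [/\ (projB @` W) x,
      (forall w w', W w -> W w' -> proj w = proj w' -> distT w w' < e' / 2) &
      (forall w, W w -> rnorm (f (proj w) - value w) < e)]).
  have [Kx|nKx] := pselect (K x); last by exists setT; split => //; exact: openT.
  have [a ha] := hf x Kx.
  have [W' [uW' thin]] := thin_near bbB (in_total a) e2.
  pose W := ((W' `&` [set w | rnorm (f (proj w) - value w) < e])^°).
  exists W; split; first exact: open_interior.
  move=> _; split.
  - by exists (in_total a) => //; exact: nbhsI.
  - by move=> w w' /interior_subset[W'w _] /interior_subset[W'w' _]; exact: thin.
  - by move=> w /interior_subset[].
have [W hWx] := choice hW.
have oW x : open (W x) by have [] := hWx x.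
have hWK x (Kx : K x) := (hWx x).2 Kx.
have [n [x [phi [xK phi0 phi1 cphi phiV]]]] :
  exists (n : nat) (x : 'I_n -> X) (phi : 'I_n -> X -> R),
    [/\ forall i, K (x i), forall i y, 0 <= phi i y,
        forall y, K y -> \sum_(i < n) phi i y = 1,
        forall i y, K y -> {for y, continuous (phi i)} &
        forall i, exists2 C, closed C & C `<=` projB @` W (x i) /\
          forall y, phi i y != 0 -> C y].
  apply: (@partition_of_unity K (fun x => projB @` W x)) => // x Kx.
  apply: open_nbhs_nbhs; split; first exact: bb_proj_open.
  by have [] := hWK x Kx.
have [sigma hs] := choice (fun x => select_section (W x)).
pose f' y := \sum_(i < n) (phi i y)%:C%C *: sigma (x i) y.
exists f'; split.
- move=> x0 Kx0.
  (* Thinness contributes [e' / 2]. The [n] scalings and [n] additions lose [eta] each, and the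
     empty sum once more: [2 n + 1] times [eta] is the other half. *)
  pose eta := e' / 2 / (2 * n%:R + 1).
  have d0 : 0 < 2 * n%:R + 1 :> R by rewrite ltr_wpDl// mulr_ge0.
  have eta0 : 0 < eta by rewrite divr_gt0.
  exists (\sum_(i < n) (phi i x0)%:C%C *: sigma (x i) x0).
  have h : near_section (eta + \sum_(i < n) (`|phi i x0| * (e' / 2) + eta + eta)) f'
      (in_total (\sum_(i < n) (phi i x0)%:C%C *: sigma (x i) x0)).
    apply: (near_section_sum bbB (g := fun i y => (phi i y)%:C%C *: sigma (x i) y)) => // i.
    have [V0|nV0] := pselect ((projB @` W (x i)) x0).
      have [_ thin _] := hWK _ (xK i).
      apply: near_sectionZ => //; first exact: cphi.
      apply: (@thin_approx_section (W (x i)) _ _ (projB @` W (x i)) (oW _) thin) => //.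
      exact: hs.
    have [C clC [CV hC]] := phiV i.
    have nC : ~ C x0 by move=> /CV.
    have z0 y : ~ C y -> phi i y = 0.
      by move=> nCy; apply/eqP; apply: contrapT => /negP /hC.
    rewrite (z0 _ nC) normr0 mul0r add0r rmorph0 scale0r.
    apply: near_section0 => //.
    apply: filterS (open_nbhs_nbhs (conj (closed_openC clC) nC)) => y nCy.
    by rewrite z0// rmorph0 scale0r.
  apply: near_section_le h.
  rewrite big_split/= big_split/= sumr_const card_ord -mulr_suml.
  have -> : \sum_(i < n) `|phi i x0| = 1.
    by rewrite -(phi1 _ Kx0); apply: eq_bigr => i _; rewrite ger0_norm.
  rewrite mul1r -[eta *+ n]mulr_natl.
  have : (2 * n%:R + 1) * eta = e' / 2 by rewrite mulrC divfK// gt_eqF.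
  by move=> ?; lra.
- move=> y Ky.
  have -> : f y - f' y = \sum_(i < n) (phi i y)%:C%C *: (f y - sigma (x i) y).
    rewrite /f'; under [RHS]eq_bigr do rewrite scalerBr.
    by rewrite sumrB -scaler_suml -rmorph_sum phi1// rmorph1 scale1r.
  apply: le_trans (ler_rnorm_sum _ _ _) _.
  have -> : e = \sum_(i < n) phi i y * e by rewrite -mulr_suml phi1// mul1r.
  apply: ler_sum => i _; rewrite rnormZr ger0_norm//.
  have [->|pi] := eqVneq (phi i y) 0; first by rewrite !mul0r.
  rewrite ler_wpM2l//.
  have [C clC [CV hC]] := phiV i.
  have [_ _ hf'] := hWK _ (xK i).
  have Wy := hs (x i) y (CV _ (hC _ pi)).
  exact: ltW (hf' _ Wy).
Qed.

(** Errors halve at each refinement, so the approximations converge uniformly on [K]. Near-section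
    estimates involve nearby base points, hence the interior of [K] in the conclusion. *)
Lemma approx_section_limit (K : set X) (e : R) f0 :
  compact K -> 0 < e -> approx_section K e f0 ->
  exists f : forall x, B x,
    (forall x, K x -> rnorm (f x - f0 x) <= 3 * e) /\
    forall x, K^° x -> forall d : R, 0 < d -> near_section d f (in_total (f x)).
Proof.
move=> cK e0 hf0.
pose ee n : R := e / 2 ^+ n.
have p2 n : 0 < 2 ^+ n :> R by rewrite exprn_gt0.
have ee0 n : 0 < ee n by rewrite divr_gt0.
have step n (g : {g | approx_section K (ee n) g}) :
    {g' | approx_section K (ee n.+1) g' /\
      forall x, K x -> rnorm (sval g x - g' x) <= ee n}.
  by apply: cid; exact: approx_section_refine cK (ee0 n.+1) (svalP g).
have h0 : approx_section K (ee 0%N) f0 by rewrite /ee expr0 divr1.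
pose F := fix F n : {g | approx_section K (ee n) g} :=
  if n is m.+1 then exist _ (sval (step m (F m))) (svalP (step m (F m))).1
  else exist _ f0 h0.
pose f_ n := sval (F n).
have f_approx n : approx_section K (ee n) (f_ n) by exact: svalP (F n).
have f_step n x : K x -> rnorm (f_ n x - f_ n.+1 x) <= ee n.
  exact: (svalP (step n (F n))).2.
have eeS n : ee n.+1 = ee n / 2.
  by rewrite /ee exprS invfM mulrA mulrAC.
have f_dist n k x : K x -> rnorm (f_ n x - f_ (n + k)%N x) <= 2 * ee n - 2 * ee (n + k)%N.
  move=> Kx; elim: k => [|k IH]; first by rewrite addn0 !subrr rnorm0.
  apply: le_trans (ler_rdistD (f_ (n + k)%N x) _ _) _.
  have := f_step (n + k)%N x Kx; rewrite addnS eeS; lra.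
have f_dist' n m x : K x -> (n <= m)%N -> rnorm (f_ n x - f_ m x) <= 2 * ee n.
  move=> Kx nm; have := f_dist n (m - n)%N x Kx; rewrite subnKC//.
  by have := ee0 m; lra.
have small (d : R) : 0 < d -> exists n, ee n < d.
  move=> d0; exists (Num.truncn (e / d)).
  have h : e / d < (Num.truncn (e / d)).+1%:R by exact: truncnS_gt.
  set n := Num.truncn _ in h *.
  have h2 : n.+1%:R <= 2 ^+ n :> R by rewrite -natrX ler_nat ltn_expl.
  rewrite /ee ltr_pdivrMr// mulrC -ltr_pdivrMr//.
  exact: lt_le_trans h h2.
have lim x : exists l : B x, K x -> forall n, rnorm (l - f_ n x) <= 2 * ee n.
  have [Kx|nKx] := pselect (K x); last by exists 0.
  have [|l hl] := @rnorm_complete R (B x) (fun n => f_ n x).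
    move=> d d0; have [N hN] := small (d / 4) (divr_gt0 d0 (ltr0n R 4)).
    exists N => m k Nm Nk.
    apply: le_lt_trans (ler_rdistD (f_ N x) _ _) _.
    have := f_dist' N m x Kx Nm; have := f_dist' N k x Kx Nk.
    rewrite (rdistC (f_ m x)); lra.
  exists l => _ n; apply/ler_addgt0Pr => d d0.
  have [N hN] := hl d d0.
  apply: le_trans (ler_rdistD (f_ (maxn n N) x) _ _) _.
  have h1 := hN (maxn n N) (leq_maxr _ _).
  have h2 := f_dist' n (maxn n N) x Kx (leq_maxl _ _).
  by rewrite (rdistC (f_ (maxn n N) x)); lra.
pose f x := sval (cid (lim x)).
have hf x : K x -> forall n, rnorm (f x - f_ n x) <= 2 * ee n.
  exact: svalP (cid (lim x)).
exists f; split.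
  move=> x Kx; have := hf x Kx 0%N.
  by rewrite {1}/f_ /= /ee expr0 divr1; lra.
(* The limit is within [2 ee n] of [f_ n], itself within [ee n] of nearby elements; 4 covers the sum
   and recentering doubles it to 8. *)
move=> x Kx d d0; have [n hn] := small (d / 8) (divr_gt0 d0 (ltr0n R 8)).
have [a ha] := f_approx n x (interior_subset Kx).
have h1 : near_section (4 * ee n) f (in_total a).
  have h2 := proj_pull bbB (u := in_total a) Kx.
  apply: filterS2 ha h2 => w hw Kw.
  apply: le_lt_trans (ler_rdistD (f_ n (proj w)) _ _) _.
  have := hf _ Kw n; have := ee0 n; lra.
apply: near_section_le (near_section_recenter bbB h1); lra.
Qed.

Lemma section_exists (x : X) (b : B x) (e : R) : 0 < e ->
  exists f : forall y, B y, Cc f /\ rnorm (f x - b) <= e.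
Proof.
(* The limit moves the first selection by at most [3 d], and thinness puts that selection within [d]
   of [b]. *)
move=> e0; pose d := e / 4; have d0 : 0 < d by rewrite divr_gt0.
have [W' [uW' thin]] := thin_near bbB (in_total b) d0.
pose W := W'^°; have oW : open W by exact: open_interior.
have Wb : W (in_total b) by exact: uW'.
have [g0 hg0] := select_section W.
have xW : nbhs x (projB @` W).
  apply: open_nbhs_nbhs; split; first exact: bb_proj_open.
  by exists (in_total b).
have [K [cK Kx KW]] := lch_compact_nbhs R lchX xW.
have thinW w w' : W w -> W w' -> proj w = proj w' -> distT w w' < d.
  by move=> /interior_subset Ww /interior_subset Ww'; exact: thin.
have hg0a : approx_section K d g0.
  move=> y Ky; exists (g0 y).
  exact: (thin_approx_section oW thinW hg0 KW Ky).
have [f [ff0 cf]] := approx_section_limit cK d0 hg0a.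
have [psi [cpsi psi0 psi1 [C [cC Cx CK hC]]]] := lch_bump R lchX (nbhs_interior Kx).
exists (fun y => (psi y)%:C%C *: f y); split; last first.
  rewrite psi1 rmorph1 scale1r.
  apply: le_trans (ler_rdistD (g0 x) _ _) _.
  have h1 := ff0 x (nbhs_singleton Kx).
  have Wg : W (in_total (g0 x)) by apply: hg0; exact: nbhs_singleton xW.
  have := thinW _ _ Wg Wb erefl; rewrite distT_in_total => h2.
  by rewrite /d in h1 h2; lra.
have clC := compact_closed lchX.1 cC.
split.
  move=> y; have [Ky|nKy] := pselect (K^° y).
    apply: (section_scale_continuous bbB); last exact: cpsi.
    by apply: (near_section_continuous bbB); exact: cf.
  have nC : ~ C y by move=> /CK.
  have z0 z : ~ C z -> psi z = 0.
    by move=> nCz; apply/eqP; apply: contrapT => /negP /hC.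
  apply: (near_section_continuous bbB) => e1 e10.
  rewrite (z0 _ nC) rmorph0 scale0r; apply: near_section0 => //.
  apply: filterS (open_nbhs_nbhs (conj (closed_openC clC) nC)) => z nCz.
  by rewrite z0// rmorph0 scale0r.
apply: (subclosed_compact _ cC); first exact: closed_closure.
have -> : C = closure C by rewrite -(closure_id C).1.
apply: closureS => y; apply: contraNP => nC; apply/eqP.
suff -> : psi y = 0 by rewrite rmorph0 scale0r.
by apply/eqP; apply: contrapT => /negP /hC.
Qed.

End Sections.

(** * The integrated form of an induced kernel *)

Section RealFunctional.
Variable R : realType.

Record real_functional (L : R[i] -> R) : Prop := {
  rfD : forall z w, L (z + w) = L z + L w ;
  rfZ : forall (t : R) z, L (t%:C%C * z) = t * L z ;
  rf_le : forall z, `|L z| <= Re `|z| }.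

Lemma Re_functional : real_functional (@complex.Re R).
Proof.
split; first by move=> z w; rewrite raddfD.
- by move=> t [a b] /=; rewrite mul0r subr0.
- exact: rnorm_cplx_le.
Qed.

Lemma Im_functional : real_functional (@complex.Im R).
Proof.
split; first by move=> z w; rewrite raddfD.
- by move=> t [a b] /=; rewrite mul0r addr0.
- move=> [a b]; rewrite normc_def /=.
  by rewrite -(sqrtr_sqr b) ler_wsqrtr// lerDr sqr_ge0.
Qed.

Lemma opp_functional L : real_functional L -> real_functional (fun z => - L z).
Proof.
move=> [LD LZ LB]; split.
- by move=> z w; rewrite LD opprD.
- by move=> t z; rewrite LZ mulrN.
- by move=> z; rewrite normrN.
Qed.

(** [Re] tests the real part, while [Im] and [- Im] are both nonnegative on nonnegative numbers and
    together force the imaginary part to vanish. *)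
Lemma cplx_ge0_functional (z : R[i]) :
  (forall L, real_functional L -> (forall w, 0 <= w -> 0 <= L w) -> 0 <= L z) ->
  0 <= z.
Proof.
move=> h; apply/cplx_ge0P; split.
  by apply: h; [exact: Re_functional|move=> w /cplx_ge0P[]].
have h1 : 0 <= Im z.
  by apply: h; [exact: Im_functional|move=> w /cplx_ge0P[_ ->]].
have h2 : 0 <= - Im z.
  apply: (h (fun z => - Im z)); first exact/opp_functional/Im_functional.
  by move=> w /cplx_ge0P[_ ->]; rewrite oppr0.
by lra.
Qed.

Variables (L : R[i] -> R) (hL : real_functional L).

Lemma rfB z w : L (z - w) = L z - L w.
Proof.
rewrite rfD//; congr (_ + _); have := rfZ hL (-1) w.
by rewrite rmorphN rmorph1 !mulN1r.
Qed.

Lemma rf0 : L 0 = 0.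
Proof. by have := rfZ hL 0 0; rewrite mulr0 mul0r. Qed.

Lemma rf_sum (I : finType) (F : I -> R[i]) : L (\sum_i F i) = \sum_i L (F i).
Proof. exact: (big_morph L (rfD hL) rf0). Qed.

Lemma rf_continuous (X : topologicalType) (F : X -> R[i]^o) :
  continuous F -> continuous (fun x => L (F x)).
Proof.
move=> cF x; apply/cvgrPdist_lt => e e0.
have := cF x => /cvg_rnormP /(_ e e0); apply: filterS => y hy.
by rewrite -rfB; apply: le_lt_trans (rf_le hL _) hy.
Qed.

End RealFunctional.

(** * Continuity of representations along continuous families *)

Section StrongContinuity.
Variables (R : realType) (G : topGroupType) (H : closedSubgroup G).
Variables (B : starBundle R G) (bsbB : banach_star_bundle B).
Variables (Y : hilbertType R) (T : starRep (reduction B H) Y).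

Let bbB : banach_bundle B := bsb_bundle bsbB.

Lemma mulT_continuous (X : topologicalType) (P Q : X -> totalSpace B) :
  continuous P -> continuous Q -> continuous (fun x => mulT (P x) (Q x)).
Proof.
move=> cP cQ x; apply: (@cvg_comp _ _ _ (fun x => (P x, Q x))
  (fun p : totalSpace B * totalSpace B => mulT p.1 p.2) _ (nbhs (P x, Q x))).
  exact: (cvg_pair (cP x) (cQ x)).
have cm : continuous (fun p : totalSpace B * totalSpace B => mulT p.1 p.2).
  exact: bmul_continuous bsbB.
exact: (cm (P x, Q x)).
Qed.

Lemma starT_continuous (X : topologicalType) (P : X -> totalSpace B) :
  continuous P -> continuous (fun x => starT (P x)).
Proof.
move=> cP x; apply: (@cvg_comp _ _ _ P (@starT R G B) _ (nbhs (P x))).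
  exact: cP.
have cs : continuous (@starT R G B) by exact: bstar_continuous bsbB.
exact: (cs (P x)).
Qed.

Section Family.
Variables (X : topologicalType) (P : X -> totalSpace B).
Hypothesis cP : continuous P.
Hypothesis PH : forall x, subgroup_set H (proj (P x)).

(** Continuity of [T] refers to the total space of the reduction. Its topology is initial along
    [red_incl], so a continuous family lying over [H] lifts to it. *)
Lemma opT_weak_continuous xi eta :
  continuous (fun x => ip (opT T (P x) xi) eta : R[i]^o).
Proof.
pose h x : subgroup_type H := exist _ (proj (P x)) (mem_set (PH x)).
pose lift x : totalSpace (reduction B H) :=
  @in_total R _ (reduction B H) (h x) (value (P x)).
have clift : continuous lift.
  apply/continuousP => A [W oW <-].
  have -> : lift @^-1` (@red_incl R G B H @^-1` W) = P @^-1` W.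
    by apply/seteqP; split => x /=; rewrite /red_incl/lift/= in_total_value.
  by move/continuousP : cP; apply.
have -> : (fun x => ip (opT T (P x) xi) eta : R[i]^o) =
    (fun u : totalSpace (reduction B H) => ip (rep T (value u) xi) eta : R[i]^o) \o lift.
  by apply/funext => x; rewrite -(rep_atE T (PH x)).
by move=> x; apply: cvg_comp; [exact: clift|exact: rep_continuous].
Qed.

Lemma opT_functional_continuous (L : R[i] -> R) xi eta : real_functional L ->
  continuous (fun x => L (ip eta (opT T (P x) xi))).
Proof.
move=> hL.
(* Weak continuity is available with the operator in the conjugate-linear slot; conjugation moves it
   to the linear one. *)
have hL' : real_functional (fun z => L z^*%C).
  split.
  - by move=> z w; rewrite rmorphD rfD.
  - move=> t z; rewrite -rfZ//; congr L; case: z => a b.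
    by simpc.
  - by move=> z; apply: le_trans (rf_le hL _) _; rewrite normcJ.
have := rf_continuous hL' (opT_weak_continuous (xi := xi) (eta := eta)).
by under eq_fun do rewrite -ip_conj.
Qed.

End Family.

(** Expanding the squared distance of [T_{P x} xi] to its value at [x0] leaves only matrix
    coefficients, as [|T_b xi|^2 = <xi, T_{b^* b} xi>]; weak continuity thus upgrades to strong
    continuity. *)
Lemma opT_strong_continuous (X : topologicalType) (P : X -> totalSpace B) xi :
  continuous P -> (forall x, subgroup_set H (proj (P x))) ->
  continuous (fun x => opT T (P x) xi).
Proof.
move=> cP PH x0.
have norm2 x : rnorm (opT T (P x) xi) ^+ 2 = Re (ip xi (opT T (mulT (starT (P x)) (P x)) xi)).
  have PV : subgroup_set H (proj (starT (P x))) by apply: subgroupV; exact: PH.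
  by rewrite opT_mul// -rip_self -/(rip xi _) (ripC xi) /rip opT_star.
pose d x := Re (ip xi (opT T (mulT (starT (P x)) (P x)) xi)) -
   2 * Re (ip (opT T (P x0) xi) (opT T (P x) xi)) + rnorm (opT T (P x0) xi) ^+ 2.
have dE x : d x = rnorm (opT T (P x0) xi - opT T (P x) xi) ^+ 2.
  rewrite /d -norm2 -[RHS]rip_self /rip ipBr !ipBl !raddfB/=.
  rewrite -/(rip _ _) -/(rip (opT T (P x) xi) (opT T (P x0) xi)).
  rewrite -/(rip (opT T (P x0) xi) (opT T (P x0) xi)).
  rewrite -/(rip (opT T (P x) xi) (opT T (P x) xi)) !rip_self.
  by rewrite (ripC (opT T (P x) xi)); lra.
have cd : continuous d.
  move=> x; apply: cvgD; last exact: cvg_cst.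
  apply: cvgB.
    apply: (opT_functional_continuous (P := fun x => mulT (starT (P x)) (P x))).
    - by apply: mulT_continuous => //; exact: starT_continuous.
    - by move=> y; apply: subgroupM => //; apply: subgroupV.
    - exact: Re_functional.
  apply: cvgM; first exact: cvg_cst.
  have c1 := opT_functional_continuous cP PH (xi := xi) (eta := opT T (P x0) xi) (Re_functional R).
  exact: (c1 x).
apply/cvg_rnormP => e e0.
have d0 : d x0 < e ^+ 2 by rewrite dE subrr rnorm0 expr0n exprn_gt0.
have hd : \forall x \near x0, d x < e ^+ 2 by exact: (cd x0 _ (lt_nbhsl d0)).
apply: filterS hd => x.
rewrite dE => h; have := rnorm_ge0 (opT T (P x0) xi - opT T (P x) xi).
by move=> h1; rewrite -(ltr_pXn2r (n := 2))// nnegrE ltW.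
Qed.

(** Provides the bound that [bochner_functional] requires of a matrix coefficient on the fibre where
    the convolution is integrated. *)
Lemma opT_fibre_bound (t : G) xi eta : subgroup_set H t ->
  exists2 C : R, 0 < C &
    forall b : B t, Re `|ip eta (opT T (in_total b) xi)| <= C * rnorm b.
Proof.
move=> Ht.
have lin : linear (fun b : B t => ip eta (opT T (in_total b) xi) : R[i]^o).
  by move=> k a b; rewrite opT_linear ipDr ipZr.
have cont : continuous (fun b : B t => ip eta (opT T (in_total b) xi) : R[i]^o).
  have cw := opT_weak_continuous (in_total_continuous bbB (x := t))
    (fun b => Ht) (xi := xi) (eta := eta).
  move=> b; apply/cvg_rnormP => e e0.
  have := cw b => /cvg_rnormP /(_ e e0); apply: filterS => a.
  rewrite /rnorm => h; rewrite !(ip_conj (opT _ _ _) eta) -rmorphB.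
  by rewrite normcJ.
by have [C C0 hC] := linear_bound lin cont; exists C.
Qed.

End StrongContinuity.

Lemma continuous_compT (X Y Z : topologicalType) (f : X -> Y) (g : Y -> Z) :
  continuous f -> continuous g -> continuous (fun x => g (f x)).
Proof. by move=> cf cg x; apply: cvg_comp; [exact: cf|exact: cg]. Qed.

Lemma continuous_pair (X Y Z : topologicalType) (f : X -> Y) (g : X -> Z) :
  continuous f -> continuous g -> continuous (fun x => (f x, g x)).
Proof. by move=> cf cg x; exact: (cvg_pair (cf x) (cg x)). Qed.

Lemma continuous_cst (X Y : topologicalType) (y : Y) : continuous (fun _ : X => y).
Proof. by move=> x; exact: cvg_cst. Qed.

Lemma continuous_fst (X Y : topologicalType) : continuous (@fst X Y).
Proof. by move=> p; exact: cvg_fst. Qed.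

Lemma continuous_snd (X Y : topologicalType) : continuous (@snd X Y).
Proof. by move=> p; exact: cvg_snd. Qed.

Lemma continuous_mulR (R : realType) (X : topologicalType) (f g : X -> R) :
  continuous f -> continuous g -> continuous (fun x => f x * g x).
Proof. by move=> cf cg x; apply: cvgM; [exact: cf|exact: cg]. Qed.

Lemma continuous_invR (R : realType) (X : topologicalType) (f : X -> R) :
  continuous f -> (forall x, f x != 0) -> continuous (fun x => (f x)^-1).
Proof. by move=> cf f0 x; apply: cvgV; [exact: f0|exact: cf]. Qed.

Lemma cplx_norm_le (R : realType) (z : R[i]) : Re `|z| <= `|Re z| + `|Im z|.
Proof.
rewrite normc_def /=; set a := Re z; set b := Im z.
rewrite -(ger0_norm (addr_ge0 (normr_ge0 a) (normr_ge0 b))) -sqrtr_sqr ler_wsqrtr//.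
rewrite sqrrD -!normrX !(ger0_norm (sqr_ge0 _)).
by rewrite addrAC lerDl mulrn_wge0// mulr_ge0.
Qed.

Lemma ip_functional_le (R : realType) (Y : hilbertType R) (L : R[i] -> R) (x y : Y) :
  real_functional L -> `|L (ip x y)| <= 2 * (rnorm x * rnorm y).
Proof.
move=> hL; apply: le_trans (rf_le hL _) _; apply: le_trans (cplx_norm_le _) _.
have h1 := rip_CS x y.
have h2 : `|Im (ip x y)| <= rnorm x * rnorm y.
  rewrite Im_ip; apply: le_trans (rip_CS _ _) _; rewrite rnormZ.
  by rewrite normc_def /= expr0n expr1n add0r sqrtr1 mul1r.
by rewrite /rip in h1; lra.
Qed.

Lemma ip_functional_continuous (R : realType) (Y : hilbertType R) (L : R[i] -> R)
    (x : Y) (X : topologicalType) (F : X -> Y) :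
  real_functional L -> continuous F -> continuous (fun t => L (ip x (F t))).
Proof.
move=> hL cF t; apply/cvgrPdist_lt => e e0.
have d0 : 0 < 2 * rnorm x + 1 by rewrite ltr_wpDl// mulr_ge0// rnorm_ge0.
have := cF t => /cvg_rnormP /(_ _ (divr_gt0 e0 d0)); apply: filterS => s hs.
rewrite -(rfB hL) -ipBr; apply: le_lt_trans (ip_functional_le _ _ hL) _.
rewrite ltr_pdivlMr// in hs; apply: le_lt_trans hs.
rewrite mulrA mulrC ler_wpM2l ?rnorm_ge0//; lra.
Qed.

Lemma continuous_rnormP (R : realType) (V : normedModType R[i]) (X : topologicalType)
    (F : X -> V) :
  (forall x (e : R), 0 < e -> \forall y \near x, rnorm (F x - F y) < e) ->
  continuous F.
Proof. by move=> h x; apply/cvg_rnormP => e e0; exact: h. Qed.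

Lemma continuous_scaleC (R : realType) (V : normedModType R[i]) (X : topologicalType)
    (phi : X -> R) (F : X -> V) :
  continuous phi -> continuous F -> continuous (fun x => (phi x)%:C%C *: F x).
Proof.
move=> cphi cF x; apply/cvg_rnormP => e e0.
have a0 : 0 < `|phi x| + 1 by rewrite ltr_wpDl.
have b0 : 0 < rnorm (F x) + 1 by rewrite ltr_wpDl// rnorm_ge0.
have h1 : \forall y \near x, rnorm (F x - F y) < e / 2 / (`|phi x| + 1).
  have := cF x => /cvg_rnormP; apply; by rewrite !divr_gt0.
have h2 : \forall y \near x, `|phi x - phi y| < e / 2 / (rnorm (F x) + 1).
  have := cphi x => /cvgrPdist_lt; apply; by rewrite !divr_gt0.
have h3 : \forall y \near x, rnorm (F x - F y) < 1.
  by have := cF x => /cvg_rnormP; apply.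
apply: filterS3 h1 h2 h3 => y hy1 hy2 hy3.
have -> : (phi x)%:C%C *: F x - (phi y)%:C%C *: F y =
    (phi x)%:C%C *: (F x - F y) + (phi x - phi y)%:C%C *: F y.
  by rewrite scalerBr rmorphB scalerBl addrA subrK.
apply: le_lt_trans (ler_rnormD _ _) _; rewrite !rnormZr.
have h4 : rnorm (F y) <= rnorm (F x) + 1.
  have := ler_rdistD (F x) (F y) 0; rewrite !subr0 rdistC; lra.
have h5 : `|phi x| * rnorm (F x - F y) <= e / 2.
  apply: le_trans (ler_wpM2l (normr_ge0 _) (ltW hy1)) _.
  rewrite mulrCA; apply: ler_piMr; first by rewrite ltW// divr_gt0.
  by rewrite ler_pdivrMr// mul1r lerDl.
have h6 : `|phi x - phi y| * rnorm (F y) < e / 2.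
  apply: (@le_lt_trans _ _ (`|phi x - phi y| * (rnorm (F x) + 1))).
    by rewrite ler_wpM2l.
  by rewrite -ltr_pdivlMr.
lra.
Qed.

Lemma Int_le (R : realType) (G : topGroupType) (hG : hausdorff_space G)
    (mu : {measure set (borel G) -> \bar R})
    (mu_fin : forall K : set G, compact K -> (mu K < +oo)%E) (f g : G -> R) :
  cc_fun f -> cc_fun g -> (forall x, f x <= g x) -> Int mu f <= Int mu g.
Proof.
move=> cf cg fg; apply: le_Rintegral => //; exact: cc_integrable.
Qed.

(** The partition is fine for both variables at once, so the same tags serve in the outer and the
    inner integral, and the approximating sum is the given quadratic form evaluated at the
    volumes. *)
Lemma kernel_positive (R : realType) (G : topGroupType) (hG : hausdorff_space G)
    (mu : {measure set (borel G) -> \bar R})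
    (mu_fin : forall K : set G, compact K -> (mu K < +oo)%E)
    (N : G * G -> R) (C : set G) :
  continuous N -> compact C -> (forall x y, N (x, y) != 0 -> C x /\ C y) ->
  (forall n (x : 'I_n -> G) (a : 'I_n -> R), (forall i, 0 <= a i) ->
     0 <= \sum_(i < n) \sum_(j < n) a i * a j * N (x i, x j)) ->
  0 <= Int mu (fun x => Int mu (fun y => N (x, y))).
Proof.
move=> cN cC NC N_pos.
have N'c := continuous_swap cN; set N' := fun p : G * G => N (p.2, p.1) in N'c.
have NC1 x : forall y, N (x, y) != 0 -> C y by move=> y /NC[].
have NC2 x : forall y, N' (x, y) != 0 -> C y by move=> y /NC[].
have sl x : cc_fun (fun y => N (x, y)) by exact: cc_fun_slice cN cC (NC1 x).
have par := cc_fun_param hG mu_fin cN cC cC NC.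
have v0 : 0 <= vol mu C by exact: vol_ge0.
apply/ler_addgt0Pl => d d0.
pose e := d / (2 * vol mu C ^+ 2 + 1).
have v1 : 0 < 2 * vol mu C ^+ 2 + 1 by rewrite ltr_wpDl// mulr_ge0// sqr_ge0.
have e0 : 0 < e by rewrite divr_gt0.
have [n [E [x [hE he]]]] := @compact_partition G hG C
    (fun x0 x => (forall y, `|N (x, y) - N (x0, y)| <= e * \1_C y) /\
                 (forall y, `|N' (x, y) - N' (x0, y)| <= e * \1_C y)) cC
    (fun x0 _ => nbhsI (Int_param_close cN cC e0 (filterE _ NC1))
                       (Int_param_close N'c cC e0 (filterE _ NC2))).
have h1 : `|Int mu (fun x => Int mu (fun y => N (x, y))) -
    \sum_(i < n) vol mu (E i) * Int mu (fun y => N (x i, y))| <=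
    e * vol mu C * vol mu C.
  apply: (Int_partition hG mu_fin (cc_integrable hG mu_fin par) cC _ _ hE).
  - move=> z; apply: contraNP => nC; apply/eqP.
    rewrite (_ : (fun y => _) = cst 0) ?Rintegral_cst ?mul0r//.
    by apply/funext => y; apply/eqP; apply: contrapT => /negP /NC[].
  - by rewrite mulr_ge0// ltW.
  - by move=> i z Ez; apply: Int_dist_le => // y; exact: (he i z Ez).1.
have h2 i : `|Int mu (fun y => N (x i, y)) -
    \sum_(j < n) vol mu (E j) * N (x i, x j)| <= e * vol mu C.
  apply: (Int_partition hG mu_fin (cc_integrable hG mu_fin (sl (x i))) cC _ _ hE) => //.
  - exact: NC1.
  - exact: ltW.
  - move=> j z Ez; have := (he j z Ez).2 (x i).
    by rewrite indicE mem_set ?mulr1//; exact: mp_in hE i.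
have h3 : `|\sum_(i < n) vol mu (E i) * Int mu (fun y => N (x i, y)) -
    \sum_(i < n) \sum_(j < n) vol mu (E i) * vol mu (E j) * N (x i, x j)| <=
    e * vol mu C * vol mu C.
  rewrite -sumrB; apply: le_trans (ler_norm_sum _ _ _) _.
  have -> : e * vol mu C * vol mu C = \sum_(i < n) vol mu (E i) * (e * vol mu C).
    rewrite -mulr_suml mulrC; congr (_ * _).
    rewrite (mp_vol_sum hG mu_fin cC hE (borel_compact hG cC) (@subset_refl _ _)).
    by apply: eq_bigr => i _; rewrite setIidr//; exact: mp_sub hE i.
  apply: ler_sum => i _.
  have -> : \sum_(j < n) vol mu (E i) * vol mu (E j) * N (x i, x j) =
     vol mu (E i) * \sum_(j < n) vol mu (E j) * N (x i, x j).
    by rewrite mulr_sumr; apply: eq_bigr => j _; rewrite mulrA.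
  rewrite -mulrBr normrM ger0_norm ?vol_ge0//.
  by apply: ler_wpM2l; [exact: vol_ge0|exact: h2].
have h4 := N_pos n x (fun i => vol mu (E i)) (fun i => vol_ge0 mu (E i)).
have h5 : 2 * (e * vol mu C * vol mu C) <= d.
  rewrite (_ : 2 * _ = e * (2 * vol mu C ^+ 2)); last by ring.
  rewrite /e mulrAC ler_pdivrMr// ler_wpM2l ?(ltW d0)//; lra.
move: h1 h3 h4; rewrite !ler_distl.
set A := Int mu _; set S1 := \sum_(i < n) _; set S2 := \sum_(i < n) _.
by move=> /andP[? ?] /andP[? ?] ?; lra.
Qed.

Lemma continuous_div_supp (R : realType) (X : topologicalType) (f w : X -> R)
    (K : set X) :
  continuous f -> continuous w -> closed K -> (forall x, f x != 0 -> K x) ->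
  (forall x, K x -> w x != 0) -> continuous (fun x => f x / w x).
Proof.
move=> cf cw clK fK wK x; have [Kx|nKx] := pselect (K x).
  apply: cvgM; first exact: cf.
  by apply: cvgV; [exact: wK|exact: cw].
have f0 y : ~ K y -> f y = 0.
  by move=> nKy; apply/eqP; apply: contrapT => /negP /fK.
rewrite /continuous_at f0// mul0r; apply: cvg_near_cst.
apply: filterS (open_nbhs_nbhs (conj (closed_openC clK) nKx)) => y nKy.
by rewrite f0// mul0r.
Qed.

(** * The integrated form as an iterated integral *)

Section Induction.
Variables (R : realType) (G : topGroupType) (lchG : lch G) (H : closedSubgroup G).
Variables (muG : {measure set (borel G) -> \bar R}) (haarG : left_haar muG).
Variables (DeltaG : G -> R) (modG : modular_function muG DeltaG).
Variable (muH : {measure set (borel (subgroup_type H)) -> \bar R}).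
Hypothesis haarH : left_haar muH.
Variables (DeltaH : subgroup_type H -> R) (modH : modular_function muH DeltaH).
Variables (B : starBundle R G) (bsbB : banach_star_bundle B).
Variables (Y : hilbertType R) (T : starRep (reduction B H) Y).

Local Notation HT := (subgroup_type H).
Let bbB : banach_bundle B := bsb_bundle bsbB.
Let hG : hausdorff_space G := lchG.1.
Let lchH : lch HT := lch_subgroup H lchG.
Let hH : hausdorff_space HT := lchH.1.
Let finG := haar_compact haarG.
Let finH := haar_compact haarH.

Definition half_delta (h : HT) : R :=
  Num.sqrt (DeltaG (val h)) / Num.sqrt (DeltaH h).

Lemma half_delta_gt0 h : 0 < half_delta h.
Proof.
by rewrite divr_gt0// sqrtr_gt0; [exact: modular_gt0 modG _|exact: modular_gt0 modH _].
Qed.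

Lemma half_delta_continuous : continuous half_delta.
Proof.
have cG : continuous (fun h : HT => Num.sqrt (DeltaG (val h))).
  apply: continuous_compT (@sqrt_continuous R).
  apply: continuous_compT (modular_continuous lchG haarG modG).
  exact: subgroup_val_continuous.
have cH : continuous (fun h : HT => Num.sqrt (DeltaH h)).
  apply: continuous_compT (@sqrt_continuous R).
  exact: (modular_continuous lchH haarH modH).
apply: continuous_mulR => //; apply: continuous_invR => // h.
by rewrite gt_eqF// sqrtr_gt0; exact: modular_gt0 modH _.
Qed.

Lemma half_deltaM h k : half_delta (h * k)%g = half_delta h * half_delta k.
Proof.
have g0 x : 0 <= DeltaG x by rewrite ltW//; exact: modular_gt0 modG x.
have h0 x : 0 <= DeltaH x by rewrite ltW//; exact: modular_gt0 modH x.
rewrite /half_delta (modularM lchG haarG modG) (modularM lchH haarH modH).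
by rewrite !sqrtrM// invfM mulrACA.
Qed.

Lemma half_delta_sqr h : half_delta h ^+ 2 = DeltaG (val h) / DeltaH h.
Proof.
by rewrite exprMn exprVn !sqr_sqrtr// ltW//; [exact: modular_gt0 modH _|exact: modular_gt0 modG _].
Qed.

Section Convolution.
Variables (f : forall t, B t) (ccf : Cc f) (xi : Y).

Local Notation K := (closure [set x | f x != 0]).
Let cK : compact K := ccf.2.
Let fK x : f x != 0 -> K x.
Proof. by move=> h; exact: subset_closure. Qed.
Let f_cont : continuous (fun x => in_total (f x)) := ccf.1.

Definition pair_elt (s t : G) : totalSpace B :=
  mulT (starT (in_total (f s))) (in_total (f t)).

Definition pair_op (s t : G) : Y := opT T (pair_elt s t) xi.

Lemma bmul0r (s t : G) (a : B s) : bmul a (0 : B t) = 0.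
Proof.
have := bmul_linearr bsbB a (-1) (0 : B t) 0.
by rewrite scaler0 addr0 scaleN1r addNr.
Qed.

Lemma bmul0l (s t : G) (b : B t) : bmul (0 : B s) b = 0.
Proof.
have := bmul_linearl bsbB b (-1) (0 : B s) 0.
by rewrite scaler0 addr0 scaleN1r addNr.
Qed.

Lemma bstar0 (t : G) : bstar (0 : B t) = 0.
Proof.
have := bstar_conj_linear bsbB (-1) (0 : B t) 0.
by rewrite scaler0 addr0 rmorphN rmorph1 scaleN1r addNr.
Qed.

Lemma pair_op_supp s t : pair_op s t != 0 -> K s /\ K t.
Proof.
move=> h; split; apply: fK; apply: contraNneq h => f0;
  rewrite /pair_op /pair_elt /mulT /starT /= f0.
  by rewrite bstar0 bmul0l opT_zero.
by rewrite bmul0r opT_zero.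
Qed.

Lemma pair_elt_continuous (X : topologicalType) (p q : X -> G) :
  continuous p -> continuous q -> continuous (fun x => pair_elt (p x) (q x)).
Proof.
move=> cp cq; apply: (mulT_continuous bsbB).
  by apply: (starT_continuous bsbB); exact: continuous_compT cp f_cont.
exact: continuous_compT cq f_cont.
Qed.

Lemma pair_op_continuous (X : topologicalType) (p q : X -> G) :
  continuous p -> continuous q -> (forall x, subgroup_set H ((p x)^-1 * q x)%g) ->
  continuous (fun x => pair_op (p x) (q x)).
Proof.
move=> cp cq hpq; apply: (opT_strong_continuous bsbB) => //.
exact: pair_elt_continuous.
Qed.

Section Conv.
Variable h : HT.

Let conv_fun (s : G) : B (val h) :=
  fib (val h) (in_total (bmul (inv_section DeltaG f s) (f (s^-1 * val h)%g))).

Let conv_val : B (val h) := convolution muG (inv_section DeltaG f) f (val h).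

Let inv_sectionE s : in_total (inv_section DeltaG f s) =
  scaleT ((DeltaG s)^-1)%:C%C (starT (in_total (f (s^-1)%g))).
Proof.
rewrite /inv_section.
have e : in_total (fib s (in_total (bstar (f (s^-1)%g)))) = starT (in_total (f (s^-1)%g)).
  by rewrite in_totalK// /proj/= invgK.
rewrite -e; reflexivity.
Qed.

Let proj_conv s :
  proj (in_total (bmul (inv_section DeltaG f s) (f (s^-1 * val h)%g))) = val h.
Proof. by rewrite /proj/= mulgA mulgV mul1g. Qed.

Let opT_conv s : opT T (in_total (conv_fun s)) xi =
  ((DeltaG s)^-1)%:C%C *: pair_op (s^-1)%g (s^-1 * val h)%g.
Proof.
rewrite /conv_fun in_totalK ?proj_conv//.
rewrite -[in_total (bmul _ _)]/(mulT (in_total (inv_section DeltaG f s))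
  (in_total (f (s^-1 * val h)%g))).
rewrite inv_sectionE /pair_op /pair_elt.
rewrite /scaleT /mulT /=.
have bl := bmul_linearl bsbB (f (s^-1 * val h)%g) ((DeltaG s)^-1)%:C%C (bstar (f (s^-1)%g)) 0.
rewrite !addr0 bmul0l addr0 in bl.
by rewrite bl -[X in in_total X]addr0 opT_linear opT_zero addr0.
Qed.

Let inv_continuous : continuous (fun s : G => (s^-1)%g).
Proof. exact: invg_continuous. Qed.

Let conv_fun_continuous : continuous conv_fun.
Proof.
apply: (fib_continuous bbB) => [|s]; last exact: proj_conv.
apply: (mulT_continuous bsbB (P := fun s => in_total (inv_section DeltaG f s))
  (Q := fun s => in_total (f (s^-1 * val h)%g))).
  move=> s; apply: (section_scale_continuous bbB
    (g := fun s => fib s (in_total (bstar (f (s^-1)%g)))));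
    last exact: (modular_inv_continuous lchG haarG modG).
  have e t : in_total (fib t (in_total (bstar (f (t^-1)%g)))) = starT (in_total (f (t^-1)%g)).
    by rewrite in_totalK// /proj/= invgK.
  rewrite e; under eq_fun do rewrite e.
  have cst : continuous (fun t => starT (in_total (f (t^-1)%g))).
    by apply: (starT_continuous bsbB); exact: continuous_compT inv_continuous f_cont.
  exact: (cst s).
apply: (continuous_compT (f := fun s : G => (s^-1 * val h)%g) _ f_cont).
by apply: continuous_mulg; [exact: inv_continuous|move=> s; exact: cvg_cst].
Qed.

Let conv_fun_supp s : ~ [set (x^-1)%g | x in K] s -> conv_fun s = 0.
Proof.
move=> nK; have f0 : f (s^-1)%g = 0.
  apply/eqP; apply: contrapT => /negP /fK Ks.
  by apply: nK; exists (s^-1)%g; rewrite ?invgK.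
rewrite /conv_fun /inv_section f0 bstar0.
have -> : fib s (in_total (0 : B (s^-1)^-1%g)) = 0.
  by rewrite invgK fibK.
rewrite scaler0 bmul0l.
have -> : val h = (s * (s^-1 * val h))%g by rewrite mulgA mulgV mul1g.
by rewrite mulKg fibK.
Qed.

(** The matrix coefficient of [T] is a bounded functional on the fibre over [h], hence passes under
    the Bochner integral that defines the convolution. *)
Lemma conv_formula (L : R[i] -> R) eta : real_functional L ->
  L (ip eta (opT T (in_total conv_val) xi)) =
  Int muG (fun s => (DeltaG s)^-1 * L (ip eta (pair_op (s^-1)%g (s^-1 * val h)%g))).
Proof.
move=> hL; have cKV := compactV cK.
have [v hv] := bochner_exists hG finG conv_fun_continuous cKV conv_fun_supp.
have hb : is_bochner muG conv_fun conv_val by exact: bochner_of_exists hv.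
have Hh : subgroup_set H (val h) by exact: subgroup_valP.
have [C C0 hC] := opT_fibre_bound bsbB T xi eta Hh.
pose L' (b : B (val h)) := L (ip eta (opT T (in_total b) xi)).
have L'E s : L' (conv_fun s) =
    (DeltaG s)^-1 * L (ip eta (pair_op (s^-1)%g (s^-1 * val h)%g)).
  by rewrite /L' opT_conv ipZr rfZ.
rewrite -[LHS]/(L' conv_val).
rewrite (bochner_functional hG finG (L := L') (C := C) _ _ _ _ hb).
- by congr (Rintegral _ _ _); apply/funext => s; exact: L'E.
- move=> a b; rewrite /L'; have := opT_linear T 1 a b xi.
  by rewrite !scale1r => ->; rewrite ipDr rfD.
- move=> t a; rewrite /L'; have := opT_linear T t%:C%C a 0 xi.
  by rewrite addr0 opT_zero addr0 => ->; rewrite ipZr rfZ.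
- by move=> b; apply: le_trans (rf_le hL _) (hC b).
split.
  have cL' : continuous (fun s => L (ip eta (opT T (in_total (conv_fun s)) xi))).
    apply: (opT_functional_continuous (P := fun s => in_total (conv_fun s))) => //.
    exact: continuous_compT conv_fun_continuous (@in_total_continuous _ _ _ bbB _).
  exact: cL'.
exists [set (x^-1)%g | x in K] => // s h1; apply: contrapT => nK.
by move: h1; rewrite /L' conv_fun_supp// opT_zero ip0r rf0// eqxx.
Qed.

End Conv.
Local Notation KV := [set (z^-1)%g | z in K].
Local Notation KH := ((val : HT -> G) @^-1` [set (x * y)%g | x in KV & y in K]).

Definition conv_op (h : HT) : Y :=
  opT T (in_total (convolution muG (inv_section DeltaG f) f (val h))) xi.

Definition conv_integrand (L : R[i] -> R) (eta : Y) (p : HT * G) : R :=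
  (DeltaG p.2)^-1 * L (ip eta (pair_op (p.2^-1)%g (p.2^-1 * val p.1)%g)).

Lemma conv_pair_continuous :
  continuous (fun p : HT * G => pair_op (p.2^-1)%g (p.2^-1 * val p.1)%g).
Proof.
have c2 : continuous (fun p : HT * G => p.2) by move=> p; exact: cvg_snd.
have c1 : continuous (fun p : HT * G => p.1) by move=> p; exact: cvg_fst.
have ci := continuous_invg c2.
apply: (pair_op_continuous ci).
  apply: (continuous_mulg ci).
  exact: continuous_compT c1 (@subgroup_val_continuous G H).
by move=> p; rewrite mulKg; exact: subgroup_valP.
Qed.

Lemma conv_pair_supp h s : pair_op (s^-1)%g (s^-1 * val h)%g != 0 ->
  KH h /\
  KV s.
Proof.
move=> /pair_op_supp[Ks Kh].
have Ks' : KV s by exists (s^-1)%g; rewrite ?invgK.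
split => //=; exists s => //; exists (s^-1 * val h)%g => //.
by rewrite mulVKg.
Qed.

Lemma conv_integrand_continuous L eta : real_functional L ->
  continuous (conv_integrand L eta).
Proof.
move=> hL; apply: continuous_mulR.
  apply: continuous_compT (modular_inv_continuous lchG haarG modG).
  by move=> p; exact: cvg_snd.
exact: ip_functional_continuous hL conv_pair_continuous.
Qed.

Let L0 := compactV cK.
Let L1 : compact KH :=
  compact_subgroup (compactM L0 cK).

Lemma conv_integrand_supp L eta h s : real_functional L ->
  conv_integrand L eta (h, s) != 0 ->
  KH h /\
  KV s.
Proof.
move=> hL; rewrite /conv_integrand /= => n0; apply: conv_pair_supp.
by apply: contraNneq n0 => ->; rewrite ip0r rf0// mulr0.
Qed.

Lemma conv_opE L eta h : real_functional L ->
  L (ip eta (conv_op h)) = Int muG (fun s => conv_integrand L eta (h, s)).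
Proof. by move=> hL; rewrite /conv_op conv_formula. Qed.

Lemma conv_integrand_cc L eta h : real_functional L ->
  cc_fun (fun s => conv_integrand L eta (h, s)).
Proof.
move=> hL; apply: (cc_fun_slice (F := conv_integrand L eta)
  (@conv_integrand_continuous L eta hL) L0) => s.
by move=> /(conv_integrand_supp hL)[].
Qed.

(** Continuity of the convolution as a section is bypassed. With [eta] the difference of two values,
    [|eta|^2 = <eta, eta>] is by [conv_formula] an integral over a fixed compact set, at most
    [|eta|] times a quantity made small by the tube lemma; one factor [|eta|] cancels. *)
Lemma conv_op_continuous : continuous conv_op.
Proof.
apply: continuous_rnormP => h0 e e0.
pose P (p : HT * G) := pair_op (p.2^-1)%g (p.2^-1 * val p.1)%g.
pose g (p : HT * G) := (DeltaG p.2)^-1 * rnorm (P (h0, p.2) - P p).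
have cg : continuous g.
  apply: continuous_mulR.
    apply: continuous_compT (modular_inv_continuous lchG haarG modG).
    by move=> p; exact: cvg_snd.
  apply: rnorm_continuous => p; apply: cvgB; last exact: conv_pair_continuous.
  have c : continuous (fun p : HT * G => P (h0, p.2)).
    apply: continuous_compT conv_pair_continuous.
    by apply: continuous_pair; [exact: continuous_cst|exact: continuous_snd].
  exact: (c p).
pose v := vol muG (KV : set (borel G)).
have v0 : 0 < v + 1 by rewrite ltr_wpDl// vol_ge0.
have e'0 : 0 < e / (v + 1) by rewrite divr_gt0.
have D0 s : 0 <= (DeltaG s)^-1 by rewrite invr_ge0 ltW//; exact: modular_gt0 modG s.
have hg : \forall h \near h0, forall s, KV s -> g (h, s) < e / (v + 1).
  by apply: tube_lt cg L0 _ => s _; rewrite /g subrr rnorm0 mulr0.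
apply: (@filterS HT _ (nbhs_filter h0) _ _ _ hg) => h {}hg.
have hL := Re_functional R.
pose eta := conv_op h0 - conv_op h.
have h1 : rnorm eta ^+ 2 <= rnorm eta * (e / (v + 1)) * v.
  rewrite -rip_self /rip {2}/eta ipBr (rfB hL) !conv_opE//.
  apply: le_trans (ler_norm _) _.
  apply: (Int_dist_le hG finG _ _ L0); [exact: conv_integrand_cc|exact: conv_integrand_cc|].
  move=> s; rewrite /conv_integrand /= -mulrBr -(rfB hL) -ipBr.
  rewrite normrM (ger0_norm (D0 s)).
  apply: (@le_trans _ _ (rnorm eta * g (h, s))).
    rewrite /g mulrCA; apply: ler_wpM2l => //.
    exact: rip_CS.
  rewrite -mulrA; apply: ler_wpM2l; first exact: rnorm_ge0.
  have [Ls|nLs] := pselect (KV s).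
    by rewrite indicE mem_set// mulr1 ltW// hg.
  rewrite indicE memNset// mulr0 /g.
  have P0 k : P (k, s) = 0.
    by apply/eqP; apply: contrapT => /negP /conv_pair_supp[].
  by rewrite !P0 subrr rnorm0 mulr0.
have [->|n0] := eqVneq (rnorm eta) 0; first by [].
have p : 0 < rnorm eta by rewrite lt_def n0 rnorm_ge0.
rewrite -/eta; have h2 : rnorm eta <= e / (v + 1) * v.
  by rewrite -(ler_pM2l p) -expr2 mulrA.
apply: le_lt_trans h2 _; rewrite mulrAC ltr_pdivrMr//.
by rewrite ltr_pM2l// ltrDl.
Qed.

(** The outer Bochner integral, over [H], is resolved thanks to the continuity of [conv_op], the
    inner one by [conv_opE]. *)
Lemma integrated_formula (L : R[i] -> R) : real_functional L ->
  L (ip xi (integrated_form muH T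
    (p_map DeltaG DeltaH (convolution muG (inv_section DeltaG f) f)) xi)) =
  Int muH (fun h => half_delta h *
    Int muG (fun s => conv_integrand L xi (h, s))).
Proof.
move=> hL.
pose F (h : HT) : Y := (half_delta h)%:C%C *: conv_op h.
have FE h : T h (p_map DeltaG DeltaH (convolution muG (inv_section DeltaG f) f) h) xi = F h.
  rewrite /F /conv_op /p_map -opT_in_total.
  have := opT_linear T (half_delta h)%:C%C
    (convolution muG (inv_section DeltaG f) f (val h)) 0 xi.
  by rewrite addr0 opT_zero addr0.
have cF : continuous F.
  apply: continuous_scaleC; last exact: conv_op_continuous.
  exact: (half_delta_continuous).
have F0 h : ~ KH h -> F h = 0.
  move=> nh; rewrite /F; suff -> : conv_op h = 0 by rewrite scaler0.
  apply: rnorm_eq0; apply/eqP; rewrite -sqrf_eq0; apply/eqP.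
  rewrite -rip_self /rip (conv_opE _ _ (Re_functional R)).
  rewrite (_ : (fun s => _) = cst 0) ?Rintegral_cst ?mul0r//.
  apply/funext => s; apply/eqP; apply: contrapT => /negP.
  by move=> /(conv_integrand_supp (Re_functional R))[].
have [v hv] := bochner_exists hH finH cF L1 F0.
have hb := bochner_of_exists hv.
have -> : integrated_form muH T
    (p_map DeltaG DeltaH (convolution muG (inv_section DeltaG f) f)) xi = bochner muH F.
  by rewrite /integrated_form; congr bochner; apply/funext => h; exact: FE.
rewrite (bochner_functional hH finH (L := fun y => L (ip xi y)) (C := 2 * rnorm xi) _ _ _ _ hb).
- congr (Rintegral _ _ _); apply/funext => h.
  by rewrite /F ipZr rfZ// conv_opE.
- by move=> x y; rewrite ipDr rfD.
- by move=> t x; rewrite ipZr rfZ.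
- by move=> x; rewrite -mulrA; exact: ip_functional_le.
split; first exact: ip_functional_continuous hL cF.
exists KH.
  exact: L1.
move=> h n0; apply: contrapT => nh.
by move: n0; rewrite F0// ip0r rf0// eqxx.
Qed.

End Convolution.

(** * Localization around a point of the bundle *)

Lemma Cc_scale (f : forall t, B t) (phi : G -> R) :
  Cc f -> continuous phi -> Cc (fun t => (phi t)%:C%C *: f t).
Proof.
move=> [cf cK] cphi; split.
  move=> t; apply: (section_scale_continuous bbB); [exact: cf|exact: cphi].
apply: (subclosed_compact _ cK); first exact: closed_closure.
apply: closureS => t; apply: contraNneq => ->; by rewrite scaler0.
Qed.

Lemma pair_op_scale (f : forall t, B t) (phi : G -> R) xi s t :
  pair_op (fun t => (phi t)%:C%C *: f t) xi s t =
  (phi s * phi t)%:C%C *: pair_op f xi s t.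
Proof.
rewrite /pair_op /pair_elt.
have := opT_mull_linear bsbB T (starT (in_total ((phi s)%:C%C *: f s))) (phi t)%:C%C (f t) 0 xi.
rewrite addr0 /mulT /= (bmul0r) opT_zero addr0 => ->.
have := opT_starmul_linear bsbB T (in_total (f t)) (phi s)%:C%C (f s) 0 xi.
rewrite addr0 /mulT /starT /= (bstar0) (bmul0l) opT_zero addr0 => ->.
rewrite scalerA rmorphM mulrC; congr (_ * _ *: _).
by rewrite /= oppr0.
Qed.

Lemma B_positive_unit_fibre_positive :
  B_positive muG DeltaG muH DeltaH T -> unit_fibre_positive T.
Proof.
move=> T_pos; apply/unit_fibre_positiveE => u xi.
apply: cplx_ge0_functional => L hL L_ge0.
set z := L _; apply/ler_addgt0Pl => e' e'0; rewrite addrC.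
pose e := e' / 2; have e0 : 0 < e by rewrite divr_gt0.
have -> : e' = e + e by rewrite /e -splitr.
pose r := proj u.
pose Q (b : B r) := L (ip xi (opT T (mulT (starT (in_total b)) (in_total b)) xi)).
have cQ : continuous Q.
  have ci := @in_total_continuous _ _ _ bbB r.
  apply: (opT_functional_continuous (P := fun b : B r => mulT (starT (in_total b)) (in_total b)) _ _ hL).
    by apply: (mulT_continuous bsbB) => //; exact: (starT_continuous bsbB).
  by move=> b; rewrite /proj/= mulVg; exact: subgroup1.
have Qu : Q (value u) = z by rewrite /Q in_total_value.
have [d d0 hd] : exists2 d : R, 0 < d &
    forall b, rnorm (value u - b) < d -> `|Q (value u) - Q b| < e.
  have := cQ (value u) => /cvgrPdist_lt /(_ e e0).
  by move=> /nbhs_rnormP.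
have d20 : 0 < d / 2 by rewrite divr_gt0.
(* Sections only pass close to [u], at a cost of [e] in the value of [Q]; a second [e] will pay for
   the localization. *)
have [f [ccf fr]] := section_exists bbB lchG (value u) d20.
have Qf : `|z - Q (f r)| < e.
  by rewrite -Qu; apply: hd; rewrite rdistC; apply: le_lt_trans fr _; lra.
pose q (p : G * HT) := L (ip xi (pair_op f xi p.1 (p.1 * val p.2)%g)).
have cq : continuous q.
  apply: ip_functional_continuous => //.
  apply: (pair_op_continuous ccf (@continuous_fst G HT)).
    apply: continuous_mulg; first exact: continuous_fst.
    exact: continuous_compT (@continuous_snd G HT) (@subgroup_val_continuous G H).
  by move=> p; rewrite mulKg; exact: subgroup_valP.
have q1 : q (r, 1%g) = Q (f r) by rewrite /q /= mulg1.
have hlt : q (r, 1%g) < z + (e + e).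
  by rewrite q1; move: Qf; rewrite ltr_distlC => /andP[]; lra.
have hN : nbhs ((r, 1%g) : G * HT) [set p | q p < z + (e + e)].
  exact: (cq (r, 1%g) _ (lt_nbhsl hlt)).
have [[N M] /= [Nr M1] NM] := hN.
have [U U1 UM] := nbhs_subgroup M1.
(* The bump must be so narrow that [s^-1 t] lies in [U] for all [s] and [t] in its support: this
   forces [h] near 1, where [q] stays below [z + 2 e]. *)
have cdiv : continuous (fun p : G * G => (p.1^-1 * p.2)%g).
  apply: continuous_mulg; last exact: continuous_snd.
  by apply: continuous_invg; exact: continuous_fst.
have hU : nbhs ((r, r) : G * G) [set p | U (p.1^-1 * p.2)%g].
  by have := cdiv (r, r); rewrite /continuous_at /= mulVg => cd1; exact: (cd1 _ U1).
have [[N1 N2] /= [N1r N2r] NU] := hU.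
have [phi [cphi phi0 phir [C [cC _ CN hC]]]] := lch_bump R lchG (nbhsI Nr (nbhsI N1r N2r)).
pose g t := (phi t)%:C%C *: f t.
have ccg : Cc g by exact: Cc_scale.
have I_ge0 := L_ge0 _ (T_pos xi g ccg).
rewrite (integrated_formula ccg xi hL) in I_ge0.
pose D (p : HT * G) := (DeltaG p.2)^-1 * (phi (p.2^-1)%g * phi (p.2^-1 * val p.1)%g).
have cinv : continuous (fun p : HT * G => (p.2^-1)%g).
  by apply: continuous_invg; exact: continuous_snd.
have cD : continuous D.
  apply: continuous_mulR.
    exact: continuous_compT (@continuous_snd HT G) (modular_inv_continuous lchG haarG modG).
  apply: continuous_mulR; first exact: continuous_compT cinv cphi.
  apply: continuous_compT cphi; apply: continuous_mulg => //.
  exact: continuous_compT (@continuous_fst HT G) (@subgroup_val_continuous G H).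
pose CV := [set (x^-1)%g | x in C].
have cCV : compact CV by exact: compactV.
pose CH : set HT := val @^-1` [set (x * y)%g | x in CV & y in C].
have cCH : compact CH by apply: compact_subgroup; exact: compactM.
have DC h s : D (h, s) != 0 -> CH h /\ CV s.
  rewrite /D /= => n0.
  have Cs : C (s^-1)%g by apply: hC; apply: contraNneq n0 => ->; rewrite mul0r mulr0.
  have Ch : C (s^-1 * val h)%g by apply: hC; apply: contraNneq n0 => ->; rewrite !mulr0.
  have CVs : CV s by exists (s^-1)%g; rewrite ?invgK.
  split => //; exists s => //; exists (s^-1 * val h)%g => //.
  by rewrite mulVKg.
have Dsl h : cc_fun (fun s => D (h, s)).
  by apply: (cc_fun_slice (F := D) cD cCV) => s /DC[].
have Dpar := cc_fun_param hG finG cD cCH cCV DC.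
pose hd' := half_delta.
have chd : continuous hd' by exact: (half_delta_continuous).
have hd0 h : 0 < hd' h by exact: half_delta_gt0.
have DeltaV0 s : 0 < (DeltaG s)^-1 by rewrite invr_gt0; exact: modular_gt0 modG s.
have D_ge0 h s : 0 <= D (h, s) by rewrite mulr_ge0 ?mulr_ge0// ltW.
(* The nonnegative integrand is positive at [h = 1], [s = r^-1], where the bump takes the value
   1. *)
have c_gt0 : 0 < Int muH (fun h => hd' h * Int muG (fun s => D (h, s))).
  apply: (Int_gt0 lchH haarH (x := 1%g)).
  - exact: cc_funM.
  - by move=> h; rewrite mulr_ge0 ?(ltW (hd0 h))//; exact: Rintegral_ge0.
  - rewrite mulr_gt0//; apply: (Int_gt0 lchG haarG (x := (r^-1)%g)) => //.
    by rewrite /D /= mulg1 invgK phir !mulr1.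
(* Wherever the bump factors are nonzero, [q] is below [z + 2 e]; so the nonnegative integral
   attached to [g] is at most this multiple of a positive mass. *)
suff h : 0 <= (z + (e + e)) * Int muH (fun h => hd' h * Int muG (fun s => D (h, s))).
  by move: h; rewrite pmulr_lge0.
apply: le_trans I_ge0 _.
have ccD := cc_funM Dpar chd.
rewrite -(IntZ hH finH _ ccD).
have cc_conv := cc_fun_param hG finG
  (@conv_integrand_continuous _ ccg xi L xi hL)
  (compact_subgroup (compactM (compactV ccg.2) ccg.2)) (compactV ccg.2)
  (fun h s => @conv_integrand_supp _ xi L xi h s hL).
apply: (Int_le hH finH); first exact: cc_funM cc_conv chd.
  exact: cc_funZ.
move=> h; rewrite mulrCA ler_pM2l// -(IntZ hG finG)//.
apply: (Int_le hG finG).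
- by apply: (conv_integrand_cc ccg).

- exact: cc_funZ.
move=> s; rewrite /conv_integrand pair_op_scale ipZr rfZ// [leRHS]mulrCA /D /=.
rewrite ler_pM2l// mulrC.
have [->|n0] := eqVneq (phi (s^-1)%g * phi (s^-1 * val h)%g) 0; first by rewrite !mulr0.
have n1 : phi (s^-1)%g != 0 by apply: contraNneq n0 => ->; rewrite mul0r.
have n2 : phi (s^-1 * val h)%g != 0 by apply: contraNneq n0 => ->; rewrite mulr0.
rewrite ler_pM2r ?lt_def ?n0 ?mulr_ge0//.
have [Ns [N1s _]] := CN _ (hC _ n1).
have [_ [_ N2h]] := CN _ (hC _ n2).
have Uh : U (val h).
  have := NU (_, _) (conj N1s N2h); rewrite /= invgK mulgA mulgV mul1g.
  by [].
have := NM ((s^-1)%g, h) (conj Ns (UM _ Uh)) => /=.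
by rewrite /q /= => /ltW.
Qed.

(** Left translation replaces [s] by [k s], and [(k s)^-1 k = s^-1]. *)
Lemma Int_inv_translate (F : G -> R) (k : G) : cc_fun F ->
  Int muG (fun s => (DeltaG s)^-1 * F (s^-1)%g) =
  DeltaG k * Int muG (fun s => (DeltaG s)^-1 * F (s^-1 * k)%g).
Proof.
move=> ccF.
have cci : cc_fun (fun s => F (s^-1 * k)%g).
  apply: (@cc_fun_comp _ _ _ F (fun s : G => (s^-1 * k)%g) (fun t => (k * t^-1)%g)) => //.
  - by apply: continuous_mulg; [exact: invg_continuous|exact: continuous_cst].
  - by apply: continuous_mulg; [exact: continuous_cst|exact: invg_continuous].
  - by move=> s; rewrite invgM invgK mulVKg.
have cci' := cc_funM cci (modular_inv_continuous lchG haarG modG).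
rewrite -(Int_translate lchG haarG k cci') /=.
have ccV : cc_fun (fun s => (DeltaG s)^-1 * F (s^-1)%g).
  apply: cc_funM; last exact: (modular_inv_continuous lchG haarG modG).
  apply: (@cc_fun_comp _ _ _ F (fun s : G => (s^-1)%g) (fun t => (t^-1)%g)) => //.
  - exact: invg_continuous.
  - exact: invg_continuous.
  - exact: invgK.
have -> : (fun s => (DeltaG (k * s)%g)^-1 * F ((k * s)^-1 * k)%g) =
   (fun s => (DeltaG k)^-1 * ((DeltaG s)^-1 * F (s^-1)%g)).
  apply/funext => s; rewrite (modularM lchG haarG modG) invfM -mulrA.
  by rewrite invgM -mulgA mulVg mulg1.
rewrite (IntZ hG finG)// mulVKf// gt_eqF//; exact: modular_gt0 modG k.
Qed.

(** * Weights constant along cosets *)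

Section Weight.
Variables (phi : G -> R) (C : set G).
Hypothesis cphi : continuous phi.
Hypothesis phi0 : forall x, 0 <= phi x.
Hypothesis cC : compact C.
Hypothesis phiC : forall x, phi x != 0 -> C x.

Definition coset_weight (s : G) : R :=
  Int muH (fun k => (DeltaH k)^-1 * phi (s * (val k)^-1)%g).

Let Wf (p : G * HT) : R := (DeltaH p.2)^-1 * phi (p.1 * (val p.2)^-1)%g.

Let cWf : continuous Wf.
Proof.
apply: continuous_mulR.
  exact: continuous_compT (@continuous_snd G HT) (modular_inv_continuous lchH haarH modH).
apply: continuous_compT cphi; apply: continuous_mulg; first exact: continuous_fst.
apply: continuous_invg.
exact: continuous_compT (@continuous_snd G HT) (@subgroup_val_continuous G H).
Qed.

Let Wf_supp (N : set G) s k : N s -> Wf (s, k) != 0 ->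
  ((val : HT -> G) @^-1` [set (x * y)%g | x in [set (z^-1)%g | z in C] & y in N]) k.
Proof.
rewrite /Wf /= => Ns n0.
have Csk : C (s * (val k)^-1)%g by apply: phiC; apply: contraNneq n0 => ->; rewrite mulr0.
exists (val k * s^-1)%g; last by exists s => //; rewrite mulgVK.
by exists (s * (val k)^-1)%g => //; rewrite invgM invgK.
Qed.

Lemma coset_weight_cc s :
  cc_fun (fun k : HT => (DeltaH k)^-1 * phi (s * (val k)^-1)%g).
Proof.
have cS := compact_subgroup (H := H) (compactM (compactV cC) (@compact_set1 _ s)).
apply: (cc_fun_slice (F := Wf) cWf cS) => k; exact: Wf_supp.
Qed.

Lemma coset_weight_continuous : continuous coset_weight.
Proof.
move=> s; have [N [cN Ns _]] := lch_compact_nbhs R lchG (@filterT _ (nbhs s) _).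
apply: (Int_param_cvg hH finH cWf (compact_subgroup (compactM (compactV cC) cN))).
by apply: filterS Ns => t Nt k; exact: Wf_supp.
Qed.

(** Right translation in [H] produces a modular factor, which the [DeltaH] inside the integrand
    compensates exactly. *)
Lemma coset_weight_invariant s (x : HT) :
  coset_weight (s * val x)%g = coset_weight s.
Proof.
rewrite /coset_weight; have := Int_rtranslate lchH haarH modH (x^-1)%g (coset_weight_cc s).
rewrite /Wf /= (modularV lchH haarH modH) invrK.
have -> : (fun y : HT => (DeltaH (y * x^-1)%g)^-1 * phi (s * (val (y * x^-1)%g)^-1)%g) =
  (fun y => DeltaH x * ((DeltaH y)^-1 * phi (s * val x * (val y)^-1)%g)).
  apply/funext => y; rewrite (modularM lchH haarH modH) (modularV lchH haarH modH).
  rewrite invfM invrK mulrA [_^-1 * DeltaH x]mulrC; congr (_ * phi _).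
  have -> : val (y * x^-1)%g = (val y * (val x)^-1)%g by [].
  by rewrite invgM invgK mulgA.
rewrite (IntZ hH finH); last exact: coset_weight_cc.
by move=> /(mulfI (lt0r_neq0 (modular_gt0 modH x))).
Qed.

Lemma coset_weight_ge0 s : 0 <= coset_weight s.
Proof.
by apply: Rintegral_ge0 => k _; rewrite mulr_ge0// invr_ge0 ltW//; exact: modular_gt0 modH k.
Qed.

Lemma coset_weight_gt0 s : 0 < phi s -> 0 < coset_weight s.
Proof.
move=> ps; apply: (Int_gt0 lchH haarH (x := 1%g)); first exact: coset_weight_cc.
  by move=> k; rewrite mulr_ge0// invr_ge0 ltW//; exact: modular_gt0 modH k.
rewrite (modular1 lchH haarH modH) invr1 mul1r.
have -> : val (1%g : HT) = 1%g by [].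
by rewrite invg1 mulg1.
Qed.

End Weight.

(** * From positivity on cosets to the integrated form *)

Section CosetPositive.
Hypothesis T_pos : coset_positive T.
Variables (f : forall t, B t) (ccf : Cc f) (xi : Y).
Variables (L : R[i] -> R) (hL : real_functional L).
Hypothesis L_ge0 : forall z, 0 <= z -> 0 <= L z.

Local Notation K := (closure [set x | f x != 0]).
Local Notation hd := (half_delta).

Let cK : compact K := ccf.2.
Let chd : continuous hd := half_delta_continuous.
Let hd0 h : 0 < hd h := half_delta_gt0 h.
Let cval : continuous (val : HT -> G) := @subgroup_val_continuous G H.

Definition pair_form (s t : G) : R := L (ip xi (pair_op f xi s t)).

Lemma pair_form_supp s t : pair_form s t != 0 -> K s /\ K t.
Proof.
move=> h; apply: (pair_op_supp (xi := xi)).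
by apply: contraNneq h => h; rewrite /pair_form h ip0r rf0.
Qed.

Lemma pair_form_continuous (X : topologicalType) (p q : X -> G) :
  continuous p -> continuous q -> (forall x, subgroup_set H ((p x)^-1 * q x)%g) ->
  continuous (fun x => pair_form (p x) (q x)).
Proof.
move=> cp cq hpq; apply: ip_functional_continuous => //.
exact: (pair_op_continuous ccf).
Qed.

(** Coset positivity for the elements [f (s x_i)], all over the coset [s H], with the vectors
    [a_i hd (x_i) xi]. The empty family is separate, since [coset_positive] asks for [n > 0]. *)
Lemma pair_form_gram (s : G) n (x : 'I_n -> HT) (a : 'I_n -> R) :
  (forall i, 0 <= a i) ->
  0 <= \sum_(i < n) \sum_(j < n) a i * a j *
    (hd (x i) * hd (x j) * pair_form (s * val (x i))%g (s * val (x j))%g).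
Proof.
move=> a0; case: n x a a0 => [|n] x a a0; first by rewrite big_ord0.
pose c i : R := a i * hd (x i).
pose alpha := [set (s * h)%g | h in H].
have Ha : left_cosets H alpha by exists s.
pose b i : totalSpace B := in_total (f (s * val (x i))%g).
have Hb i : alpha (proj (b i)).
  by exists (val (x i)) => //; exact: subgroup_valP.
have := T_pos Ha (ltn0Sn n) Hb (fun i => (c i)%:C%C *: xi).
move=> /L_ge0; rewrite rf_sum//.
rewrite (eq_bigr (fun i => \sum_(j < n.+1) a i * a j *
    (hd (x i) * hd (x j) * pair_form (s * val (x i))%g (s * val (x j))%g))) // => i _.
rewrite rf_sum//; apply: eq_bigr => j _.
rewrite rep_atE opTZ ipZr rfZ// ipZlr rfZ//.
by rewrite /pair_form /pair_op /pair_elt /b /c; ring.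
Qed.

Lemma coset_kernel_ge0 (s : G) :
  0 <= Int muH (fun k => Int muH (fun h =>
    hd k * hd h * pair_form (s * val k)%g (s * val h)%g)).
Proof.
pose N (p : HT * HT) := hd p.1 * hd p.2 * pair_form (s * val p.1)%g (s * val p.2)%g.
have c1 : continuous (fun p : HT * HT => (s * val p.1)%g).
  apply: continuous_mulg; first exact: continuous_cst.
  exact: continuous_compT (@continuous_fst HT HT) cval.
have c2 : continuous (fun p : HT * HT => (s * val p.2)%g).
  apply: continuous_mulg; first exact: continuous_cst.
  exact: continuous_compT (@continuous_snd HT HT) cval.
have cN : continuous N.
  apply: continuous_mulR.
    apply: continuous_mulR.
      exact: continuous_compT (@continuous_fst HT HT) chd.
    exact: continuous_compT (@continuous_snd HT HT) chd.
  apply: pair_form_continuous => // p.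
  rewrite invgM -mulgA mulKg; apply: subgroupM; last exact: subgroup_valP.
  by apply: subgroupV; exact: subgroup_valP.
have cC := compact_subgroup (H := H) (compactM (@compact_set1 _ (s^-1)%g) cK).
have KC k : K (s * val k)%g ->
    ((val : HT -> G) @^-1` [set (x * y)%g | x in [set (s^-1)%g] & y in K]) k.
  by move=> Kk; exists (s^-1)%g => //; exists (s * val k)%g => //; rewrite mulKg.
apply: (kernel_positive hH finH cN cC) => [k h n0|n x a a0]; last exact: pair_form_gram.
have : pair_form (s * val k)%g (s * val h)%g != 0.
  by apply: contraNneq n0; rewrite /N /= => ->; rewrite mulr0.
by move=> /pair_form_supp[Kk Kh]; split; exact: KC.
Qed.

Definition fibre_integral (s : G) : R :=
  Int muH (fun h => hd h * pair_form s (s * val h)%g).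

Let F1 (p : G * HT) : R := hd p.2 * pair_form p.1 (p.1 * val p.2)%g.

Let cF1 : continuous F1.
Proof.
apply: continuous_mulR; first exact: continuous_compT (@continuous_snd G HT) chd.
apply: pair_form_continuous; first exact: continuous_fst.
  apply: continuous_mulg; first exact: continuous_fst.
  exact: continuous_compT (@continuous_snd G HT) cval.
by move=> p; rewrite mulKg; exact: subgroup_valP.
Qed.

Let KV := [set (z^-1)%g | z in K].
Let cKV : compact KV := compactV cK.
Let cKH := compact_subgroup (H := H) (compactM cKV cK).

Let F1_supp s h : F1 (s, h) != 0 -> K s /\
  ((val : HT -> G) @^-1` [set (x * y)%g | x in KV & y in K]) h.
Proof.
rewrite /F1 /= => n0; have : pair_form s (s * val h)%g != 0.
  by apply: contraNneq n0 => ->; rewrite mulr0.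
move=> /pair_form_supp[Ks Kh]; split => //.
exists (s^-1)%g; first by exists s.
by exists (s * val h)%g => //; rewrite mulKg.
Qed.

Lemma fibre_integral_cc : cc_fun fibre_integral.
Proof. exact: (cc_fun_param hH finH cF1 cK cKH F1_supp). Qed.

Lemma fibre_integral_supp s : fibre_integral s != 0 -> K s.
Proof.
apply: contraNP => nK; apply/eqP; rewrite /fibre_integral.
rewrite (_ : (fun h => _) = cst 0) ?Rintegral_cst ?mul0r//.
apply/funext => h; apply/eqP; apply: contrapT => /negP n0.
by have [] := @F1_supp s h n0.
Qed.

(** Substituting [k^-1 h] for [h] divides [hd h] by [hd k], so multiplication by [hd k ^+ 2] leaves
    the symmetric weight [hd k * hd h]; the square root in [hd] is what makes the kernel
    symmetric. *)
Lemma fibre_integral_translate s (k : HT) :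
  hd k ^+ 2 * fibre_integral (s * val k)%g =
  Int muH (fun h => hd k * hd h * pair_form (s * val k)%g (s * val h)%g).
Proof.
rewrite /fibre_integral.
have ccs : cc_fun (fun h => F1 ((s * val k)%g, h)).
  by apply: (cc_fun_slice (F := F1) cF1 cKH) => h /F1_supp[].
have := Int_translate lchH haarH (k^-1)%g ccs; rewrite /F1 /=.
have vV h : val (k^-1 * h)%g = ((val k)^-1 * val h)%g by [].
have -> : (fun y : HT => hd (k^-1 * y)%g *
      pair_form (s * val k)%g (s * val k * val (k^-1 * y)%g)%g) =
   (fun y => (hd k)^-1 * (hd y * pair_form (s * val k)%g (s * val y)%g)).
  apply/funext => y.
  have hdV : hd (k^-1)%g = (hd k)^-1.
    apply: (mulIf (lt0r_neq0 (hd0 k))).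
    rewrite -(half_deltaM) mulVg mulVf ?lt0r_neq0//.
    rewrite /half_delta (_ : val (1%g : HT) = 1%g)//.
    by rewrite (modular1 lchG haarG modG) (modular1 lchH haarH modH) sqrtr1 divr1.
  rewrite (half_deltaM) hdV vV -mulrA.
  by rewrite -mulgA mulVKg.
move=> <-.
have cct : cc_fun (fun y : HT => hd y * pair_form (s * val k)%g (s * val y)%g).
  apply: cc_funM => //; split.
    apply: pair_form_continuous; first exact: continuous_cst.
      by apply: continuous_mulg; [exact: continuous_cst|exact: cval].
    move=> h; rewrite invgM -mulgA mulKg; apply: subgroupM; last exact: subgroup_valP.
    by apply: subgroupV; exact: subgroup_valP.
  exists ((val : HT -> G) @^-1` [set (x * y)%g | x in [set (s^-1)%g] & y in K]).
    by apply: compact_subgroup; exact: (compactM (@compact_set1 _ (s^-1)%g) cK).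
  move=> h /pair_form_supp[_ Kh]; exists (s^-1)%g => //.
  by exists (s * val h)%g => //; rewrite mulKg.
rewrite (IntZ hH finH)// expr2 -mulrA mulVKf ?lt0r_neq0//.
rewrite -(IntZ hH finH)//; congr (Rintegral _ _ _); apply/funext => h.
by rewrite mulrA.
Qed.

Lemma integrated_form_ge0 :
  0 <= Int muH (fun h => hd h * Int muG (fun s => conv_integrand f xi L xi (h, s))).
Proof.
have [phi [cphi phi0 phiK [C cC phiC]]] := lch_bump_compact R lchG cK.
pose W := coset_weight phi.
have cW : continuous W by exact: (coset_weight_continuous cphi cC phiC).
have W_gt0 s : K s -> 0 < W s.
  by move=> Ks; apply: (coset_weight_gt0 cphi phi0 cC phiC); exact: phiK.
have W_ge0 s : 0 <= W s by apply: (coset_weight_ge0 phi0).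
have clK : closed K by exact: closed_closure.
(* [W] is positive on [K], which contains the support of the numerator, so the quotient is
   continuous although [W] may vanish elsewhere. *)
pose Phi s := fibre_integral s / W s.
have Phi_supp s : Phi s != 0 -> K s.
  by move=> n0; apply: fibre_integral_supp; apply: contraNneq n0 => h; rewrite /Phi h mul0r.
have cPhi : continuous Phi.
  apply: (continuous_div_supp fibre_integral_cc.1 cW clK fibre_integral_supp).
  by move=> s /W_gt0; rewrite lt0r => /andP[].
have PhiE s : fibre_integral s = W s * Phi s.
  have [Ks|nKs] := pselect (K s); first by rewrite /Phi mulrC divfK// gt_eqF// W_gt0.
  rewrite /Phi (_ : fibre_integral s = 0) ?mul0r ?mulr0//.
  by apply/eqP; apply: contrapT => /negP /fibre_integral_supp.
have iV : continuous (fun s : G => (s^-1)%g) by exact: invg_continuous.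
have cD := modular_inv_continuous lchG haarG modG.
have D_ge0 s : 0 <= (DeltaG s)^-1 by rewrite invr_ge0 ltW//; exact: modular_gt0 modG s.
have cCV : compact [set (z^-1)%g | z in C] by exact: compactV.
have E1 : Int muH (fun h => hd h * Int muG (fun s => conv_integrand f xi L xi (h, s))) =
    Int muG (fun s => (DeltaG s)^-1 * fibre_integral (s^-1)%g).
  pose F (p : HT * G) := hd p.1 * conv_integrand f xi L xi p.
  have cF : continuous F.
    apply: continuous_mulR; first exact: continuous_compT (@continuous_fst HT G) chd.
    exact: (conv_integrand_continuous ccf).
  have FS h s : F (h, s) != 0 ->
      ((val : HT -> G) @^-1` [set (x * y)%g | x in KV & y in K]) h /\ KV s.
    move=> n0; apply: (conv_integrand_supp (xi := xi) (L := L) (eta := xi)) => //.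
    by apply: contraNneq n0; rewrite /F => ->; rewrite mulr0.
  have := Int_fubini hH hG finH finG cF cKH cKV FS; rewrite /F /=.
  have -> : (fun x : HT => Int muG (fun y => hd x * conv_integrand f xi L xi (x, y))) =
      (fun h => hd h * Int muG (fun s => conv_integrand f xi L xi (h, s))).
    apply/funext => h; rewrite (IntZ hG finG)//.
    exact: (conv_integrand_cc ccf).
  move=> ->; congr (Rintegral _ _ _); apply/funext => s.
  rewrite /fibre_integral -(IntZ hH finH); last first.
    by apply: (cc_fun_slice (F := F1) cF1 cKH) => h /F1_supp[].
  by congr (Rintegral _ _ _); apply/funext => h; rewrite /conv_integrand /= mulrCA.
(* Write [fibre_integral] as [W * Phi], expand [W], exchange the integrals and translate by [k]. The
   factor [DeltaG k] thus gained joins the inverse of [DeltaH k] to form [hd k ^+ 2]. *)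
have E2 : Int muG (fun s => (DeltaG s)^-1 * fibre_integral (s^-1)%g) =
    Int muH (fun k => hd k ^+ 2 *
      Int muG (fun s => (DeltaG s)^-1 * (phi (s^-1)%g * Phi (s^-1 * val k)%g))).
  pose F (p : G * HT) := (DeltaG p.1)^-1 *
    ((DeltaH p.2)^-1 * (phi (p.1^-1 * (val p.2)^-1)%g * Phi (p.1^-1)%g)).
  have c1 : continuous (fun p : G * HT => p.1) by exact: continuous_fst.
  have c2 : continuous (fun p : G * HT => p.2) by exact: continuous_snd.
  have c1V : continuous (fun p : G * HT => (p.1^-1)%g) by exact: continuous_compT c1 iV.
  have c2V : continuous (fun p : G * HT => ((val p.2)^-1)%g).
    by apply: continuous_invg; exact: continuous_compT c2 cval.
  have cF : continuous F.
    apply: continuous_mulR; first exact: continuous_compT c1 cD.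
    apply: continuous_mulR.
      exact: continuous_compT c2 (modular_inv_continuous lchH haarH modH).
    apply: continuous_mulR; last exact: continuous_compT c1V cPhi.
    by apply: continuous_compT cphi; exact: continuous_mulg.
  pose S2 := (val : HT -> G) @^-1` [set (x * y)%g | x in [set (z^-1)%g | z in C] & y in K].
  have cS2 : compact S2 by exact: compact_subgroup (compactM cCV cK).
  have FS s k : F (s, k) != 0 -> KV s /\ S2 k.
    rewrite /F /= => n0.
    have Ks : K (s^-1)%g by apply: Phi_supp; apply: contraNneq n0 => ->; rewrite !mulr0.
    have Ck : C (s^-1 * (val k)^-1)%g.
      by apply: phiC; apply: contraNneq n0 => ->; rewrite mul0r !mulr0.
    split; first by exists (s^-1)%g; rewrite ?invgK.
    exists (val k * s)%g; last by exists (s^-1)%g => //; rewrite mulgK.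
    by exists (s^-1 * (val k)^-1)%g => //; rewrite invgM !invgK.
  have := Int_fubini hG hH finG finH cF cKV cS2 FS; rewrite /F /=.
  have -> : (fun x : G => Int muH (fun y => (DeltaG x)^-1 *
      ((DeltaH y)^-1 * (phi (x^-1 * (val y)^-1)%g * Phi (x^-1)%g)))) =
      (fun s => (DeltaG s)^-1 * fibre_integral (s^-1)%g).
    apply/funext => s; rewrite PhiE /W /coset_weight.
    rewrite (_ : (fun y => _) = (fun y : HT => ((DeltaG s)^-1 * Phi (s^-1)%g) *
       ((DeltaH y)^-1 * phi (s^-1 * (val y)^-1)%g))); last first.
      by apply/funext => y; ring.
    rewrite (IntZ hH finH); first by ring.
    exact: (coset_weight_cc cphi cC phiC).
  move=> ->; congr (Rintegral _ _ _); apply/funext => k.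
  have ccF : cc_fun (fun s => phi (s * (val k)^-1)%g * Phi s).
    apply: cc_funM; first by split => //; exists K.
    by apply: continuous_compT cphi; apply: continuous_mulg;
      [move=> s; exact: cvg_id|exact: continuous_cst].
  rewrite (_ : (fun s => _) = (fun s : G => (DeltaH k)^-1 *
     ((DeltaG s)^-1 * (phi (s^-1 * (val k)^-1)%g * Phi (s^-1)%g)))); last first.
    by apply/funext => s; rewrite mulrCA.
  have ccV : cc_fun (fun s => (DeltaG s)^-1 * (phi (s^-1 * (val k)^-1)%g * Phi (s^-1)%g)).
    apply: cc_funM => //.
    apply: (@cc_fun_comp _ _ _ (fun s => phi (s * (val k)^-1)%g * Phi s)
      (fun s : G => (s^-1)%g) (fun t => (t^-1)%g)) => //.
    exact: invgK.
  rewrite (IntZ hG finG)//.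
  rewrite (Int_inv_translate (val k) ccF) mulrA half_delta_sqr.
  rewrite [X in X * _]mulrC; congr (_ * Rintegral _ _ _); apply/funext => s.
  by rewrite mulgK.
(* The integrals are exchanged back, so that for fixed [s] the integral over [H] runs along the
   single coset of [s^-1]. *)
have E3 : Int muH (fun k => hd k ^+ 2 *
      Int muG (fun s => (DeltaG s)^-1 * (phi (s^-1)%g * Phi (s^-1 * val k)%g))) =
    Int muG (fun s => (DeltaG s)^-1 * phi (s^-1)%g *
      Int muH (fun k => hd k ^+ 2 * Phi (s^-1 * val k)%g)).
  pose F (p : HT * G) := hd p.1 ^+ 2 *
    ((DeltaG p.2)^-1 * (phi (p.2^-1)%g * Phi (p.2^-1 * val p.1)%g)).
  have c1 : continuous (fun p : HT * G => p.1) by exact: continuous_fst.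
  have c2 : continuous (fun p : HT * G => p.2) by exact: continuous_snd.
  have c2V : continuous (fun p : HT * G => (p.2^-1)%g) by exact: continuous_compT c2 iV.
  have cF : continuous F.
    apply: continuous_mulR.
      by apply: continuous_mulR; exact: continuous_compT c1 chd.
    apply: continuous_mulR; first exact: continuous_compT c2 cD.
    apply: continuous_mulR; first exact: continuous_compT c2V cphi.
    apply: continuous_compT cPhi; apply: continuous_mulg => //.
    exact: continuous_compT c1 cval.
  pose S1 := (val : HT -> G) @^-1` [set (x * y)%g | x in [set (z^-1)%g | z in C] & y in K].
  have cS1 : compact S1 by exact: compact_subgroup (compactM cCV cK).
  have FS k s : F (k, s) != 0 -> S1 k /\ [set (z^-1)%g | z in C] s.
    rewrite /F /= => n0.
    have Cs : C (s^-1)%g.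
      by apply: phiC; apply: contraNneq n0 => ->; rewrite mul0r !mulr0.
    have Kk : K (s^-1 * val k)%g.
      by apply: Phi_supp; apply: contraNneq n0 => ->; rewrite !mulr0.
    have Cs' : [set (z^-1)%g | z in C] s by exists (s^-1)%g; rewrite ?invgK.
    split => //; exists s => //; exists (s^-1 * val k)%g => //.
    by rewrite mulVKg.
  have slG (k : HT) : cc_fun (fun s => (DeltaG s)^-1 * (phi (s^-1)%g * Phi (s^-1 * val k)%g)).
    apply: cc_funM => //.
    rewrite (_ : (fun s => _) = (fun s : G => Phi (s^-1 * val k)%g * phi (s^-1)%g)); last first.
      by apply/funext => s; rewrite mulrC.
    apply: cc_funM.
      apply: (@cc_fun_comp _ _ _ phi (fun s : G => (s^-1)%g) (fun t => (t^-1)%g)) => //;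
        first exact: invgK.
      by split => //; exists C.
    apply: continuous_compT cPhi; apply: continuous_mulg => //; exact: continuous_cst.
  have slH (s : G) : cc_fun (fun k : HT => hd k ^+ 2 * Phi (s^-1 * val k)%g).
    apply: cc_funM; last by apply: continuous_mulR.
    split.
      apply: continuous_compT cPhi; apply: continuous_mulg => //; exact: continuous_cst.
    exists ((val : HT -> G) @^-1` [set (x * y)%g | x in [set s] & y in K]).
      by apply: compact_subgroup; exact: (compactM (@compact_set1 _ s) cK).
    move=> k /Phi_supp Kk; exists s => //; exists (s^-1 * val k)%g => //.
    by rewrite mulVKg.
  have := Int_fubini hH hG finH finG cF cS1 cCV FS; rewrite /F /=.
  have -> : (fun x : HT => Int muG (fun y => hd x ^+ 2 *
      ((DeltaG y)^-1 * (phi (y^-1)%g * Phi (y^-1 * val x)%g)))) =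
      (fun k => hd k ^+ 2 *
        Int muG (fun s => (DeltaG s)^-1 * (phi (s^-1)%g * Phi (s^-1 * val k)%g))).
    by apply/funext => k; rewrite (IntZ hG finG).
  move=> ->; congr (Rintegral _ _ _); apply/funext => s.
  rewrite -(IntZ hH finH)//; congr (Rintegral _ _ _); apply/funext => k.
  by ring.
rewrite E1 E2 E3; apply: Rintegral_ge0 => s _.
rewrite mulr_ge0 ?mulr_ge0//.
(* [W] is constant along the coset and leaves the integral over [k]; what remains is the kernel
   integral that is nonnegative by [coset_kernel_ge0]. *)
have -> : (fun k : HT => hd k ^+ 2 * Phi (s^-1 * val k)%g) =
    (fun k => (W (s^-1)%g)^-1 * Int muH (fun h =>
       hd k * hd h * pair_form (s^-1 * val k)%g (s^-1 * val h)%g)).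
  apply/funext => k; rewrite -fibre_integral_translate /Phi.
  rewrite [W _](coset_weight_invariant cphi cC phiC).
  by rewrite mulrA mulrC.
rewrite (IntZ hH finH); last first.
  have ccF : cc_fun (fun k : HT => hd k ^+ 2 * fibre_integral (s^-1 * val k)%g).
    apply: cc_funM; last by apply: continuous_mulR.
    split.
      apply: continuous_compT fibre_integral_cc.1.
      by apply: continuous_mulg => //; exact: continuous_cst.
    exists ((val : HT -> G) @^-1` [set (x * y)%g | x in [set s] & y in K]).
      by apply: compact_subgroup; exact: (compactM (@compact_set1 _ s) cK).
    move=> k /fibre_integral_supp Kk; exists s => //; exists (s^-1 * val k)%g => //.
    by rewrite mulVKg.
  by under eq_fun do rewrite -fibre_integral_translate.
by rewrite mulr_ge0 ?invr_ge0//; exact: coset_kernel_ge0.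
Qed.

End CosetPositive.

Lemma coset_positive_B_positive :
  coset_positive T -> B_positive muG DeltaG muH DeltaH T.
Proof.
move=> T_pos xi f ccf; apply: cplx_ge0_functional => L hL L_ge0.
by rewrite (integrated_formula ccf xi hL); exact: integrated_form_ge0.
Qed.

End Induction.

Theorem theorem3p8 (R : realType) (G : topGroupType) (lchG : lch G)
    (H : closedSubgroup G)
    (muG : {measure set (borel G) -> \bar R}) (haarG : left_haar muG)
    (DeltaG : G -> R) (modG : modular_function muG DeltaG)
    (muH : {measure set (borel (subgroup_type H)) -> \bar R})
    (haarH : left_haar muH)
    (DeltaH : subgroup_type H -> R) (modH : modular_function muH DeltaH)
    (B : starBundle R G) (bsbB : banach_star_bundle B)
    (Y : hilbertType R) (T : starRep (reduction B H) Y) :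
  ((B_positive muG DeltaG muH DeltaH T <-> coset_positive T) /\
   (coset_positive T <-> unit_fibre_positive T)) /\
  (fell_bundle B ->
   [/\ B_positive muG DeltaG muH DeltaH T, coset_positive T
     & unit_fibre_positive T]).
Proof.
have B_unit := B_positive_unit_fibre_positive lchG haarG modG haarH modH bsbB (T := T).
have unit_coset := unit_fibre_coset_positive bsbB (T := T).
have coset_B := coset_positive_B_positive lchG haarG modG haarH modH bsbB (T := T).
have coset_unit := @coset_positiveW R G H B Y T.
split; first by do 2!split; auto.
move=> fB; have T_pos := fell_unit_fibre_positive T fB.
by split; auto.
Qed.
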